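(* Let $i\ge1$ and $k\ge2$. Then $$i+3\ \le\ \mathrm{ct}\big(M(\mathbb{Z}_k,i)\big)\ \le\ i+3k.$$
   Context: An open cover $\mathcal U$ of a space $Y$ is a good cover if all elements of $\mathcal U$ and all their non-empty finite intersections are contractible. The strict covering type $\mathrm{sct}(Y)$ is the minimal cardinality of a good cover of $Y$, and the covering type of $X$ is $\mathrm{ct}(X):=\min\{\mathrm{sct}(Y)\mid Y\simeq X\}$. $\mathbb{Z}_k$ is the cyclic group of order $k$. $M(\mathbb{Z}_k,1)$ denotes the 2-dimensional CW complex obtained by attaching a 2-cell to a circle by a map of degree $k$, and $M(\mathbb{Z}_k,i)$ is (up to homotopy) its $(i-1)$-fold suspension, a Moore space whose only non-trivial reduced integral homology group is $\mathbb{Z}_k$ in degree $i$. *)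

(* Defs.v *)
From HB Require Import structures.
From mathcomp Require Import all_boot all_order all_algebra generic_quotient.
From mathcomp Require Import all_classical all_reals all_analysis.
From mathcomp Require Import complex.
From Stdlib Require Import Relation_Operators.
Set Implicit Arguments.
Unset Strict Implicit.
Unset Printing Implicit Defensive.
Import Order.TTheory GRing.Theory Num.Theory numFieldNormedType.Exports.
Local Open Scope classical_set_scope.
Local Open Scope ring_scope.

(* [R : realType] is a model of the real numbers.  A [topologicalType] is an
   arbitrary, possibly empty, topological space: the choice structure it
   carries is available on every type since the logic is classical.  A set
   [A : set X] used as a type is [set_type A] with the subspace topology. *)

Section QuotientSpaces.
Local Open Scope quotient_scope.

Section GeneratedEquivalence.
Context {T : Type} (r : T -> T -> Prop).

Definition gen_equiv : rel T := fun x y => `[< clos_refl_sym_trans T r x y >].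

Lemma gen_equiv_refl : reflexive gen_equiv.
Proof. by move=> x; apply/asboolP; exact: rst_refl. Qed.

Lemma gen_equiv_sym : symmetric gen_equiv.
Proof.
by move=> x y; apply/idP/idP => /asboolP xy; apply/asboolP; exact: rst_sym.
Qed.

Lemma gen_equiv_trans : transitive gen_equiv.
Proof.
move=> y x z /asboolP xy /asboolP yz; apply/asboolP.
exact: rst_trans xy yz.
Qed.

Definition gen_equiv_rel : equiv_rel T :=
  EquivRel gen_equiv gen_equiv_refl gen_equiv_sym gen_equiv_trans.
End GeneratedEquivalence.

Definition quotient_space (T : topologicalType) (r : T -> T -> Prop)
    : topologicalType :=
  quotient_topology {eq_quot (gen_equiv_rel r)}.

Definition sum_space (X Y : topologicalType) : topologicalType :=
  {b : bool & (if b then X else Y : topologicalType)}.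

Definition sum_inl (X Y : topologicalType) (x : X) : sum_space X Y :=
  existT (fun b : bool => if b then X else Y : topologicalType) true x.

Definition sum_inr (X Y : topologicalType) (y : Y) : sum_space X Y :=
  existT (fun b : bool => if b then X else Y : topologicalType) false y.

(* For [j] the inclusion of a closed subspace, this is the space obtained from
   [X] by attaching [B] along the map [f]. *)
Definition adjunction_space (S B X : topologicalType) (j : S -> B) (f : S -> X)
    : topologicalType :=
  @quotient_space (sum_space X B)
    (fun p q => exists s : S, p = sum_inl B (f s) /\ q = sum_inr X (j s)).

End QuotientSpaces.

Definition unit_interval (R : realType) : set R := [set t | 0 <= t <= 1].
Arguments unit_interval : clear implicits.

(* Unreduced suspension. *)
Definition suspension (R : realType) (X : topologicalType) : topologicalType :=
  @quotient_space (X * unit_interval R)%type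
    (fun p q => set_val p.2 = set_val q.2 /\
                (set_val p.2 = 0 \/ set_val p.2 = 1)).

Section Homotopy.
Variable R : realType.

Definition homotopic (X Y : topologicalType) (f g : X -> Y) : Prop :=
  exists H : X * unit_interval R -> Y,
    [/\ continuous H,
        (forall x t, set_val t = 0 -> H (x, t) = f x) &
        (forall x t, set_val t = 1 -> H (x, t) = g x)].

Definition homotopy_equivalent (X Y : topologicalType) : Prop :=
  exists (f : X -> Y) (g : Y -> X),
    [/\ continuous f, continuous g,
        homotopic (g \o f) idfun & homotopic (f \o g) idfun].

Definition contractible (X : topologicalType) : Prop :=
  exists x0 : X, homotopic (idfun : X -> X) (cst x0).

End Homotopy.

Section CoveringType.
Variable R : realType.

Definition open_cover (Y : topologicalType) (U : set (set Y)) : Prop :=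
  (forall A, U A -> open A) /\ \bigcup_(A in U) A = [set: Y].

Definition good_cover (Y : topologicalType) (U : set (set Y)) : Prop :=
  [/\ open_cover U,
      (forall A, U A -> contractible R A) &
      (forall V : set (set Y), V `<=` U -> finite_set V -> V !=set0 ->
         \bigcap_(A in V) A !=set0 ->
         contractible R (\bigcap_(A in V) A : set Y))].

(* Both infima below are taken over sets of extended natural numbers, so they
   are minima; the value is [+oo] when there is no finite good cover. *)
Definition sct (Y : topologicalType) : \bar R :=
  ereal_inf [set n%:R%:E | n in
    [set n : nat | exists U : set (set Y), good_cover U /\ (U #= `I_n)%card]].

Definition ct (X : topologicalType) : \bar R :=
  ereal_inf [set e | exists Y : topologicalType,
    homotopy_equivalent R Y X /\ e = sct Y].

End CoveringType.

Section MooreSpaces.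
Variable R : realType.

(* The complex plane with the topology given by its modulus, which takes its
   values in (the real elements of) [R[i]]. *)
Definition plane : numClosedFieldType := R[i].

Definition circle : set plane := [set z | `|z| = 1].
Definition disk : set plane := [set z | `|z| <= 1].

Lemma circle_sub_disk : circle `<=` disk.
Proof. by rewrite /circle /disk => z /= ->. Qed.

Lemma circle_exp (k : nat) (z : plane) : circle z -> circle (z ^+ k).
Proof. by rewrite /circle /= => z1; rewrite normrX z1 expr1n. Qed.

Definition circle_incl (z : circle) : disk :=
  SigSub (mem_set (circle_sub_disk (set_mem (valP z)))).

Definition circle_pow (k : nat) (z : circle) : circle :=
  SigSub (mem_set (circle_exp k (set_mem (valP z)))).

Definition moore_space1 (k : nat) : topologicalType :=
  adjunction_space circle_incl (circle_pow k).

(* M(Z_k, i); only meaningful for [0 < i]. *)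
Definition moore_space (k i : nat) : topologicalType :=
  iter i.-1 (suspension R) (moore_space1 k).

End MooreSpaces.

(* Main.v *)
(* Lower bound: by Mayer-Vietoris and induction on [n], a space with a good
   cover by [n] sets has no reduced homology in degrees [>= n - 1], over any
   ring of coefficients.  Over [Z/k], M(Z_k, i) has non-zero homology in degree
   [i + 1]: the class of the attaching circle dies in the one-dimensional
   skeleton because its image is [k] times a loop, which gives a class of degree
   2 in M(Z_k, 1), and suspension raises the degree by one.  Hence [n >= i + 3].

   Upper bound: if X has a good cover by [n] sets U_j, its suspension has the
   good cover formed of the lower open cone and of the [n] sets obtained by
   adding to the upper open cone a cylinder over U_j reaching down into the
   lower one.  For M(Z_k, 1), cut the disk into a core and [3 k] overlapping
   radial petals, lying over three arcs that cover the boundary circle, and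
   attach to three of the petals the neighbourhoods of these arcs. *)

Require Import Defs.
From mathcomp Require Import all_boot all_order all_algebra generic_quotient.
From mathcomp Require Import all_classical all_reals all_analysis.
From mathcomp Require Import complex ring lra zify.
From Stdlib Require Import Relation_Operators.
Set Implicit Arguments.
Unset Strict Implicit.
Unset Printing Implicit Defensive.
Import Order.TTheory GRing.Theory Num.Theory numFieldNormedType.Exports.
Local Open Scope classical_set_scope.
Local Open Scope ring_scope.

(** * Chains of affine simplices *)

Section Chains.
Variable K : comNzRingType.

(** Homology groups are never formed: the proof only needs that certain cycles do or do not bound.
    Chains therefore stay lists, compared through cochains that see a map only on the standard
    simplex. The lower bound runs downwards: if M(Z_k, i) were acyclic in degree i + 1, undoing the
    suspensions and then one Mayer-Vietoris step inside M(Z_k, 1) would make the fundamental cycle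
    of the circle a boundary, and a last step would join two points in a circle minus two points.
    That cycle is cut into k arcs because the attaching map sends them all to the same singular
    simplex, so that k = 0 in the coefficients kills their sum.

    In the upper bound the obstacle is that contractions live on the product of a quotient with the
    interval; [coherent_homotopy] reduces their continuity to the pieces that are glued. Sectors
    have half-width 2/3 of the spacing of their centres: 2/3 > 1/2 makes neighbours overlap, and 4
    times 2/3 is less than 3, so that two points of one sector never reach another one by going
    round in different ways. A petal can be merged with its arc since the union slides outwards to
    the boundary circle. *)

Definition chain (T : Type) := seq (K * T).

(* Lists denote the same chain when their values under [ev] agree on all
   cochains, or on all admissible ones for singular chains. *)
Definition ev T (l : chain T) (f : T -> K) : K := \sum_(a <- l) a.1 * f a.2.

Definition push T U (g : T -> U) (l : chain T) : chain U :=
  [seq (a.1, g a.2) | a <- l].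

Definition opp T (l : chain T) : chain T := [seq (- a.1, a.2) | a <- l].

Definition bind T U (l : chain T) (g : T -> chain U) : chain U :=
  flatten [seq [seq (a.1 * b.1, b.2) | b <- g a.2] | a <- l].

Definition restrict T (P : T -> Prop) (l : chain T) : chain T :=
  [seq a <- l | `[< P a.2 >]].

Definition supp T (P : T -> Prop) (l : chain T) : bool :=
  all (fun a => `[< P a.2 >]) l.

Section Eval.
Variables T U : Type.
Implicit Types (l : chain T) (f g : T -> K) (P Q : T -> Prop).

Lemma ev_nil f : ev [::] f = 0. Proof. by rewrite /ev big_nil. Qed.

Lemma ev_cons a l f : ev (a :: l) f = a.1 * f a.2 + ev l f.
Proof. by rewrite /ev big_cons. Qed.

Lemma ev_cat l l' f : ev (l ++ l') f = ev l f + ev l' f.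
Proof. by rewrite /ev big_cat. Qed.

Lemma ev_opp l f : ev (opp l) f = - ev l f.
Proof. by rewrite /ev big_map /= -sumrN; apply: eq_bigr => a _; rewrite mulNr. Qed.

Lemma ev_push (h : T -> U) l (f : U -> K) : ev (push h l) f = ev l (f \o h).
Proof. by rewrite /ev big_map. Qed.

Lemma ev_bind l (h : T -> chain U) (f : U -> K) :
  ev (bind l h) f = ev l (fun x => ev (h x) f).
Proof.
rewrite /ev big_flatten /= big_map; apply: eq_bigr => a _.
by rewrite big_map mulr_sumr; apply: eq_bigr => b _; rewrite mulrA.
Qed.

Lemma ev_restrict P l f :
  ev (restrict P l) f = ev l (fun x => if `[< P x >] then f x else 0).
Proof.
rewrite /ev big_filter big_mkcond; apply: eq_bigr => a _.
by case: ifP => // _; rewrite mulr0.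
Qed.

Lemma eq_ev l f g : f =1 g -> ev l f = ev l g.
Proof. by move=> fg; apply: eq_bigr => a _; rewrite fg. Qed.

Lemma evB l f g : ev l (fun x => f x - g x) = ev l f - ev l g.
Proof. by rewrite /ev -sumrB; apply: eq_bigr => a _; rewrite mulrBr. Qed.

Lemma evN l f : ev l (fun x => - f x) = - ev l f.
Proof. by rewrite /ev -sumrN; apply: eq_bigr => a _; rewrite mulrN. Qed.

Lemma ev0 l : ev l (fun=> 0) = 0.
Proof. by rewrite /ev big1// => a _; rewrite mulr0. Qed.

Lemma eq_ev_supp P l f g :
  supp P l -> (forall x, P x -> f x = g x) -> ev l f = ev l g.
Proof.
move=> + fg; elim: l => [|a l IH]; rewrite ?ev_nil//= => /andP[/asboolP Pa Pl].
by rewrite !ev_cons fg// IH.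
Qed.

Lemma supp_cat P l l' : supp P (l ++ l') = supp P l && supp P l'.
Proof. exact: all_cat. Qed.

Lemma supp_opp P l : supp P (opp l) = supp P l.
Proof. by rewrite /supp all_map. Qed.

Lemma supp_push (P : U -> Prop) (h : T -> U) l :
  supp P (push h l) = supp (P \o h) l.
Proof. by rewrite /supp all_map. Qed.

Lemma sub_supp P Q l : (forall x, P x -> Q x) -> supp P l -> supp Q l.
Proof. by move=> PQ; apply: sub_all => a /asboolP /PQ ?; apply/asboolP. Qed.

Lemma suppT P l : (forall x, P x) -> supp P l.
Proof. by move=> HP; elim: l => //= a l ->; rewrite andbT; apply/asboolP. Qed.

Lemma supp_bind P (Q : U -> Prop) l (h : T -> chain U) :
  supp P l -> (forall x, P x -> supp Q (h x)) -> supp Q (bind l h).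
Proof.
move=> + hQ; elim: l => [//|a l IH] /= /andP[/asboolP Pa Pl].
by rewrite /supp all_cat all_map [X in X && _](hQ _ Pa) [X in _ && X](IH Pl).
Qed.

Lemma supp_restrict P Q l : supp Q l -> supp (fun x => P x /\ Q x) (restrict P l).
Proof.
elim: l => [//|a l IH] /= /andP[/asboolP Qa /IH Ql]; rewrite /restrict /=.
by case: ifP => [/asboolP Pa|_] //=; rewrite Ql andbT; apply/asboolP.
Qed.

End Eval.
End Chains.

(** * Affine simplices as matrices: boundary, subdivision, cone homotopies *)

Section MatrixChains.
Variables (K : comNzRingType) (R : realFieldType).
Notation chain := (chain K).

Definition cone m n (b : 'rV[R]_m) (W : 'M[R]_(n, m)) : 'M[R]_(n.+1, m) :=
  col_mx b W.

Lemma cone_ind m n (P : 'M[R]_(n.+1, m) -> Prop) :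
  (forall b W, P (cone b W)) -> forall V, P V.
Proof. by move=> H V; rewrite -[V](@vsubmxK _ 1 n m V); apply: H. Qed.

Lemma cone_mul m m' n (b : 'rV[R]_m) (W : 'M[R]_(n, m)) (A : 'M[R]_(m, m')) :
  cone b W *m A = cone (b *m A) (W *m A).
Proof. exact: (@mul_col_mx _ 1 n m m'). Qed.

(* Rows are vertices; the recursion is d (cone b W) = W - cone b (d W). *)
Fixpoint bdry_mx m n : 'M[R]_(n.+1, m) -> chain 'M[R]_(n, m) :=
  match n with
  | 0 => fun V => [:: (1, dsubmx (V : 'M[R]_(1 + 0, m)))]
  | n'.+1 => fun V => (1, dsubmx (V : 'M[R]_(1 + n'.+1, m))) ::
      opp (push (cone (usubmx (V : 'M[R]_(1 + n'.+1, m))))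
            (bdry_mx (dsubmx (V : 'M[R]_(1 + n'.+1, m)))))
  end.

Lemma ev_bdry_mx_cone0 m b (W : 'M[R]_(0, m)) f : ev (bdry_mx (cone b W)) f = f W.
Proof.
by rewrite /= ev_cons ev_nil addr0 mul1r [dsubmx _](@col_mxKd _ 1 0 m).
Qed.

Lemma ev_bdry_mx_coneS m n b (W : 'M[R]_(n.+1, m)) f :
  ev (bdry_mx (cone b W)) f = f W - ev (bdry_mx W) (f \o cone b).
Proof.
rewrite [bdry_mx _]/= ev_cons mul1r ev_opp ev_push.
by rewrite [dsubmx _](@col_mxKd _ 1 n.+1 m) [usubmx _](@col_mxKu _ 1 n.+1 m).
Qed.

(** By the cone formula, d d (cone b W) = dW - (dW - cone b (d d W)), so the claim descends to
    [W]. *)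
Lemma bdry_mx_bdry_mx m n (V : 'M[R]_(n.+2, m)) f :
  ev (bdry_mx V) (fun U => ev (bdry_mx U) f) = 0.
Proof.
elim: n V f => [|n IH] V f; elim/cone_ind: V => b W; rewrite ev_bdry_mx_coneS.
  elim/cone_ind: W => c W; rewrite !ev_bdry_mx_cone0 /=.
  by rewrite ev_bdry_mx_cone0 subrr.
rewrite [X in _ - X](_ : _ =
    ev (bdry_mx W) (fun U => f U - ev (bdry_mx U) (f \o cone b))); last first.
  by apply: eq_ev => U /=; rewrite ev_bdry_mx_coneS.
by rewrite evB IH subr0 subrr.
Qed.

Lemma bdry_mx_mul m m' n (V : 'M[R]_(n.+1, m)) (A : 'M[R]_(m, m')) f :
  ev (bdry_mx (V *m A)) f = ev (bdry_mx V) (fun U => f (U *m A)).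
Proof.
elim: n V f => [|n IH] V f; elim/cone_ind: V => b W; rewrite cone_mul.
  by rewrite !ev_bdry_mx_cone0.
rewrite !ev_bdry_mx_coneS IH; congr (_ - _).
by apply: eq_ev => U /=; rewrite cone_mul.
Qed.

Definition rowsin m n (C : 'rV[R]_m -> Prop) (V : 'M[R]_(n, m)) :=
  forall i, C (row i V).

Lemma rowsin_cone m n (C : 'rV[R]_m -> Prop) b (W : 'M[R]_(n, m)) :
  rowsin C (cone b W) <-> C b /\ rowsin C W.
Proof.
split=> [H|[Cb CW] i].
  split=> [|i].
    by have := H (lshift n (ord0 : 'I_1)); rewrite (@rowKu _ 1 n) row_id.
  by have := H (rshift 1 i); rewrite (@rowKd _ 1 n).
have [j ->|j ->] := split_ordP (i : 'I_(1 + n)).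
  by rewrite (@rowKu _ 1 n) ord1 row_id.
by rewrite (@rowKd _ 1 n).
Qed.

Lemma supp_bdry_mx m n (C : 'rV[R]_m -> Prop) (V : 'M[R]_(n.+1, m)) :
  rowsin C V -> supp (rowsin C) (bdry_mx V).
Proof.
elim: n V => [|n IH] V; elim/cone_ind: V => b W /rowsin_cone[Cb CW] /=.
  by rewrite andbT; apply/asboolP; rewrite [dsubmx _](@col_mxKd _ 1 0 m).
rewrite [usubmx _](@col_mxKu _ 1 n.+1 m) [dsubmx _](@col_mxKd _ 1 n.+1 m).
rewrite supp_opp supp_push; apply/andP; split; first exact/asboolP.
by apply: sub_supp (IH _ CW) => U CU; apply/rowsin_cone.
Qed.

Definition bary m n (V : 'M[R]_(n, m)) : 'rV[R]_m :=
  n%:R^-1 *: (const_mx 1 *m V).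

Lemma bary_mul m m' n (V : 'M[R]_(n, m)) (A : 'M[R]_(m, m')) :
  bary (V *m A) = bary V *m A.
Proof. by rewrite /bary mulmxA scalemxAl. Qed.

(** Cone from the barycentre over the subdivided boundary. The empty simplex is its own subdivision,
    and hence so is a single vertex. *)
Fixpoint sd m n : 'M[R]_(n, m) -> chain 'M[R]_(n, m) :=
  match n with
  | 0 => fun V => [:: (1, V)]
  | n'.+1 => fun V => push (cone (bary V)) (bind (bdry_mx V) (@sd m n'))
  end.

Lemma sdS m n (V : 'M[R]_(n.+1, m)) :
  sd V = push (cone (bary V)) (bind (bdry_mx V) (@sd m n)).
Proof. by []. Qed.

(** d (cone b (sd dV)) = sd dV - cone b (d sd dV), and by induction the last term is cone b (sd d
    dV) = 0. *)
Lemma sd_bdry_mx m n (V : 'M[R]_(n.+1, m)) f :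
  ev (sd V) (fun W => ev (bdry_mx W) f) = ev (bdry_mx V) (fun U => ev (sd U) f).
Proof.
elim: n V f => [|n IH] V f; rewrite sdS ev_push ev_bind.
  apply: eq_ev => U; apply: eq_ev => W /=.
  by rewrite ev_bdry_mx_cone0.
set b := bary _.
rewrite (_ : (fun U => _) = fun U => ev (sd U) f
   - ev (bdry_mx U) (fun W => ev (sd W) (f \o cone b))).
  by rewrite evB bdry_mx_bdry_mx subr0.
apply/funext => U; rewrite -IH -evB; apply: eq_ev => W /=.
by rewrite ev_bdry_mx_coneS.
Qed.

Lemma sd_mul m m' n (V : 'M[R]_(n, m)) (A : 'M[R]_(m, m')) f :
  ev (sd (V *m A)) f = ev (sd V) (fun U => f (U *m A)).
Proof.
elim: n V f => [|n IH] V f; first by rewrite /= !ev_cons !ev_nil.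
rewrite !sdS !ev_push !ev_bind bdry_mx_mul; apply: eq_ev => U; rewrite IH.
by apply: eq_ev => W /=; rewrite cone_mul bary_mul.
Qed.

(* Natural chain maps that agree on the empty simplex are homotopic, because
   cones are acyclic; this serves both for subdivision and for prisms. *)
Section ConeHomotopy.
Variables m m' : nat.
Variables F G : forall n, 'M[R]_(n, m) -> chain 'M[R]_(n, m').
Variable b : forall n, 'M[R]_(n, m) -> 'rV[R]_m'.

Fixpoint cone_htpy n : 'M[R]_(n, m) -> chain 'M[R]_(n.+1, m') :=
  match n with
  | 0 => fun=> [::]
  | n'.+1 => fun V => push (cone (b V))
      (F V ++ opp (G V) ++ opp (bind (bdry_mx V) (@cone_htpy n')))
  end.

Hypothesis F_dM : forall n (V : 'M[R]_(n.+1, m)) f,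
  ev (F V) (fun W => ev (bdry_mx W) f) = ev (bdry_mx V) (fun U => ev (F U) f).
Hypothesis G_dM : forall n (V : 'M[R]_(n.+1, m)) f,
  ev (G V) (fun W => ev (bdry_mx W) f) = ev (bdry_mx V) (fun U => ev (G U) f).
Hypothesis FG0 : forall (V : 'M[R]_(0, m)) f, ev (F V) f = ev (G V) f.

(** The definition reads D V = cone b (F V - G V - D dV). The boundary of this cone is its base
    minus a cone over d (F V - G V - D dV), which vanishes by induction and d d = 0; in the lowest
    degree [FG0] takes the place of the induction hypothesis. *)
Lemma bdry_mx_cone_htpy n (V : 'M[R]_(n.+1, m)) f :
  ev (cone_htpy V) (fun W => ev (bdry_mx W) f) =
  ev (F V) f - ev (G V) f - ev (bdry_mx V) (fun U => ev (cone_htpy U) f).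
Proof.
have hDE p (W : 'M[R]_(p.+1, m)) g : ev (cone_htpy W) g = let g' := g \o cone (b W) in
    ev (F W) g' - ev (G W) g' - ev (bdry_mx W) (fun U => ev (cone_htpy U) g').
  rewrite (_ : cone_htpy W = push (cone (b W))
      (F W ++ opp (G W) ++ opp (bind (bdry_mx W) (@cone_htpy p))))//.
  by rewrite ev_push !ev_cat !ev_opp ev_bind addrA.
elim: n V f => [|n IH] V f; rewrite hDE /=.
  pose c (U : 'M[R]_(1, m')) := ev (bdry_mx (cone (b V) U)) f.
  have cE : c = fun U => f U - ev (bdry_mx U) (f \o cone (b V)).
    by apply/funext => U; rewrite /c ev_bdry_mx_coneS.
  have hD0 g : ev (bdry_mx V) (fun U => ev (cone_htpy U) g) = 0.
    by rewrite (eq_ev _ (g := fun=> 0)) ?ev0// => U /=; rewrite ev_nil.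
  rewrite (_ : _ \o _ = c)// cE !evB F_dM G_dM !hD0.
  rewrite (eq_ev (bdry_mx V) (fun U => FG0 U (f \o cone (b V)) : _ = (fun U' => ev (G U') (f \o cone (b V))) U)).
  by ring.
pose c (U : 'M[R]_(n.+2, m')) := ev (bdry_mx (cone (b V) U)) f.
have cE : c = fun U => f U - ev (bdry_mx U) (f \o cone (b V)).
  by apply/funext => U; rewrite /c ev_bdry_mx_coneS.
rewrite (_ : _ \o _ = c)// cE !evB F_dM G_dM.
set g := f \o _.
have -> : ev (bdry_mx V) (fun U => ev (cone_htpy U) (fun W => f W - ev (bdry_mx W) g)) =
    ev (bdry_mx V) (fun U => ev (cone_htpy U) f) -
    (ev (bdry_mx V) (fun U => ev (F U) g) - ev (bdry_mx V) (fun U => ev (G U) g)).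
  rewrite -!evB (_ : (fun U => _ ) = fun U => (ev (cone_htpy U) f -
    (ev (F U) g - ev (G U) g)) - (- ev (bdry_mx U) (fun W => ev (cone_htpy W) g))).
    by rewrite evB evN bdry_mx_bdry_mx oppr0 subr0.
  by apply/funext => U; rewrite evB IH; ring.
by ring.
Qed.

End ConeHomotopy.

End MatrixChains.

(** * Convexity and mesh in the standard simplex *)

Section StandardSimplex.
Variable R : realFieldType.

Definition simplex n (x : 'rV[R]_n) : Prop :=
  (forall i, 0 <= x 0 i) /\ \sum_i x 0 i = 1.

Definition cvx m (C : 'rV[R]_m -> Prop) :=
  forall n (x : 'rV[R]_n) (V : 'M[R]_(n, m)),
    simplex x -> rowsin C V -> C (x *m V).

(** Acting on row vectors, these matrices are the affine maps between standard simplices. *)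
Notation stoch := (rowsin (@simplex _)).

Lemma mulmxEsum n m (x : 'rV[R]_n) (V : 'M[R]_(n, m)) j :
  (x *m V) 0 j = \sum_i x 0 i * V i j.
Proof. by rewrite mxE. Qed.

Lemma cvx_simplex m : cvx (@simplex m).
Proof.
move=> n x V [x0 x1] HV; split=> [j|].
  rewrite mulmxEsum; apply: sumr_ge0 => i _; apply: mulr_ge0 => //.
  by have [/(_ j)] := HV i; rewrite mxE.
under eq_bigr => j _ do rewrite mulmxEsum.
rewrite exchange_big /= -[RHS]x1; apply: eq_bigr => i _.
rewrite -mulr_sumr -[RHS]mulr1; congr (_ * _).
by have [_ <-] := HV i; apply: eq_bigr => j _; rewrite mxE.
Qed.

Lemma stoch1 n : stoch (1%:M : 'M[R]_n).
Proof.
move=> i; split=> [j|]; first by rewrite !mxE; case: eqP.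
rewrite (bigD1 i)//= !mxE eqxx big1 ?addr0// => j /negPf ji.
by rewrite !mxE eq_sym ji.
Qed.

Lemma cvx_bary n m (C : 'rV[R]_m -> Prop) (V : 'M[R]_(n.+1, m)) :
  cvx C -> rowsin C V -> C (bary V).
Proof.
move=> cC CV; rewrite /bary scalemxAl; apply: cC => //; split=> [i|].
  by rewrite !mxE mulr1 invr_ge0 ler0n.
under eq_bigr => i _ do rewrite !mxE mulr1.
by rewrite sumr_const card_ord -[_^-1 *+ _]mulr_natr mulVf// pnatr_eq0.
Qed.

Variable K : comNzRingType.

Lemma supp_sd n m (C : 'rV[R]_m -> Prop) (V : 'M[R]_(n, m)) :
  cvx C -> rowsin C V -> supp (rowsin C) (sd K V).
Proof.
move=> cC; elim: n V => [|n IH] V CV; first by rewrite /= andbT; apply/asboolP.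
rewrite sdS supp_push; apply: (@supp_bind _ _ _ (rowsin C)).
  exact: supp_bdry_mx.
move=> U /IH; apply: sub_supp => W CW.
by apply/rowsin_cone; split=> //; apply: cvx_bary.
Qed.

Lemma supp_cone_htpy m m' (F G : forall n, 'M[R]_(n, m) -> chain K 'M[R]_(n, m'))
    (b : forall n, 'M[R]_(n, m) -> 'rV[R]_m')
    (C : 'rV[R]_m -> Prop) (C' : 'rV[R]_m' -> Prop) :
  (forall n (V : 'M[R]_(n, m)), rowsin C V -> supp (rowsin C') (F n V)) ->
  (forall n (V : 'M[R]_(n, m)), rowsin C V -> supp (rowsin C') (G n V)) ->
  (forall n (V : 'M[R]_(n.+1, m)), rowsin C V -> C' (b n.+1 V)) ->
  forall n (V : 'M[R]_(n, m)), rowsin C V -> supp (rowsin C') (cone_htpy F G b V).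
Proof.
move=> hF hG hb; elim=> [//|n IH] V CV.
rewrite (_ : cone_htpy F G b V = push (cone (b _ V))
   (F _ V ++ opp (G _ V) ++ opp (bind (bdry_mx K V) (@cone_htpy K R _ _ F G b n))))//.
rewrite supp_push; apply: (@sub_supp _ _ (rowsin C')).
  by move=> W CW; apply/rowsin_cone; split=> //; apply: hb.
rewrite !supp_cat !supp_opp hF// hG//=.
by apply: (@supp_bind _ _ _ (rowsin C)) => //; apply: supp_bdry_mx.
Qed.

(** Coordinatewise, hence a bound on the diameter in the sup norm, which is the norm behind [ball]
    on row vectors. *)
Definition mesh n m (d : R) (V : 'M[R]_(n, m)) :=
  forall i j k, `|V i k - V j k| <= d.

Lemma cvx_box m (b : 'rV[R]_m) (r : R) :
  cvx (fun v : 'rV_m => forall k, `|b 0 k - v 0 k| <= r).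
Proof.
move=> n x V [x0 x1] HV k; rewrite mulmxEsum -[b 0 k]mul1r -x1 mulr_suml -sumrB.
apply: le_trans (ler_norm_sum _ _ _) _; rewrite -[r]mul1r -x1 mulr_suml.
apply: ler_sum => i _; rewrite -mulrBr normrM ger0_norm//.
by apply: ler_wpM2l => //; have := HV i k; rewrite mxE.
Qed.

(** One of the [n + 1] differences that are averaged is zero, whence the factor n / (n + 1). *)
Lemma mesh_bary n m d (V : 'M[R]_(n.+1, m)) : mesh d V ->
  rowsin (fun v => forall k, `|bary V 0 k - v 0 k| <= (1 - n.+1%:R^-1) * d) V.
Proof.
move=> dV i k; rewrite [row _ _ _ _]mxE /bary [fun_of_matrix (_ *: _) _ _]mxE mulmxEsum.
have n0 : (n.+1%:R : R) != 0 by rewrite pnatr_eq0.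
under eq_bigr => j _ do rewrite mxE mul1r.
have -> : n.+1%:R^-1 * (\sum_j V j k) - V i k =
    n.+1%:R^-1 * \sum_j (V j k - V i k).
  rewrite sumrB mulrBr sumr_const card_ord -[V i k *+ _]mulr_natl mulrA.
  by rewrite mulVf// mul1r.
rewrite normrM ger0_norm ?invr_ge0 ?ler0n//.
rewrite (bigD1 i)//= subrr add0r.
have -> : (1 - n.+1%:R^-1) * d = n.+1%:R^-1 * (n%:R * d).
  by move: n0; rewrite -natr1 => n0; field.
apply: ler_wpM2l; first by rewrite invr_ge0 ler0n.
apply: le_trans (ler_norm_sum _ _ _) _.
have -> : n%:R * d = \sum_(j < n.+1 | j != i) d.
  by rewrite sumr_const -[d *+ _]mulr_natl (cardC1 i) card_ord.
by apply: ler_sum => j _; apply: dV.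
Qed.

Lemma mesh_sd n m d (V : 'M[R]_(n, m)) : 0 <= d ->
  mesh d V -> supp (mesh ((1 - n%:R^-1) * d)) (sd K V).
Proof.
move=> d0; elim: n V => [|n IH] V dV.
  by rewrite /= andbT; apply/asboolP => -[].
set C := fun v : 'rV[R]_m =>
  forall k, `|bary V 0 k - v 0 k| <= (1 - n.+1%:R^-1) * d.
have CV : rowsin C V := mesh_bary dV.
(* The faces have their vertices among those of [V], so their mesh is still at most [d]. *)
pose inV v := exists i, v = row i V.
have inVV : rowsin inV V by move=> i; exists i.
rewrite sdS supp_push.
apply: (@supp_bind _ _ _ (fun U => rowsin C U /\ rowsin inV U)).
  elim: (bdry_mx K V) (supp_bdry_mx K CV) (supp_bdry_mx K inVV) => //= a l IHl.
  move=> /andP[/asboolP ? /IHl{}IHl] /andP[/asboolP ? /IHl ->].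
  by rewrite andbT; apply/asboolP.
move=> U [CU VU].
have dU : mesh d U.
  move=> i j k; have [i' /rowP/(_ k)] := VU i; have [j' /rowP/(_ k)] := VU j.
  by rewrite !mxE => -> ->; apply: dV.
have := IH _ dU; have := supp_sd (@cvx_box _ _ _) CU; rewrite /supp.
elim: (sd K U) => //= a l IHl /andP[/asboolP Ca /IHl{}IHl].
move=> /andP[/asboolP ma /IHl ->]; rewrite andbT; apply/asboolP.
have n10 : (n.+1%:R : R) != 0 by rewrite pnatr_eq0.
have pos : 0 <= (1 - n.+1%:R^-1) * d.
  by apply: mulr_ge0; rewrite // subr_ge0 invf_le1 ?ltr0n// ler1n.
move=> i j k.
have [i' ->|i' ->] := split_ordP (i : 'I_(1 + n));
have [j' ->|j' ->] := split_ordP (j : 'I_(1 + n));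
  rewrite /cone ?(@col_mxEu _ 1 n) ?(@col_mxEd _ 1 n) ?(ord1 i') ?(ord1 j') ?subrr ?normr0//.
- by have := Ca j' k; rewrite [row _ _ _ _]mxE.
- by rewrite distrC; have := Ca i' k; rewrite [row _ _ _ _]mxE.
(* Two vertices off the apex belong to the subdivision of a facet, where induction gives the factor
   1 - 1/n. Here [n] is positive, since [i'] exists, and the factor grows with [n]. *)
- apply: le_trans (ma i' j' k) _; apply: ler_wpM2r => //.
  rewrite lerD2l lerN2 lef_pV2 ?posrE ?ltr0n ?ler_nat//.
  exact: leq_ltn_trans (ltn_ord i').
Qed.

Definition sdI N n m (V : 'M[R]_(n, m)) : chain K 'M[R]_(n, m) :=
  iter N (fun z => bind z (@sd K R m n)) [:: (1, V)].

Lemma ev_sdIS N n m (V : 'M[R]_(n, m)) f :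
  ev (sdI N.+1 V) f = ev (sdI N V) (fun U => ev (sd K U) f).
Proof. exact: ev_bind. Qed.

Lemma ev_sdI0 n m (V : 'M[R]_(n, m)) f : ev (sdI 0 V) f = f V.
Proof. by rewrite ev_cons ev_nil addr0 mul1r. Qed.

Lemma sdI_bdry_mx N n m (V : 'M[R]_(n.+1, m)) f :
  ev (sdI N V) (fun W => ev (bdry_mx K W) f) = ev (bdry_mx K V) (fun U => ev (sdI N U) f).
Proof.
elim: N f => [|N IH] f.
  by rewrite ev_sdI0; apply: eq_ev => U; rewrite ev_sdI0.
rewrite ev_sdIS; under [RHS]eq_ev do rewrite ev_sdIS.
by rewrite -IH; apply: eq_ev => U; apply: sd_bdry_mx.
Qed.

Lemma sdI_mul N m m' n (V : 'M[R]_(n, m)) (A : 'M[R]_(m, m')) f :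
  ev (sdI N (V *m A)) f = ev (sdI N V) (fun U => f (U *m A)).
Proof.
elim: N f => [|N IH] f; first by rewrite !ev_sdI0.
rewrite !ev_sdIS IH; apply: eq_ev => U; exact: sd_mul.
Qed.

Lemma sdI_nil N m (V : 'M[R]_(0, m)) f : ev (sdI N V) f = f V.
Proof.
elim: N f => [|N IH] f; first by rewrite ev_sdI0.
by rewrite ev_sdIS IH /= ev_cons ev_nil mul1r addr0.
Qed.

Lemma supp_sdI N n m (C : 'rV[R]_m -> Prop) d (V : 'M[R]_(n, m)) : 0 <= d ->
  cvx C -> rowsin C V -> mesh d V ->
  supp (fun W => rowsin C W /\ mesh ((1 - n%:R^-1) ^+ N * d) W) (sdI N V).
Proof.
move=> d0 cC CV dV; elim: N => [|N IH].
  by rewrite /= expr0 mul1r andbT; apply/asboolP.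
apply: (supp_bind IH) => W [CW dW].
have c0 : 0 <= (1 - n%:R^-1 : R).
  by case: (n) => [|p]; rewrite ?invr0 ?subr0// subr_ge0 invf_le1 ?ltr0n// ler1n.
have := mesh_sd (mulr_ge0 (exprn_ge0 N c0) d0) dW.
rewrite mulrA -exprS; have := supp_sd cC CW; rewrite /supp.
elim: (sd K W) => //= a l IHl /andP[/asboolP Ca /IHl{}IHl].
by move=> /andP[/asboolP ma /IHl ->]; rewrite andbT; apply/asboolP.
Qed.

Lemma supp_sdI_stoch N n m (V : 'M[R]_(n, m)) :
  stoch V -> supp stoch (sdI N V).
Proof.
move=> sV; elim: N => [|N IH]; first by rewrite /= andbT; apply/asboolP.
by apply: (supp_bind IH) => W; apply: supp_sd; apply: cvx_simplex.
Qed.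

(** Naturality of the homotopy. [B] is the map that [A] induces on the target: [A] itself for
    subdivision, [A] with an identity block for the time coordinate in the case of prisms. *)
Lemma cone_htpy_mul m1 m1' m2 m2' (F1 G1 : forall n, 'M[R]_(n, m1) -> chain K 'M[R]_(n, m1'))
  b1 (F2 G2 : forall n, 'M[R]_(n, m2) -> chain K 'M[R]_(n, m2')) b2
  (A : 'M[R]_(m1, m2)) (B : 'M[R]_(m1', m2')) :
  (forall n (V : 'M[R]_(n, m1)) f, ev (F2 n (V *m A)) f = ev (F1 n V) (fun U => f (U *m B))) ->
  (forall n (V : 'M[R]_(n, m1)) f, ev (G2 n (V *m A)) f = ev (G1 n V) (fun U => f (U *m B))) ->
  (forall n (V : 'M[R]_(n, m1)), b2 n (V *m A) = b1 n V *m B) ->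
  forall n (V : 'M[R]_(n, m1)) f,
    ev (cone_htpy F2 G2 b2 (V *m A)) f = ev (cone_htpy F1 G1 b1 V) (fun U => f (U *m B)).
Proof.
move=> FF GG bb; elim=> [|n IH] V f; first by rewrite !ev_nil.
have hDE m m' (F G : forall n, 'M[R]_(n, m) -> chain K 'M[R]_(n, m')) b
    (W : 'M[R]_(n.+1, m)) g : ev (cone_htpy F G b W) g = let g' := g \o cone (b n.+1 W) in
    ev (F _ W) g' - ev (G _ W) g' - ev (bdry_mx K W) (fun U => ev (cone_htpy F G b U) g').
  rewrite (_ : cone_htpy F G b W = push (cone (b _ W))
      (F _ W ++ opp (G _ W) ++ opp (bind (bdry_mx K W) (@cone_htpy _ _ _ _ F G b n))))//.
  by rewrite ev_push !ev_cat !ev_opp ev_bind addrA.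
rewrite !hDE /= FF GG bdry_mx_mul.
have E : (fun U => (f \o cone (b2 n.+1 (V *m A))) (U *m B)) =
    (fun U => f (U *m B)) \o cone (b1 n.+1 V).
  by apply/funext => U /=; rewrite bb cone_mul.
by rewrite !E; congr (_ - _); apply: eq_ev => U; rewrite IH E.
Qed.

End StandardSimplex.
Notation stoch := (rowsin (@simplex _ _)).

(** * Augmented singular chains and natural operators on them *)

Section SingularChains.
Variables (R : realFieldType) (K : comNzRingType).

(* [n] is the number of vertices: the empty simplex [n = 0] makes the singular
   complex augmented, so that all homology is reduced. *)
Definition simp n (X : Type) := 'rV[R]_n -> X.

Definition act n m X (s : simp m X) (V : 'M[R]_(n, m)) : simp n X :=
  fun x => s (x *m V).

Definition eq_on_simplex n X (s t : simp n X) := forall x, simplex x -> s x = t x.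

(* Values off the standard simplex are junk, which admissible cochains ignore. *)
Definition admissible n X (f : simp n X -> K) := forall s t, eq_on_simplex s t -> f s = f t.

Definition bd n X (s : simp n.+1 X) : chain K (simp n X) :=
  push (act s) (bdry_mx K 1%:M).

Definition bdz n X (z : chain K (simp n.+1 X)) : chain K (simp n X) :=
  bind z (@bd n X).

(** For [n = 0] this is the vanishing of the augmentation: the simplex without vertices has no
    points, so an admissible cochain on [simp 0] is constant. *)
Definition is_cycle n X (z : chain K (simp n.+1 X)) :=
  forall f, admissible f -> ev (bdz z) f = 0.

Section Basics.
Variable X : Type.

Lemma act_act n m p (s : simp p X) (V : 'M[R]_(m, p)) (U : 'M[R]_(n, m)) :
  act (act s V) U = act s (U *m V).
Proof. by apply/funext => x; rewrite /act mulmxA. Qed.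

Lemma act1 n (s : simp n X) : act s 1%:M = s.
Proof. by apply/funext => x; rewrite /act mulmx1. Qed.

Lemma ev_bd_act n m (s : simp m X) (V : 'M[R]_(n.+1, m)) f :
  ev (bd (act s V)) f = ev (bdry_mx K V) (fun U => f (act s U)).
Proof.
rewrite ev_push -[in RHS](mul1mx V) bdry_mx_mul.
by apply: eq_ev => U /=; rewrite act_act.
Qed.

Lemma good_ev_act n m (L : chain K 'M[R]_(n, m)) (f : simp n X -> K) :
  supp stoch L -> admissible f -> admissible (fun s => ev L (fun W => f (act s W))).
Proof.
move=> sL gf s t st; apply: (eq_ev_supp sL) => W sW; apply: gf => x sx.
exact/st/cvx_simplex.
Qed.

Lemma good_bd n (f : simp n X -> K) : admissible f -> admissible (fun s => ev (bd s) f).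
Proof.
move=> gf s t st; rewrite !ev_push; apply: (good_ev_act _ gf st).
by apply: supp_bdry_mx; apply: stoch1.
Qed.

Lemma ev_bdz n (z : chain K (simp n.+1 X)) f :
  ev (bdz z) f = ev z (fun s => ev (bd s) f).
Proof. exact: ev_bind. Qed.

Lemma bdz_bdz n (z : chain K (simp n.+2 X)) f : ev (bdz (bdz z)) f = 0.
Proof.
rewrite !ev_bdz (eq_ev _ (g := fun=> 0)) ?ev0// => s.
rewrite -[in LHS](act1 s) ev_bd_act.
by rewrite -[RHS](bdry_mx_bdry_mx (K := K) 1%:M (fun U => f (act s U))); apply: eq_ev => U; rewrite ev_bd_act.
Qed.

Definition sdz N n (z : chain K (simp n X)) : chain K (simp n X) :=
  bind z (fun s => push (act s) (sdI K N 1%:M)).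

Lemma ev_sdz N n (z : chain K (simp n X)) f :
  ev (sdz N z) f = ev z (fun s => ev (sdI K N 1%:M) (fun W => f (act s W))).
Proof. by rewrite ev_bind; apply: eq_ev => s; rewrite ev_push. Qed.

Lemma bdz_sdz N n (z : chain K (simp n.+1 X)) f :
  ev (bdz (sdz N z)) f = ev (sdz N (bdz z)) f.
Proof.
rewrite !ev_bdz ev_sdz ev_sdz ev_bdz; apply: eq_ev => s.
rewrite (eq_ev _ (g := fun W => ev (bdry_mx K W) (fun U => f (act s U)))); last first.
  by move=> W; rewrite ev_bd_act.
rewrite sdI_bdry_mx -[in RHS](act1 s) ev_bd_act; apply: eq_ev => U.
rewrite -[in LHS](mul1mx U) sdI_mul; apply: eq_ev => W.
by rewrite act_act.
Qed.

Lemma good_sdz N n (f : simp n X -> K) : admissible f ->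
  admissible (fun s => ev (sdI K N 1%:M) (fun W => f (act s W))).
Proof. by move=> gf; apply: good_ev_act => //; apply/supp_sdI_stoch/stoch1. Qed.

End Basics.

Section Operator.
Variables (X Y : Type) (e : nat -> nat).
Variable tau : forall m, simp m X -> simp (e m) Y.
Variable rho : forall m1 m2, 'M[R]_(m1, m2) -> 'M[R]_(e m1, e m2).
Hypothesis tau_act : forall n m (s : simp m X) (V : 'M[R]_(n, m)),
  tau (act s V) = act (tau s) (rho V).
Variables F G : forall m n, 'M[R]_(n, m) -> chain K 'M[R]_(n, e m).
Variable b : forall m n, 'M[R]_(n, m) -> 'rV[R]_(e m).
Hypothesis F_dM : forall m n (V : 'M[R]_(n.+1, m)) f,
  ev (F V) (fun W => ev (bdry_mx K W) f) = ev (bdry_mx K V) (fun U => ev (F U) f).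
Hypothesis G_dM : forall m n (V : 'M[R]_(n.+1, m)) f,
  ev (G V) (fun W => ev (bdry_mx K W) f) = ev (bdry_mx K V) (fun U => ev (G U) f).
Hypothesis FG0 : forall m (V : 'M[R]_(0, m)) f, ev (F V) f = ev (G V) f.
Hypothesis F_mul : forall m m' n (V : 'M[R]_(n, m)) (A : 'M[R]_(m, m')) f,
  ev (F (V *m A)) f = ev (F V) (fun U => f (U *m rho A)).
Hypothesis G_mul : forall m m' n (V : 'M[R]_(n, m)) (A : 'M[R]_(m, m')) f,
  ev (G (V *m A)) f = ev (G V) (fun U => f (U *m rho A)).
Hypothesis b_mul : forall m m' n (V : 'M[R]_(n, m)) (A : 'M[R]_(m, m')),
  b (V *m A) = b V *m rho A.

(** Moves an affine homotopy to singular chains. It is used twice: for subdivision, where [e] and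
    [tau] are identities, and for prisms, where [e m] is [m + 1] and [tau s] is a homotopy
    precomposed with [s] times the identity of the time axis. *)
Definition oper n (s : simp n X) : chain K (simp n.+1 Y) :=
  push (act (tau s)) (cone_htpy (@F n) (@G n) (@b n) 1%:M).

(** The affine formula is applied to the identity matrix. A face of [s] is [s] acted on by some [U],
    and naturality identifies the operator on that face with the affine homotopy of [U] seen through
    [tau s]. *)
Lemma bdz_oper n (z : chain K (simp n.+1 X)) f :
  ev (bdz (bind z (@oper n.+1))) f =
  ev z (fun s => ev (F 1%:M) (fun W => f (act (tau s) W))) -
  ev z (fun s => ev (G 1%:M) (fun W => f (act (tau s) W))) -
  ev (bdz z) (fun s => ev (oper s) f).
Proof.
rewrite !ev_bdz ev_bind -!evB; apply: eq_ev => s; rewrite ev_push.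
rewrite (eq_ev _ (g := fun W => ev (bdry_mx K W) (fun U => f (act (tau s) U)))); last first.
  by move=> W /=; rewrite ev_bd_act.
rewrite bdry_mx_cone_htpy//; congr (_ - _).
rewrite -[in RHS](act1 s) ev_bd_act; apply: eq_ev => U.
rewrite ev_push -[in LHS](mul1mx U).
rewrite (cone_htpy_mul (F1 := @F n) (G1 := @G n) (b1 := @b n) (A := U) (B := rho U))//.
by apply: eq_ev => W /=; rewrite tau_act act_act.
Qed.

End Operator.

End SingularChains.

(** * Continuity within subsets *)

Lemma within_comp (T U W : topologicalType) (D : set T) (E : set U)
    (f : T -> U) (g : U -> W) :
  {within D, continuous f} -> {within E, continuous g} ->
  (forall x, D x -> E (f x)) -> {within D, continuous (g \o f)}.
Proof.
move=> /subspace_continuousP cf /subspace_continuousP cg DE.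
apply/subspace_continuousP => x Dx N nN.
have /(cf x Dx) := cg _ (DE x Dx) N nN.
rewrite /within /nbhs /= => H; near=> y => /= Dy.
have : D y -> E (f y) -> N (g (f y)) by near: y; exact: H.
by apply=> //; apply: DE.
Unshelve. all: by end_near.
Qed.

Lemma continuous_pair (T U W : topologicalType) (f : T -> U) (g : T -> W) :
  continuous f -> continuous g -> continuous (fun x => (f x, g x)).
Proof. by move=> cf cg x; apply: cvg_pair; [apply: cf|apply: cg]. Qed.

Lemma within_pair (T U W : topologicalType) (D : set T) (f : T -> U) (g : T -> W) :
  {within D, continuous f} -> {within D, continuous g} ->
  {within D, continuous (fun x => (f x, g x))}.
Proof. by move=> cf cg x; apply: cvg_pair; [apply: cf|apply: cg]. Qed.

Lemma mx_continuous (T U : topologicalType) m n (f : T -> 'M[U]_(m, n)) :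
  (forall i j, continuous (fun t => f t i j)) -> continuous f.
Proof.
move=> cf t N [P nP PN]; apply: filterS PN _.
by apply: filter_forall => i; apply: filter_forall => j; apply: cf (nP i j).
Qed.

(** * Singular homology *)

Section Continuity.
Variable R : realType.

Lemma mulmx_continuous n m (V : 'M[R]_(n, m)) :
  continuous (fun x : 'rV[R]_n => x *m V).
Proof.
apply: mx_continuous => i j; rewrite (_ : (fun _ => _) =
    (fun x : 'rV[R]_n => \sum_k x i k * V k j)); last first.
  by apply/funext => x; rewrite mxE.
apply: continuous_big => [|k _ x]; first exact: add_continuous.
by apply: cvgMr_tmp; [exact: (nbhs_filter x)|exact: (@coord_continuous R 1 n i k x)].
Qed.

Lemma simplex_compact n : compact [set x : 'rV[R]_n | simplex x].
Proof.
have c1 : compact [set v : 'rV[R]_n | forall i, [set` `[0, 1]] (v ord0 i)].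
  apply: (@rV_compact R n (fun=> [set` `[0, 1]])) => _.
  exact: segment_compact.
apply: (subclosed_compact _ c1).
  have -> : [set x : 'rV[R]_n | simplex x] =
      (\bigcap_(i in [set: 'I_n]) ((fun x : 'rV[R]_n => x 0 i) @^-1` [set t | 0 <= t]))
      `&` ((fun x : 'rV[R]_n => \sum_i x 0 i) @^-1` [set 1]).
    apply/seteqP; split=> x /=; first by move=> [x0 x1]; split=> // i _; apply: x0.
    by move=> [x0 x1]; split=> // i; apply: x0.
  apply: closedI.
    apply: closed_bigI => i _; apply: preimage_closed; last exact: closed_ge.
    by move=> x _; apply: coord_continuous.
  apply: preimage_closed; last exact: closed_eq.
  move=> x _; apply: continuous_big => [|i _]; first exact: add_continuous.
  exact: coord_continuous.
move=> x [x0 x1] i; rewrite /= in_itv /= x0 /= -x1 (bigD1 i)//= lerDl.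
by apply: sumr_ge0.
Qed.

End Continuity.

Section Singular.
Variables (R : realType) (K : comNzRingType).
Local Notation simp := (simp R).
Implicit Types (X Y : topologicalType).

Definition sing X (A : set X) n (s : simp n X) : Prop :=
  {within [set x | simplex x], continuous s} /\ forall x, simplex x -> A (s x).

Arguments sing {X} A {n} s.

Lemma sing_act X (A : set X) n m (C : 'rV[R]_m -> Prop) (s : simp m X)
    (V : 'M[R]_(n, m)) :
  cvx C -> {within [set x | C x], continuous s} -> (forall x, C x -> A (s x)) ->
  rowsin C V -> sing A (act s V).
Proof.
move=> cC cs sA CV; split=> [|x sx]; last exact/sA/cC.
apply: (within_comp _ cs); last by move=> x /= sx; exact: cC.
exact/continuous_subspaceT/mulmx_continuous.
Qed.

Lemma sing_stoch X (A : set X) n m (s : simp m X) (V : 'M[R]_(n, m)) :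
  sing A s -> stoch V -> sing A (act s V).
Proof. by move=> [cs sA]; apply: sing_act cs sA; exact: cvx_simplex. Qed.

Lemma sing_eq_on_simplex X (A : set X) n (s t : simp n X) : eq_on_simplex s t -> sing A s -> sing A t.
Proof.
move=> st [cs sA]; split=> [|x sx]; last by rewrite -st//; exact: sA.
apply: subspace_eq_continuous cs => x; rewrite inE; exact: st.
Qed.

Lemma sub_sing X (A B : set X) n (s : simp n X) : A `<=` B -> sing A s -> sing B s.
Proof. by move=> AB [cs sA]; split=> // x /sA /AB. Qed.

Lemma supp_bdz X (A : set X) n (z : chain K (simp n.+1 X)) :
  supp (sing A) z -> supp (sing A) (bdz z).
Proof.
move=> sz; apply: (supp_bind sz) => s sA; rewrite supp_push.
apply: (@sub_supp _ _ stoch); first by move=> V; apply: sing_stoch.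
exact/supp_bdry_mx/stoch1.
Qed.

Lemma supp_sdz X (A : set X) N n (z : chain K (simp n X)) :
  supp (sing A) z -> supp (sing A) (sdz N z).
Proof.
move=> sz; apply: (supp_bind sz) => s sA; rewrite supp_push.
apply: (@sub_supp _ _ stoch); first by move=> V; apply: sing_stoch.
exact/supp_sdI_stoch/stoch1.
Qed.

Definition bounds X (A : set X) n (z : chain K (simp n.+1 X)) : Prop :=
  exists2 w : chain K (simp n.+2 X), supp (sing A) w &
    forall f, admissible f -> ev (bdz w) f = ev z f.

(* Reduced homology in degree [n] with coefficients in [K] vanishes. *)
Definition acyclic X (A : set X) n : Prop :=
  forall z : chain K (simp n.+1 X), supp (sing A) z -> is_cycle z -> bounds A z.

(** The identity and the [N]-fold subdivision are both natural chain maps, so one cone homotopy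
    joins them directly, without a sum over intermediate subdivisions. The term that involves the
    boundary disappears because [z] is a cycle. *)
Lemma subdivision X (A : set X) N n (z : chain K (simp n.+1 X)) :
  supp (sing A) z -> is_cycle z ->
  exists2 w : chain K (simp n.+2 X), supp (sing A) w &
    forall f, admissible f -> ev (bdz w) f = ev z f - ev (sdz N z) f.
Proof.
move=> sz cz.
pose tau m (s : simp m X) : simp (id m) X := s.
pose rho m1 m2 (V : 'M[R]_(m1, m2)) : 'M[R]_(id m1, id m2) := V.
pose F m n (V : 'M[R]_(n, m)) : chain K 'M[R]_(n, id m) := [:: (1, V)].
pose G m n (V : 'M[R]_(n, m)) : chain K 'M[R]_(n, id m) := sdI K N V.
pose b m n (V : 'M[R]_(n, m)) : 'rV[R]_(id m) := bary V.
have evF p q (V : 'M[R]_(p, q)) f : ev (F q p V) f = f V.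
  by rewrite ev_cons ev_nil mul1r addr0.
have sL p : supp stoch (cone_htpy (@F p) (@G p) (@b p) (1%:M : 'M[R]_p)).
  apply: (@supp_cone_htpy _ _ _ _ _ _ _ (@simplex R p)); last exact: stoch1.
  - by move=> q V sV; rewrite /= andbT; apply/asboolP.
  - by move=> q V; apply: supp_sdI_stoch.
  - by move=> q V; apply: cvx_bary; apply: cvx_simplex.
exists (bind z (oper tau F G b (n := n.+1))).
  apply: (supp_bind sz) => s sA; rewrite supp_push.
  apply: sub_supp (sL _) => V; exact: sing_stoch.
move=> f gf; rewrite (bdz_oper (rho := rho))//.
- rewrite cz ?subr0; last first.
    move=> s t st; rewrite !ev_push.
    by apply: (good_ev_act (sL _) gf st).
  rewrite ev_sdz; congr (_ - _); apply: eq_ev => s.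
  by rewrite evF act1.
- by move=> p q V g; rewrite evF; apply: eq_ev => U; rewrite evF.
- by move=> p q V g; apply: sdI_bdry_mx.
- by move=> p V g; rewrite evF sdI_nil.
- by move=> p q r V A' g; rewrite !evF.
- by move=> p q r V A' g; apply: sdI_mul.
- by move=> p q r V A'; apply: bary_mul.
Qed.

(** Near each point of the simplex every small radius works; compactness makes the radius
    uniform. *)
Lemma lebesgue_number X (A B : set X) n (s : simp n X) : open A -> open B ->
  sing (A `|` B) s -> \forall e \near (0 : R)^'+, forall x, simplex x ->
    (forall y, simplex y -> ball x e y -> A (s y)) \/
    (forall y, simplex y -> ball x e y -> B (s y)).
Proof.
move=> oA oB [/subspace_continuousP cs sAB].
have /compact_near_coveringP/(_ R 0^'+
  (fun e x => (forall y, simplex y -> ball x e y -> A (s y)) \/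
    (forall y, simplex y -> ball x e y -> B (s y)))) := @simplex_compact R n; apply.
move=> x sx.
have key D : open D -> D (s x) -> \forall x' \near x & i \near 0^'+,
    forall y, simplex y -> ball x' i y -> D (s y).
  move=> oD Dx; have := cs x sx _ (open_nbhs_nbhs (conj oD Dx)).
  rewrite /= /within nbhs_simpl /= => /nbhs_ballP[e /= e0 eD].
  exists (ball x (e / 2), [set i | i < e / 2]).
    split; first by apply: nbhsx_ballx; rewrite divr_gt0.
    by apply: nbhs_right_lt; rewrite divr_gt0.
  move=> [x' i] /= [xx' ie] y sy x'y; apply: eD => //.
  rewrite [e]splitr; apply: ball_triangle xx' _.
  by apply: le_ball x'y; apply: ltW.
by case: (sAB x sx) => [/(key _ oA)|/(key _ oB)]; apply: filterS => -[x' i] /=;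
  [left|right].
Qed.

Lemma simplex0 (x : 'rV[R]_0) : ~ simplex x.
Proof. by case=> _ /eqP; rewrite big_ord0 eq_sym oner_eq0. Qed.

Lemma small_simplex X (A B : set X) n (s : simp n X) : open A -> open B ->
  sing (A `|` B) s -> \forall N \near \oo,
    supp (fun V => sing A (act s V) \/ sing B (act s V)) (sdI K N (1%:M : 'M[R]_n)).
Proof.
move=> oA oB sAB.
have [e [e0 He]] : exists e : R, 0 < e /\ forall x, simplex x ->
    (forall y, simplex y -> ball x e y -> A (s y)) \/
    (forall y, simplex y -> ball x e y -> B (s y)).
  apply: (@filter_ex _ (0 : R)^'+).
  by apply: filterI (lebesgue_number oA oB sAB); apply: nbhs_right_gt.
case: n s sAB He => [|n] s sAB He.
  (* The empty simplex has no points, so it is small vacuously. *)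
  apply: nearW => N; apply: suppT => V; left; split.
    by apply/subspace_continuousP => x /simplex0.
  by move=> x /simplex0.
have c0 : 0 <= (1 - n.+1%:R^-1 : R).
  by rewrite subr_ge0 invf_le1 ?ltr0n// ler1n.
have c1 : `|1 - n.+1%:R^-1 : R| < 1.
  by rewrite ger0_norm// ltrBlDr ltrDl invr_gt0 ltr0n.
have := @cvg_geometric R 1 _ c1 => /cvgr_lt/(_ _ e0); apply: filterS => N.
rewrite /geometric /= mul1r => cNe.
have m1 : mesh 1 (1%:M : 'M[R]_n.+1).
  move=> i j k; rewrite !mxE.
  by do 2 case: eqP; rewrite ?subrr ?subr0 ?sub0r ?normrN ?normr0 ?normr1.
apply: sub_supp (supp_sdI K N ler01 (@cvx_simplex R _) (@stoch1 R _) m1) => V.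
rewrite mulr1 => -[sV mV].
(* This set is convex and contains the vertices of [V], hence the whole small simplex; the choice of
   [N] puts it inside the Lebesgue ball around the first vertex. *)
pose C (y : 'rV[R]_n.+1) := simplex y /\ forall k, `|row ord0 V 0 k - y 0 k| <=
  (1 - n.+1%:R^-1) ^+ N.
have cC : cvx C.
  move=> p x W sx CW; split.
    by apply: cvx_simplex => // i; have [] := CW i.
  by apply: (@cvx_box R _ (row ord0 V)) => // i; have [] := CW i.
have CV : rowsin C V.
  by move=> i; split; [exact: sV|move=> k; rewrite !mxE; apply: mV].
have CB y : C y -> ball (row ord0 V) e y.
  move=> [_ Hy]; split=> // i j; rewrite ord1; apply: le_lt_trans cNe; exact: Hy.
have [cs _] := sAB.
have csC : {within [set x | C x], continuous s}.
  by apply: continuous_subspaceW cs => x [].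
by case: (He _ (sV ord0)) => H; [left|right]; apply: (sing_act cC csC) CV => x Cx;
  apply: H; by [case: Cx|apply: CB].
Qed.

Lemma small_simplices X (A B : set X) n (z : chain K (simp n X)) :
  open A -> open B -> supp (sing (A `|` B)) z ->
  \forall N \near \oo, supp (fun s => sing A s \/ sing B s) (sdz N z).
Proof.
move=> oA oB; elim: z => [_|[k s] z IH /andP[/= /asboolP sAB /IH sz]].
  by apply: nearW.
have key := small_simplex oA oB sAB.
near=> N.
rewrite /sdz /bind /= -/(bind _ _) -/(sdz N z) /supp all_cat; apply/andP; split.
  rewrite !all_map /=; near: N; apply: filterS key => N.
  by rewrite /supp.
near: N; exact: sz.
Unshelve. all: by end_near. Qed.

End Singular.

Arguments sing {R X} A {n} s.
Arguments bounds {R K X} A {n} z.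
Arguments acyclic R K {X} A n.

(** * Homotopy invariance, Mayer-Vietoris and acyclic covers *)

Section Homology.
Variables (R : realType) (K : comNzRingType).
Local Notation simp := (simp R).
Local Notation I01 := (unit_interval R).
Implicit Types (X Y : topologicalType).

(** For maps applied vertex by vertex that are not products with a matrix, such as the inclusion of
    a simplex at time 1, to which [bdry_mx_mul] does not apply. *)
Lemma bdry_mx_rowmap (h : forall n m, 'M[R]_(n, m) -> 'M[R]_(n, m + 1)) m n
    (V : 'M[R]_(n.+1, m)) (f : _ -> K) :
  (forall p b (W : 'M[R]_(p, m)), h p.+1 m (cone b W) = cone (h 1%N m b) (h p m W)) ->
  ev (bdry_mx K (h _ _ V)) f = ev (bdry_mx K V) (fun U => f (h _ _ U)).
Proof.
move=> hc; elim: n V f => [|n IH] V f; elim/cone_ind: V => b W; rewrite hc.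
  by rewrite !ev_bdry_mx_cone0.
rewrite !ev_bdry_mx_coneS IH; congr (_ - _).
by apply: eq_ev => U /=; rewrite hc.
Qed.

(** The prism operator, obtained as the cone homotopy between the inclusions of the simplex at times
    1 and 0. *)
Lemma homotopy_bounds X Y (A : set X) (B : set Y) (H : X -> R -> Y) n
    (z : chain K (simp n.+1 X)) :
  {within A `*` I01, continuous (fun p => H p.1 p.2)} ->
  (forall x t, A x -> I01 t -> B (H x t)) ->
  supp (sing A) z -> is_cycle z ->
  exists2 w : chain K (simp n.+2 Y), supp (sing B) w &
    forall f, admissible f -> ev (bdz w) f =
      ev z (fun s => f (H^~ 1 \o s)) - ev z (fun s => f (H^~ 0 \o s)).
Proof.
move=> cH HB sz cz.
pose tau m (s : simp m X) : simp (m + 1) Y :=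
  fun x => H (s (lsubmx x)) (rsubmx x 0 0).
pose rho m1 m2 (V : 'M[R]_(m1, m2)) : 'M[R]_(m1 + 1, m2 + 1) :=
  block_mx V 0 0 1%:M.
pose i1 n m (V : 'M[R]_(n, m)) : 'M[R]_(n, m + 1) := row_mx V (const_mx 1).
pose i0 n m (V : 'M[R]_(n, m)) : 'M[R]_(n, m + 1) := row_mx V 0.
pose F m n (V : 'M[R]_(n, m)) : chain K 'M[R]_(n, m + 1) := [:: (1, i1 n m V)].
pose G m n (V : 'M[R]_(n, m)) : chain K 'M[R]_(n, m + 1) := [:: (1, i0 n m V)].
(* Each prism is coned off from the barycentre of its bottom face. *)
pose b m n (V : 'M[R]_(n, m)) : 'rV[R]_(m + 1) := bary (i0 n m V).
pose C m (x : 'rV[R]_(m + 1)) := simplex (lsubmx x) /\ I01 (rsubmx x 0 0).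
have evF p q (V : 'M[R]_(p, q)) f : ev (F q p V) f = f (i1 p q V).
  by rewrite ev_cons ev_nil mul1r addr0.
have evG p q (V : 'M[R]_(p, q)) f : ev (G q p V) f = f (i0 p q V).
  by rewrite ev_cons ev_nil mul1r addr0.
have i1M p q r (V : 'M[R]_(p, q)) (U : 'M[R]_(q, r)) :
    i1 _ _ (V *m U) = i1 _ _ V *m rho _ _ U.
  by rewrite /i1 /rho mul_row_block !mulmx0 addr0 add0r mulmx1.
have i0M p q r (V : 'M[R]_(p, q)) (U : 'M[R]_(q, r)) :
    i0 _ _ (V *m U) = i0 _ _ V *m rho _ _ U.
  by rewrite /i0 /rho mul_row_block !mulmx0 addr0 add0r mulmx1.
have i1c q p c (W : 'M[R]_(p, q)) :
    i1 p.+1 q (cone c W) = cone (i1 1%N q c) (i1 p q W).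
  rewrite /i1 /cone -[RHS](@block_mxEv _ 1 p q 1) block_mxEh; congr row_mx.
  apply/matrixP => x y; rewrite mxE.
  by have [x' ->|x' ->] := split_ordP (x : 'I_(1 + p));
    rewrite ?(@col_mxEu _ 1 p) ?(@col_mxEd _ 1 p) mxE.
have i0c q p c (W : 'M[R]_(p, q)) :
    i0 p.+1 q (cone c W) = cone (i0 1%N q c) (i0 p q W).
  rewrite /i0 /cone -[RHS](@block_mxEv _ 1 p q 1) block_mxEh; congr row_mx.
  by rewrite (@col_mx0 _ 1 p).
have row_l m p i (V : 'M[R]_(p, m + 1)) : row i (lsubmx V) = lsubmx (row i V).
  by apply/rowP => j; rewrite !mxE.
have row_r m p i (V : 'M[R]_(p, m + 1)) : row i (rsubmx V) = rsubmx (row i V).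
  by apply/rowP => j; rewrite !mxE.
have cC m : cvx (@C m).
  move=> p x V sx CV; rewrite /C -[V]hsubmxK mul_mx_row row_mxKl row_mxKr.
  split; first by apply: cvx_simplex => // i; have [+ _] := CV i; rewrite row_l.
  have Vi i : I01 (rsubmx V i 0) by have [_ +] := CV i; rewrite -row_r mxE.
  have [x0 x1] := sx; rewrite /unit_interval /= mulmxEsum; apply/andP; split.
    by apply: sumr_ge0 => i _; apply: mulr_ge0 => //; have /andP[] := Vi i.
  rewrite -x1; apply: ler_sum => i _; rewrite -[leRHS]mulr1.
  by apply: ler_wpM2l => //; have /andP[] := Vi i.
have Ci1 p q (V : 'M[R]_(p, q)) : stoch V -> rowsin (@C q) (i1 p q V).
  move=> sV i; rewrite /C /i1 row_row_mx row_mxKl row_mxKr; split=> //.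
  by rewrite /unit_interval /= !mxE ler01 lexx.
have Ci0 p q (V : 'M[R]_(p, q)) : stoch V -> rowsin (@C q) (i0 p q V).
  move=> sV i; rewrite /C /i0 row_row_mx row_mxKl row_mxKr; split=> //.
  by rewrite /unit_interval /= !mxE ler01 lexx.
have sL p : supp (rowsin (@C p)) (cone_htpy (@F p) (@G p) (@b p) (1%:M : 'M[R]_p)).
  apply: (@supp_cone_htpy _ _ _ _ _ _ _ (@simplex R p)); last exact: stoch1.
  - by move=> q V sV; rewrite /= andbT; apply/asboolP/Ci1.
  - by move=> q V sV; rewrite /= andbT; apply/asboolP/Ci0.
  - by move=> q V /Ci0; apply: cvx_bary.
(* Barycentric coordinates add up to 1, so the column of ones places every point of the simplex at
   time 1. *)
have ends m (x : 'rV[R]_m) : simplex x -> x *m const_mx 1 = (const_mx 1 : 'M[R]_1).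
  move=> [_ x1]; apply/matrixP => i j; rewrite !ord1 mulmxEsum mxE -[RHS]x1.
  by apply: eq_bigr => k _; rewrite mxE mulr1.
exists (bind z (oper tau F G b (n := n.+1))).
  apply: (supp_bind sz) => s [cs sA]; rewrite supp_push.
  apply: sub_supp (sL _) => V CV.
  apply: (sing_act (@cC _) _ _ CV); last first.
    by move=> x [/sA ? ?]; apply: HB.
  apply: (@within_comp _ _ _ _ (A `*` I01)
    (fun x => (s (lsubmx x), rsubmx x 0 0)) (fun p => H p.1 p.2)) => //; last first.
    by move=> x [/sA].
  apply: within_pair.
    apply: (within_comp _ cs); last by move=> x [].
    apply: continuous_subspaceT; apply: mx_continuous => i j.
    rewrite (_ : (fun _ => _) = fun t : 'rV[R]_(n.+1 + 1) => t i (lshift 1 j)).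
      exact: coord_continuous.
    by apply/funext => t; rewrite mxE.
  apply: continuous_subspaceT.
  rewrite (_ : (fun _ => _) = fun t : 'rV[R]_(n.+1 + 1) => t 0 (rshift n.+1 0)).
    exact: coord_continuous.
  by apply/funext => t; rewrite mxE.
move=> f gf; rewrite (bdz_oper (rho := rho)).
- rewrite cz ?subr0; last first.
    move=> s t st; rewrite !ev_push; apply: (eq_ev_supp (sL _)) => W CW.
    apply: gf => x sx; rewrite /act /tau; congr (H _ _); apply: st.
    by have [] := cC _ _ _ _ sx CW.
  congr (_ - _); apply: eq_ev => s; rewrite ?evF ?evG; apply: gf => x sx.
    by rewrite /act /tau /= mul_mx_row mulmx1 row_mxKl row_mxKr ends// mxE.
  by rewrite /act /tau /= mul_mx_row mulmx1 row_mxKl row_mxKr mulmx0 mxE.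
- move=> p q s V; apply/funext => x; rewrite /tau /act /rho.
  rewrite -[in RHS](hsubmxK x) mul_row_block !mulmx0 addr0 add0r mulmx1.
  by rewrite row_mxKl row_mxKr.
- move=> p q V g; rewrite evF bdry_mx_rowmap//.
  by apply: eq_ev => U; rewrite evF.
- move=> p q V g; rewrite evG bdry_mx_rowmap//.
  by apply: eq_ev => U; rewrite evG.
- by move=> p V g; rewrite evF evG; congr g; apply/matrixP => -[].
- by move=> p q r V A' g; rewrite !evF i1M.
- by move=> p q r V A' g; rewrite !evG i0M.
- by move=> p q r V A'; rewrite /b i0M bary_mul.
Qed.

Lemma sing_comp X Y (A : set X) (B : set Y) (f : X -> Y) n (s : simp n X) :
  {within A, continuous f} -> (forall x, A x -> B (f x)) ->
  sing A s -> sing B (f \o s).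
Proof.
move=> cf AB [cs sA]; split=> [|x /sA /AB//].
exact: within_comp cs cf sA.
Qed.

Lemma bdz_push X Y (f : X -> Y) n (z : chain K (simp n.+1 X)) (phi : simp n Y -> K) :
  ev (bdz (push (fun s => f \o s) z)) phi = ev (bdz z) (fun s => phi (f \o s)).
Proof.
by rewrite !ev_bdz ev_push; apply: eq_ev => s /=; rewrite !ev_push.
Qed.

Lemma good_comp X Y (f : X -> Y) n (phi : simp n Y -> K) :
  admissible phi -> admissible (fun s : simp n X => phi (f \o s)).
Proof. by move=> gp s t st; apply: gp => x /st /= ->. Qed.

Lemma cycle_push X Y (f : X -> Y) n (z : chain K (simp n.+1 X)) :
  is_cycle z -> is_cycle (push (fun s => f \o s) z).
Proof. by move=> cz phi gp; rewrite bdz_push cz//; apply: good_comp. Qed.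

Lemma ev_bdz_cat X n (z w : chain K (simp n.+1 X)) f :
  ev (bdz (z ++ w)) f = ev (bdz z) f + ev (bdz w) f.
Proof. by rewrite !ev_bdz ev_cat. Qed.

Lemma ev_bdz_opp X n (z : chain K (simp n.+1 X)) f :
  ev (bdz (opp z)) f = - ev (bdz z) f.
Proof. by rewrite !ev_bdz ev_opp. Qed.

Lemma ev_bdry_mx_cst n m (V : 'M[R]_(n.+1, m)) (c : K) :
  ev (bdry_mx K V) (fun=> c) = if odd n then 0 else c.
Proof.
elim: n V => [|n IH] V; elim/cone_ind: V => b W; first by rewrite ev_bdry_mx_cone0.
rewrite ev_bdry_mx_coneS (_ : _ \o _ = fun=> c)// IH /=.
by case: odd => /=; rewrite ?subr0 ?subrr.
Qed.

Lemma sing_cst X (A : set X) a n : A a -> sing A (fun _ : 'rV[R]_n => a).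
Proof. by move=> Aa; split=> [x|//]; apply: cvg_cst. Qed.

(** The image is e times one constant simplex, e being the sum of the coefficients of [z]. For [n]
    odd the constant simplex is the boundary of the next one; for [n] even that boundary is zero,
    but testing the cycle condition on the constant cochain 1 gives e = 0. *)
Lemma cst_bounds X Y (B : set Y) (y : Y) n (z : chain K (simp n.+1 X)) :
  B y -> is_cycle z -> bounds B (push (fun s => cst y \o s) z).
Proof.
move=> By cz.
pose c p : simp p Y := fun=> y.
have bdc p (f : _ -> K) : ev (bd K (c p.+1)) f = if odd p then 0 else f (c p).
  by rewrite ev_push -(ev_bdry_mx_cst (1%:M : 'M[R]_p.+1)).
exists [:: (ev z (fun=> 1), c n.+2)].
  by rewrite /= andbT; apply/asboolP/sing_cst.
move=> f gf; rewrite ev_bdz ev_cons ev_nil addr0 bdc /=.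
have -> : ev (push (fun s : simp n.+1 X => cst y \o s) z) f =
    ev z (fun=> 1) * f (c n.+1).
  rewrite ev_push /ev mulr_suml; apply: eq_bigr => a _.
  by rewrite mulr1.
case: (boolP (odd n)) => [//|n2] /=.
have : ev (bdz z) (fun=> 1) = 0 by apply: cz.
rewrite ev_bdz (eq_ev _ (g := fun=> 1)) => [->|s]; first by rewrite mulr0 mul0r.
rewrite -[RHS](_ : (if odd n then 0 else 1) = _); last by rewrite (negbTE n2).
by rewrite -(ev_bdry_mx_cst (1%:M : 'M[R]_n.+1)) ev_push.
Qed.

Lemma nullhomotopic_bounds X Y (A : set X) (B : set Y) (H : X -> R -> Y) y n
    (z : chain K (simp n.+1 X)) :
  {within A `*` I01, continuous (fun p => H p.1 p.2)} ->
  (forall x t, A x -> I01 t -> B (H x t)) ->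
  (forall x, A x -> H x 1 = y) -> B y ->
  supp (sing A) z -> is_cycle z ->
  bounds B (push (fun s => H^~ 0 \o s) z).
Proof.
move=> cH HB H1 By sz cz.
have [w sw bw] := homotopy_bounds cH HB sz cz.
have [v sv bv] := cst_bounds By cz.
exists (v ++ opp w); first by rewrite supp_cat supp_opp sv.
move=> f gf; rewrite ev_bdz_cat ev_bdz_opp bv// bw// !ev_push.
rewrite (eq_ev_supp (f := fun s => f (H^~ 1 \o s)) (g := fun s => f (cst y \o s)) sz).
  by rewrite opprB addrCA subrr addr0.
by move=> s [_ sA]; apply: gf => x /sA /H1.
Qed.

(** Passes from the product of subtypes, on which the contractions of subsets are given, to total
    functions of a point and a real time. *)
Lemma within_setX X Y (A : set X) (h : A * I01 -> Y) (H : X -> R -> Y) :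
  continuous h -> (forall (x : A) (t : I01), H (set_val x) (set_val t) = h (x, t)) ->
  {within A `*` I01, continuous (fun p => H p.1 p.2)}.
Proof.
move=> ch hH; apply/subspace_sigL_continuousP.
rewrite (_ : sigL _ _ = h \o @setX_of_sigT _ _ A I01).
  by move=> p; apply: continuous_comp; [exact: setX_of_sigT_continuous|exact: ch].
apply/funext => -[[x t] p]; have [Ax It] := set_mem p.
pose x' : A := SigSub (mem_set Ax); pose t' : I01 := SigSub (mem_set It).
rewrite /sigL /= (_ : setX_of_sigT _ _ _ = (x', t')) ?hH//=.
  by rewrite -hH.
by congr pair; apply/val_inj.
Qed.

Lemma raw_contraction X (A : set X) : contractible R A ->
  exists (x0 : X) (H : X -> R -> X),
    [/\ A x0, {within A `*` I01, continuous (fun p => H p.1 p.2)},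
      (forall x t, A x -> I01 t -> A (H x t)),
      (forall x, H x 0 = x) & (forall x, H x 1 = x0)].
Proof.
move=> [x0 [h [ch h0 h1]]].
(* Outside [A] the values are chosen so that the equations at times 0 and 1 hold for every [x]. *)
pose H (x : X) (t : R) : X := if pselect (A x) is left Ax then
    if pselect (I01 t) is left It then
      set_val (h (SigSub (mem_set Ax), SigSub (mem_set It)))
    else x else if t == 0 then x else set_val x0.
have I0 : I01 0 by rewrite /unit_interval /= lexx ler01.
have I1 : I01 1 by rewrite /unit_interval /= lexx ler01.
have HE (x : A) (t : I01) : H (set_val x) (set_val t) = set_val (h (x, t)).
  rewrite /H; case: pselect => [Ax|]; last by case; apply: set_valP.
  case: pselect => [It|]; last by case; apply: set_valP.
  by congr (set_val (h _)); congr pair; apply/val_inj.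
exists (set_val x0), H; split; first exact: set_valP.
- apply: (@within_setX _ _ _ (set_val \o h)) => // p.
  by apply: continuous_comp; [exact: ch|exact: initial_continuous].
- move=> x t Ax It; have := HE (SigSub (mem_set Ax)) (SigSub (mem_set It)).
  rewrite /= => ->; exact: set_valP.
- move=> x; rewrite /H; case: pselect => [Ax|_]; last by rewrite eqxx.
  by case: pselect => // I0'; rewrite h0.
- move=> x; rewrite /H; case: pselect => [Ax|_]; last by rewrite oner_eq0.
  by case: pselect => // I1'; rewrite h1.
Qed.

Lemma contractible_acyclic X (A : set X) n : contractible R A -> acyclic R K A n.
Proof.
move=> /raw_contraction[x0 [H [Ax0 cH HA H0 H1]]] z sz cz.
have [w sw bw] := nullhomotopic_bounds cH HA (fun x _ => H1 x) Ax0 sz cz.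
exists w => // f gf; rewrite bw// ev_push; apply: eq_ev => s; congr f.
by apply/funext => x /=; rewrite H0.
Qed.

Lemma homotopic_bounds X Y (f g : X -> Y) n (z : chain K (simp n.+1 X)) :
  homotopic R f g -> supp (sing setT) z -> is_cycle z ->
  exists2 w : chain K (simp n.+2 Y), supp (sing setT) w &
    forall phi, admissible phi -> ev (bdz w) phi =
      ev z (fun s => phi (g \o s)) - ev z (fun s => phi (f \o s)).
Proof.
move=> [h [ch h0 h1]] sz cz.
pose H (x : X) (t : R) : Y :=
  if pselect (I01 t) is left It then h (x, SigSub (mem_set It)) else f x.
have HE (x : [set: X]) (t : I01) :
    H (set_val x) (set_val t) = h (set_val x, t).
  rewrite /H; case: pselect => [It|]; last by case; apply: set_valP.
  by congr (h (_, _)); apply/val_inj.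
have [||//|//|w sw bw] := @homotopy_bounds X Y setT setT H n z.
- apply: (@within_setX _ _ _ (fun p => h (set_val p.1, p.2))) => // p.
  apply: (@continuous_comp _ _ _ (fun p : [set: X] * I01 => (set_val p.1, p.2))).
    move: p; apply: continuous_pair => p; last exact: cvg_snd.
    apply: (@continuous_comp _ _ _ (@fst [set: X] I01) set_val); first exact: cvg_fst.
    exact: initial_continuous.
  exact: ch.
- by [].
exists w => // phi gp; rewrite bw//; congr (_ - _); apply: eq_ev => s; congr phi;
  apply/funext => x; rewrite /= /H; case: pselect => It.
- by rewrite h1.
- by case: It; rewrite /unit_interval /= lexx ler01.
- by rewrite h0.
- by [].
Qed.

Lemma homotopy_equivalent_acyclic X Y n :
  homotopy_equivalent R Y X -> acyclic R K [set: Y] n -> acyclic R K [set: X] n.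
Proof.
move=> [f [g [cf cg gf fg]]] aY z sz cz.
have sgz : supp (sing setT) (push (fun s => g \o s) z).
  rewrite supp_push; apply: sub_supp sz => s; apply: sing_comp => //.
  exact: continuous_subspaceT.
have [w sw bw] := aY _ sgz (cycle_push g cz).
have [v sv bv] := homotopic_bounds fg sz cz.
exists (push (fun s => f \o s) w ++ v).
  rewrite supp_cat sv andbT supp_push; apply: sub_supp sw => s.
  by apply: sing_comp => //; exact: continuous_subspaceT.
move=> phi gp; rewrite ev_bdz_cat bdz_push bw; last exact: good_comp.
by rewrite bv// ev_push addrC subrK.
Qed.

Lemma supp_setI X (A B : set X) n (u v : chain K (simp n X)) :
  supp (sing A) u -> supp (sing B) v ->
  (forall f, admissible f -> ev u f = ev v f) ->
  exists2 w, supp (sing (A `&` B)) w & forall f, admissible f -> ev w f = ev u f.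
Proof.
move=> su sv uv; exists (restrict (sing B) u).
  apply: sub_supp (supp_restrict (sing B) su) => s [[cs sB] [_ sA]].
  by split=> // x sx; split; [exact: sA|exact: sB].
move=> f gf; rewrite ev_restrict uv.
  rewrite uv//; apply: (eq_ev_supp sv) => s sB.
  by rewrite asboolT.
move=> s t st; rewrite (gf _ _ st).
have -> // : `[< sing B s >] = `[< sing B t >].
apply/asbool_equiv_eq; split; apply: sing_eq_on_simplex => // x sx; by rewrite st.
Qed.

Lemma split_small X (A B : set X) n (z : chain K (simp n X)) :
  supp (fun s => sing A s \/ sing B s) z ->
  exists u v, [/\ supp (sing A) u, supp (sing B) v &
    forall f, ev z f = ev u f + ev v f].
Proof.
elim: z => [_|[k s] z IH].
  by exists [::], [::]; split=> // f; rewrite ev_nil addr0.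
move=> /= /andP[/asboolP[sA|sB] /IH[u [v [su sv E]]]].
  exists ((k, s) :: u), v; split=> //=; first by rewrite su andbT; apply/asboolP.
  by move=> f; rewrite !ev_cons E addrA.
exists u, ((k, s) :: v); split=> //=; first by rewrite sv andbT; apply/asboolP.
by move=> f; rewrite !ev_cons E addrCA.
Qed.

Lemma subdivide_split X (A B : set X) n (z : chain K (simp n X)) :
  open A -> open B -> supp (sing (A `|` B)) z ->
  \forall N \near \oo, exists u v, [/\ supp (sing A) u, supp (sing B) v &
    forall f, ev (sdz N z) f = ev u f + ev v f].
Proof.
move=> oA oB sz; apply: filterS (small_simplices oA oB sz) => N.
exact: split_small.
Qed.

Lemma bdz_sdz_good X N n (w : chain K (simp n.+2 X)) (z : chain K (simp n.+1 X)) :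
  (forall f, admissible f -> ev (bdz w) f = ev z f) ->
  forall f, admissible f -> ev (bdz (sdz N w)) f = ev (sdz N z) f.
Proof. by move=> wz f gf; rewrite bdz_sdz !ev_sdz wz//; apply: good_sdz. Qed.

(** Subdivide the cycle as u + v. Then du = -dv lies in the intersection and bounds some q there,
    and the cycles u - q and v + q bound in [A] and in [B]. *)
Lemma mayer_vietoris_acyclic X (A B : set X) n : open A -> open B ->
  acyclic R K A n.+1 -> acyclic R K B n.+1 -> acyclic R K (A `&` B) n ->
  acyclic R K (A `|` B) n.+1.
Proof.
move=> oA oB aA aB aAB z sz cz.
have [N [u [v [su sv E]]]] := filter_ex (subdivide_split oA oB sz).
have [w0 sw0 bw0] := subdivision N sz cz.
have csd f : admissible f -> ev (bdz (sdz N z)) f = 0.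
  by move=> gf; rewrite bdz_sdz ev_sdz cz//; apply: good_sdz.
have buv f : admissible f -> ev (bdz u) f = - ev (bdz v) f.
  move=> gf; apply/eqP; rewrite -addr_eq0 !ev_bdz -E -ev_bdz csd//.
have [c sc Ec] : exists2 c, supp (sing (A `&` B)) c &
    forall f, admissible f -> ev c f = ev (bdz u) f.
  apply: (@supp_setI _ A B n.+1 (bdz u) (opp (bdz v))).
  - exact: supp_bdz.
  - by rewrite supp_opp; apply: supp_bdz.
  - by move=> f gf; rewrite ev_opp buv.
have cc : is_cycle c.
  move=> f gf; rewrite ev_bdz Ec; first by rewrite -ev_bdz bdz_bdz.
  exact: good_bd.
have [q sq bq] := aAB c sc cc.
have sAB (D : set X) : (A `&` B) `<=` D -> supp (sing D) q.
  by move=> sub; apply: sub_supp sq => s; apply: sub_sing.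
have [p1 sp1 bp1] : bounds A (u ++ opp q).
  apply: aA; first by rewrite supp_cat supp_opp su sAB// => x [].
  by move=> f gf; rewrite ev_bdz_cat ev_bdz_opp bq// Ec// subrr.
have [p2 sp2 bp2] : bounds B (v ++ q).
  apply: aB; first by rewrite supp_cat sv sAB// => x [].
  by move=> f gf; rewrite ev_bdz_cat bq// Ec// buv// subrr.
exists (w0 ++ p1 ++ p2).
  rewrite !supp_cat sw0/=; apply/andP; split.
    by apply: sub_supp sp1 => s; apply: sub_sing => x; left.
  by apply: sub_supp sp2 => s; apply: sub_sing => x; right.
move=> f gf; rewrite !ev_bdz_cat bw0// bp1// bp2// !ev_cat ev_opp E.
by ring.
Qed.

(** The connecting map, which sends the class of a cycle a + b to that of da, is well defined on
    homology. Each use goes down one degree: from a suspension to its equator, from the Moore space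
    to an annulus, from the circle to two arcs. *)
Lemma mayer_vietoris_boundary X (A B : set X) n (a b : chain K (simp n.+2 X))
    (w : chain K (simp n.+3 X)) (c : chain K (simp n.+1 X)) :
  open A -> open B -> supp (sing A) a -> supp (sing B) b ->
  supp (sing (A `|` B)) w ->
  (forall f, admissible f -> ev (bdz w) f = ev a f + ev b f) ->
  supp (sing (A `&` B)) c -> (forall f, admissible f -> ev c f = ev (bdz a) f) ->
  bounds (A `&` B) c.
Proof.
move=> oA oB sa sb sw bw sc Ec.
have [N [u [v [su sv E]]]] := filter_ex (subdivide_split oA oB sw).
have cc : is_cycle c.
  move=> f gf; rewrite ev_bdz Ec; first by rewrite -ev_bdz bdz_bdz.
  exact: good_bd.
have Esd f : admissible f -> ev (bdz u) f + ev (bdz v) f = ev (sdz N a) f + ev (sdz N b) f.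
  move=> gf; rewrite !ev_bdz -E -ev_bdz.
  rewrite (@bdz_sdz_good _ N _ w (a ++ b)) ?ev_sdz ?ev_cat// => g gg.
  by rewrite ev_cat bw.
(* With [w] subdivided as u + v, the chain sd a - du equals dv - sd b, so it lies in both sets. Its
   boundary is the subdivision of [c], and [t] below accounts for the difference with [c]. *)
have [d sd Ed] : exists2 d, supp (sing (A `&` B)) d &
    forall f, admissible f -> ev d f = ev (sdz N a ++ opp (bdz u)) f.
  apply: (@supp_setI _ A B _ _ (opp (sdz N b) ++ bdz v)).
  - by rewrite supp_cat supp_opp supp_sdz// supp_bdz.
  - by rewrite supp_cat supp_opp supp_sdz// supp_bdz.
  move=> f gf; rewrite !ev_cat !ev_opp; apply/eqP.
  by rewrite subr_eq -addrA eq_sym addrC subr_eq -Esd// addrC.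
have [t st bt] := subdivision N sc cc.
exists (t ++ d); first by rewrite supp_cat st.
move=> f gf; rewrite ev_bdz_cat bt// (ev_bdz d) Ed; last exact: good_bd.
rewrite ev_cat ev_opp -!ev_bdz bdz_bdz subr0 bdz_sdz.
rewrite (_ : ev (sdz N (bdz a)) f = ev (sdz N c) f) ?subrK//.
by rewrite !ev_sdz Ec//; apply: good_sdz.
Qed.

Lemma acyclic0 X n : acyclic R K (set0 : set X) n.
Proof.
move=> z sz _; exists [::] => // f gf; rewrite ev_nil.
rewrite (eq_ev_supp (g := fun=> 0) sz) ?ev0// => s [_].
by move=> /(_ (row ord0 1%:M) (stoch1 _ _)).
Qed.

(** Split off one set U. The union of the rest meets U in the union of the sets U [&] A, a family
    with one set fewer and needed in one degree less; hence the induction on the size, for all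
    degrees and families at once. *)
Lemma nerve_acyclic X (L : seq (set X)) n :
  (forall A, A \in L -> open A) ->
  (forall L' : seq (set X), {subset L' <= L} -> L' != [::] ->
    forall p, acyclic R K (foldr setI setT L') p) ->
  (size L <= n.+1)%N -> acyclic R K (foldr setU set0 L) n.
Proof.
have [m] := ubnP (size L); elim: m L n => // m IH [|U L] n Lm oL aL sL.
  exact: acyclic0.
have aU p : acyclic R K U p.
  have := aL [:: U] _ isT p; rewrite /= setIT; apply=> A.
  by rewrite mem_seq1 => /eqP ->; exact: mem_head.
have oL' A : A \in L -> open A by move=> AL; apply: oL; rewrite in_cons AL orbT.
have aL' (L' : seq (set X)) : {subset L' <= L} -> L' != [::] ->
    forall p, acyclic R K (foldr setI setT L') p.
  by move=> L'L; apply: aL => A /L'L AL; rewrite in_cons AL orbT.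
have oU : open U by apply: oL; exact: mem_head.
(* In degree 0 at most one set is allowed, and it is acyclic by assumption. *)
case: n sL => [|n] sL.
  have -> : L = [::] by case: L sL {Lm oL aL oL' aL'} => [//|? ?].
  by rewrite /= setU0.
have oLU : open (foldr setU set0 L).
  elim: L oL' {Lm IH oL aL aL' sL} => [|A L IH] oL'; first exact: open0.
  apply: openU; first by apply: oL'; exact: mem_head.
  by apply: IH => B BL; apply: oL'; rewrite in_cons BL orbT.
rewrite /=; apply: mayer_vietoris_acyclic => //; first by apply: IH => //; exact: ltnW.
have -> : U `&` foldr setU set0 L = foldr setU set0 [seq U `&` A | A <- L].
  elim: L {Lm IH oL aL aL' sL oLU oL'} => [|A L IH] /=; first by rewrite setI0.
  by rewrite setIUr IH.
apply: IH => [|A /mapP[B BL ->]|L' L'L L'0 p|].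
- by rewrite size_map.
- by apply: openI => //; exact: oL'.
(* An intersection of sets U [&] A is an intersection of members of the original family, U being one
   of them. *)
- have [L2 [L2L L20 ->]] : exists L2 : seq (set X), [/\ {subset L2 <= L}, L2 != [::] &
      foldr setI setT L' = foldr setI setT (U :: L2)].
    elim: L' L'L L'0 {p} => [//|A L' IH] L'L _.
    have /mapP[B BL EA] : A \in [seq U `&` A | A <- L].
      by apply: L'L; exact: mem_head.
    have [->|L'0] := eqVneq L' [::].
      exists [:: B]; split=> //=; last by rewrite EA !setIT.
      by move=> C; rewrite mem_seq1 => /eqP ->.
    have [||L2 [L2L _ E]] := IH => // [C CL'|].
      by apply: L'L; rewrite in_cons CL' orbT.
    exists (B :: L2); split=> //.
      by move=> C; rewrite in_cons => /predU1P[->//|/L2L].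
    by rewrite [LHS]/= E EA /= setIACA setIid.
  apply: aL => // A; rewrite in_cons => /predU1P[->|/L2L AL]; first exact: mem_head.
  by rewrite in_cons AL orbT.
- by rewrite size_map.
Qed.

End Homology.

(** * Quotients and suspensions *)

Section Quotient.
Variables (T : topologicalType) (r : T -> T -> Prop).
Local Open Scope quotient_scope.

Definition qpi (x : T) : quotient_space r := \pi_{eq_quot (gen_equiv_rel r)} x.

(** A map on the quotient is written as [f] after [qrepr]; when [f] respects [r] this is the induced
    map, whatever representatives are chosen. *)
Definition qrepr (q : quotient_space r) : T := repr (q : {eq_quot (gen_equiv_rel r)}).

Lemma qreprK q : qpi (qrepr q) = q.
Proof. by rewrite /qpi /qrepr reprK. Qed.

Lemma qpi_continuous : continuous qpi.
Proof. exact: pi_continuous. Qed.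

Lemma qopen (U : set (quotient_space r)) : open (qpi @^-1` U) -> open U.
Proof. by []. Qed.

Lemma qpi_eq x y : r x y -> qpi x = qpi y.
Proof. by move=> rxy; apply/eqmodP/asboolP/rst_step. Qed.

Lemma qpi_inv (Z : Type) (f : T -> Z) : (forall x y, r x y -> f x = f y) ->
  forall x y, qpi x = qpi y -> f x = f y.
Proof.
move=> rf x y /eqmodP /asboolP; by elim=> [a b /rf|//|a b _ ->|a b c _ -> _ ->].
Qed.

Lemma qlift (Z : Type) (f : T -> Z) : (forall x y, r x y -> f x = f y) ->
  forall x, f (qrepr (qpi x)) = f x.
Proof. by move=> rf x; apply: (qpi_inv rf); rewrite qreprK. Qed.

Lemma qlift_continuous (Z : topologicalType) (f : T -> Z) :
  (forall x y, r x y -> f x = f y) -> continuous f ->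
  continuous (fun q => f (qrepr q)).
Proof.
move=> rf cf; apply/continuousP => A oA; apply: qopen.
rewrite (_ : _ @^-1` _ = f @^-1` A); first by move/continuousP: cf; apply.
by apply/seteqP; split=> x /=; rewrite qlift.
Qed.

End Quotient.

Section Interval.
Variable R : realType.
Local Notation I01 := (unit_interval R).

Lemma clamp_subproof (t : R) : I01 (Num.max 0 (Num.min 1 t)).
Proof.
rewrite /unit_interval /= le_max lexx /= ge_max ler01 /=.
by rewrite ge_min lexx.
Qed.

(** Clamping lets heights be arbitrary reals, so that points and homotopies of the suspension are
    given by plain formulas. *)
Definition toI (t : R) : I01 := SigSub (mem_set (clamp_subproof t)).

Lemma toIE t : 0 <= t <= 1 -> set_val (toI t) = t.
Proof.
move=> /andP[t0 t1]; rewrite set_valE /=.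
by rewrite (min_idPr _)// (max_idPr _).
Qed.

Lemma toIK (t : I01) : toI (set_val t) = t.
Proof. by apply/val_inj; apply: toIE; have := set_valP t. Qed.

Lemma val_continuous (X : topologicalType) (A : set X) :
  continuous (fun a : A => set_val a : X).
Proof. exact: initial_continuous. Qed.

Lemma sub_continuous (X Y : topologicalType) (A : set Y) (f : X -> A) :
  continuous (fun x => set_val (f x)) -> continuous f.
Proof. by move=> cf; apply: continuous_comp_initial. Qed.

Lemma toI_continuous : continuous toI.
Proof.
apply: sub_continuous => t.
apply: (@continuous_comp _ _ _ (fun t : R => (0 : R, Num.min 1 t))
  (fun p : R * R => Num.max p.1 p.2)); last exact: max_continuous.
move: t; apply: continuous_pair => t; first exact: cvg_cst.
apply: (@continuous_comp _ _ _ (fun t : R => (1 : R, t))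
  (fun p : R * R => Num.min p.1 p.2)); last exact: min_continuous.
by move: t; apply: continuous_pair => t; [exact: cvg_cst|exact: cvg_id].
Qed.

End Interval.

Section Suspension.
Variables (R : realType) (X : topologicalType).
Local Notation I01 := (unit_interval R).
Local Notation S := (suspension R X).

Definition sus (x : X) (t : R) : S := qpi _ (x, toI t).

Lemma sus_continuous : continuous (fun p => sus p.1 p.2).
Proof.
move=> p; apply: (@continuous_comp _ _ _ (fun p : X * R => (p.1, toI p.2))).
  move: p; apply: continuous_pair => p; first exact: cvg_fst.
  by apply: continuous_comp; [exact: cvg_snd|exact: toI_continuous].
exact: qpi_continuous.
Qed.

Definition height (q : S) : R := set_val (qrepr q).2.

(** At the two poles the value depends on the chosen representative; it is meaningful for heights
    strictly between 0 and 1. *)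
Definition base (q : S) : X := (qrepr q).1.

Lemma height_sus x t : 0 <= t <= 1 -> height (sus x t) = t.
Proof.
move=> t01; rewrite /height.
rewrite (qlift (f := fun p : X * I01 => set_val p.2 : R)); first exact: toIE.
by move=> p q [].
Qed.

Lemma height_continuous : continuous height.
Proof.
apply: (qlift_continuous (f := fun p : X * I01 => set_val p.2 : R)).
  by move=> p q [].
by move=> p; apply: continuous_comp; [exact: cvg_snd|exact: val_continuous].
Qed.

Lemma height01 q : 0 <= height q <= 1.
Proof. exact: (set_valP (qrepr q).2). Qed.

Lemma base_sus x t : 0 < t < 1 -> base (sus x t) = x.
Proof.
move=> /andP[t0 t1]; have t01 : 0 <= t <= 1 by rewrite !ltW.
(* Forgetting the base point at the poles makes the first projection compatible with the
   identifications. *)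
pose g (p : X * I01) : option X :=
  if (0 < set_val p.2 :> R) && (set_val p.2 < 1 :> R) then Some p.1 else None.
have : g (qrepr (sus x t)) = g (x, toI t).
  by apply: qlift => p q [E1 E2]; rewrite /g -E1; case: E2 => ->; rewrite ltxx ?andbF.
by rewrite /g /= toIE// t0 t1 /=; case: ifP => // _ [].
Qed.

Lemma sus_base q : sus (base q) (height q) = q.
Proof. by rewrite /sus toIK -[RHS]qreprK; congr qpi; rewrite -surjective_pairing. Qed.

Lemma sus0 x y : sus x 0 = sus y 0.
Proof. by apply: qpi_eq; split=> //=; left; rewrite toIE// lexx ler01. Qed.

Lemma sus1 x y : sus x 1 = sus y 1.
Proof. by apply: qpi_eq; split=> //=; right; rewrite toIE// lexx ler01. Qed.

(** The bounds on [a] and [b] keep out the poles, where [base] is an arbitrary choice. *)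
Lemma open_height_base (a b : R) (N : set X) : 0 <= a -> b <= 1 -> open N ->
  open [set q : S | a < height q < b /\ N (base q)].
Proof.
move=> a0 b1 oN; apply: qopen.
rewrite (_ : _ @^-1` _ = (fst @^-1` N) `&`
   ((fun p : X * I01 => set_val p.2 : R) @^-1` [set t | a < t < b])).
  apply: openI; first by apply: open_comp => // p _; exact: cvg_fst.
  apply: open_comp; last first.
    rewrite (_ : mkset _ = [set t | a < t] `&` [set t | t < b]).
      by apply: openI; [exact: open_gt|exact: open_lt].
    by apply/seteqP; split=> t /=; [move/andP|move=> [-> ->]].
  by move=> p _; apply: continuous_comp; [exact: cvg_snd|exact: val_continuous].
apply/seteqP; split=> -[x t] /=.
  rewrite -[t]toIK -/(sus x _) height_sus ?toIK; last exact: (set_valP t).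
  move=> [/andP[ta tb] +]; rewrite base_sus ?ta ?tb//.
  by rewrite (le_lt_trans a0 ta) (lt_le_trans tb b1).
move=> [Nx /andP[ta tb]]; rewrite -[t]toIK -/(sus x _).
rewrite height_sus; last exact: (set_valP t).
rewrite ta tb base_sus//.
by rewrite (le_lt_trans a0 ta) (lt_le_trans tb b1).
Qed.

Lemma base_continuous (a b : R) : 0 <= a -> b <= 1 ->
  {within [set q : S | a < height q < b], continuous base}.
Proof.
move=> a0 b1; apply/subspace_continuousP => q /= qab N.
rewrite nbhsE => -[U [oU Uq] UN].
have := open_height_base a0 b1 oU.
rewrite openE => /(_ q (conj qab Uq)); rewrite /interior.
rewrite nbhs_simpl /= /within /=; apply: filterS => q' [_ Uq'] _.
exact: UN.
Qed.

(** Put [z] on the equator. It bounds in each of the two open cones; if the difference of the two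
    fillings bounds, then the equatorial copy already bounds between the poles, and [base] projects
    this back to [X]. *)
Lemma suspension_acyclic (K : comNzRingType) n :
  acyclic R K [set: S] n.+1 -> acyclic R K [set: X] n.
Proof.
move=> aS z sz cz.
(* The poles need a point of [X]; an empty space carries no simplices with a vertex. *)
have [[x0 _]|nX] := pselect (exists x : X, True); last first.
  suff X0 : [set: X] = set0 by rewrite X0 in sz *; exact: acyclic0.
  by apply/seteqP; split=> x // _; case: nX; exists x.
pose A := [set q : S | height q < 2 / 3]; pose B := [set q : S | 1 / 3 < height q].
have oA : open A.
  by apply: (@open_comp _ _ height [set t | t < 2 / 3]) => [q _|];
    [exact: height_continuous|exact: open_lt].
have oB : open B.
  by apply: (@open_comp _ _ height [set t | 1 / 3 < t]) => [q _|];
    [exact: height_continuous|exact: open_gt].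
pose c := push (fun s => (fun x => sus x 2^-1) \o s) z.
have contH (l : R -> R) : continuous l ->
    {within [set: X] `*` I01, continuous (fun p => sus p.1 (l p.2))}.
  move=> cl; apply: continuous_subspaceT => p.
  apply: (@continuous_comp _ _ _ (fun p : X * R => (p.1, l p.2)) (fun p => sus p.1 p.2)).
    move: p; apply: continuous_pair => p; first exact: cvg_fst.
    by apply: continuous_comp; [exact: cvg_snd|exact: cl].
  exact: sus_continuous.
have bA : bounds A c.
  pose H (x : X) (t : R) := sus x (2^-1 * (1 - t)).
  have -> : c = push (fun s => H^~ 0 \o s) z.
    by congr (push _ z); apply/funext => s; rewrite /H subr0 mulr1.
  apply: (@nullhomotopic_bounds R K X S setT A H (sus x0 0)) => //.
  - apply: (contH (fun t => 2^-1 * (1 - t))) => t.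
    by apply: cvgMl_tmp; apply: cvgB; [exact: cvg_cst|exact: cvg_id].
  - move=> x t _ /andP[t0 t1]; rewrite /A /H /= height_sus; lra.
  - by move=> x _; rewrite /H subrr mulr0; apply: sus0.
  - by rewrite /A /= height_sus; lra.
have bB : bounds B c.
  pose H (x : X) (t : R) := sus x (2^-1 * (1 + t)).
  have -> : c = push (fun s => H^~ 0 \o s) z.
    by congr (push _ z); apply/funext => s; rewrite /H addr0 mulr1.
  apply: (@nullhomotopic_bounds R K X S setT B H (sus x0 1)) => //.
  - apply: (contH (fun t => 2^-1 * (1 + t))) => t.
    by apply: cvgMl_tmp; apply: cvgD; [exact: cvg_cst|exact: cvg_id].
  - move=> x t _ /andP[t0 t1]; rewrite /B /H /= height_sus; lra.
  - by move=> x _; rewrite /H (_ : 2^-1 * (1 + 1) = 1); [apply: sus1|lra].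
  - by rewrite /B /= height_sus; lra.
have [a sa ba] := bA; have [b sb bb] := bB.
(* The two fillings glued along the equator form the suspension of the cycle [z]. *)
have [w sw bw] : bounds [set: S] (a ++ opp b).
  apply: aS.
    rewrite supp_cat supp_opp; apply/andP; split.
      by apply: sub_supp sa => s; apply: sub_sing.
    by apply: sub_supp sb => s; apply: sub_sing.
  by move=> f gf; rewrite ev_bdz_cat ev_bdz_opp ba// bb// subrr.
have AB : A `|` B = setT.
  apply/seteqP; split=> q // _; rewrite /A /B /=.
  by have [?|?] := ltP (height q) (2 / 3); [left|right; lra].
have [d sd bd] : bounds (A `&` B) c.
  apply: (@mayer_vietoris_boundary R K S A B n a (opp b) w c) => //.
  - by rewrite supp_opp.
  - by rewrite AB.
  - by move=> f gf; rewrite bw// ev_cat.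
  - rewrite supp_push; apply: sub_supp sz => s.
    apply: sing_comp; last by move=> x _; rewrite /A /B /= height_sus; lra.
    apply: continuous_subspaceT => x.
    apply: (@continuous_comp _ _ _ (fun x : X => (x, 2^-1 : R)) (fun p : X * R => sus p.1 p.2)).
      by move: x; apply: continuous_pair => x; [exact: cvg_id|exact: cvg_cst].
    exact: sus_continuous.
  - by move=> f gf; rewrite ba.
exists (push (fun s => base \o s) d).
  rewrite supp_push; apply: sub_supp sd => s.
  apply: sing_comp => //.
  rewrite (_ : A `&` B = [set q : S | 1 / 3 < height q < 2 / 3]).
    by apply: base_continuous; lra.
  by apply/seteqP; split=> q; rewrite /A /B /=; [move=> [-> ->]|move=> /andP[]].
move=> f gf; rewrite bdz_push bd; last exact: good_comp.
rewrite ev_push; apply: eq_ev => s; congr f; apply/funext => x /=.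
by rewrite base_sus//; lra.
Qed.

End Suspension.

(** * The plane and the circle *)

Section Plane.
Variable R : realType.
Local Notation C := (plane R).

Definition Rc (x : R) : C := (x%:C)%C.
Definition re (z : C) : R := complex.Re z.
Definition im (z : C) : R := complex.Im z.
Definition cmod (z : C) : R := re `|z|.

Lemma reRc x : re (Rc x) = x. Proof. by []. Qed.
Lemma imRc x : im (Rc x) = 0. Proof. by []. Qed.
Lemma RcB x y : Rc (x - y) = Rc x - Rc y.
Proof. exact: (rmorphB (real_complex R)). Qed.
Lemma RcM x y : Rc (x * y) = Rc x * Rc y.
Proof. exact: (rmorphM (real_complex R)). Qed.
Lemma Rc0 : Rc 0 = 0. Proof. by []. Qed.
Lemma Rc1 : Rc 1 = 1. Proof. by []. Qed.
Lemma normE (z : C) : `|z| = Rc (cmod z).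
Proof. by rewrite /cmod /Rc [`|z|]normc_def. Qed.

Lemma cmodE z : cmod z = Num.sqrt (re z ^+ 2 + im z ^+ 2).
Proof. by rewrite /cmod [`|z|]normc_def. Qed.

Lemma ltRc x y : (Rc x < Rc y) = (x < y). Proof. exact: ltcR. Qed.
Lemma leRc x y : (Rc x <= Rc y) = (x <= y). Proof. exact: lecR. Qed.
Lemma Rc_inj : injective Rc. Proof. exact: complexI. Qed.

Lemma cmod_ge0 z : 0 <= cmod z. Proof. by rewrite cmodE sqrtr_ge0. Qed.

Lemma cmodM z w : cmod (z * w) = cmod z * cmod w.
Proof. by apply: Rc_inj; rewrite RcM -!normE normrM. Qed.

Lemma cmod_eq0 z : (cmod z == 0) = (z == 0).
Proof. by rewrite -(inj_eq Rc_inj) -normE Rc0 normr_eq0. Qed.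

Lemma cmodRc x : cmod (Rc x) = `|x|.
Proof. by rewrite cmodE /re /im /= expr0n addr0 sqrtr_sqr. Qed.

Lemma norm_le z x : (`|z| <= Rc x) = (cmod z <= x).
Proof. by rewrite normE leRc. Qed.

Lemma cmod_norm1 z : (`|z| = 1) <-> (cmod z = 1).
Proof. by rewrite normE -Rc1; split=> [/Rc_inj|->]. Qed.

Lemma re_le_cmod z : `|re z| <= cmod z.
Proof.
rewrite cmodE -sqrtr_sqr; apply: ler_wsqrtr.
by rewrite lerDl sqr_ge0.
Qed.

Lemma im_le_cmod z : `|im z| <= cmod z.
Proof.
rewrite cmodE -sqrtr_sqr; apply: ler_wsqrtr.
by rewrite lerDr sqr_ge0.
Qed.

Lemma reB z w : re (z - w) = re z - re w. Proof. by case: z w => [? ?] [? ?]. Qed.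
Lemma imB z w : im (z - w) = im z - im w. Proof. by case: z w => [? ?] [? ?]. Qed.
Lemma reM z w : re (z * w) = re z * re w - im z * im w.
Proof. by case: z w => [? ?] [? ?]. Qed.
Lemma imM z w : im (z * w) = re z * im w + im z * re w.
Proof. by case: z w => [? ?] [? ?] /=; rewrite /im /re /=. Qed.

Lemma plane_eq (z w : C) : re z = re w -> im z = im w -> z = w.
Proof. by case: z w => [? ?] [? ?]; rewrite /re /im /= => -> ->. Qed.

Lemma Rc_continuous : continuous Rc.
Proof.
move=> x N /nbhs_ballP[e /= e0 eN].
(* A positive element of [R[i]] is real. *)
have E1 : e = Rc (re e).
  by apply: plane_eq => //; move: e0; rewrite -[0]Rc0 ltcE => /andP[/eqP].
move: e0; rewrite E1 -Rc0 ltRc => e0; apply/nbhs_ballP; exists (re e) => //= y xy.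
by apply: eN; rewrite /ball /= -RcB normE cmodRc E1 ltRc.
Qed.

Lemma lipschitz1_continuous (f : C -> R) :
  (forall z w, `|f z - f w| <= cmod (z - w)) -> continuous f.
Proof.
move=> Lf z N /nbhs_ballP[e /= e0 eN]; apply/nbhs_ballP; exists (Rc e) => /=.
  by rewrite -Rc0 ltRc.
move=> w /= zw; apply: eN; apply: le_lt_trans (Lf _ _) _.
by rewrite -ltRc -normE.
Qed.

Lemma re_continuous : continuous re.
Proof. by apply: lipschitz1_continuous => z w; rewrite -reB re_le_cmod. Qed.

Lemma im_continuous : continuous im.
Proof. by apply: lipschitz1_continuous => z w; rewrite -imB im_le_cmod. Qed.

Lemma cmod_continuous : continuous cmod.
Proof.
apply: lipschitz1_continuous => z w.
by rewrite -leRc -cmodRc -!normE RcB -!normE; apply: ler_dist_dist.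
Qed.

(** Angles are measured in turns, so that the period is 1 and the kernel consists of the
    integers. *)
Definition cis (t : R) : C := (cos (2 * pi * t) +i* sin (2 * pi * t))%C.

Lemma re_cis t : re (cis t) = cos (2 * pi * t). Proof. by []. Qed.
Lemma im_cis t : im (cis t) = sin (2 * pi * t). Proof. by []. Qed.

Lemma cisD s t : cis (s + t) = cis s * cis t.
Proof.
apply: plane_eq; rewrite ?reM ?imM !(re_cis, im_cis) mulrDr ?cosD ?sinD//.
by rewrite addrC [cos _ * sin _]mulrC; congr (_ + _); rewrite mulrC.
Qed.

Lemma cis0 : cis 0 = 1.
Proof. by apply: plane_eq; rewrite ?re_cis ?im_cis mulr0 ?cos0 ?sin0. Qed.

Lemma cis1 : cis 1 = 1.
Proof.
by apply: plane_eq; rewrite ?re_cis ?im_cis mulr1 mulrC -[pi * 2]/(pi * 2%:R) mulr_natr ?cos2pi ?sin2pi.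
Qed.

Lemma cisX t n : cis t ^+ n = cis (n%:R * t).
Proof.
elim: n => [|n IH]; first by rewrite expr0 mul0r cis0.
by rewrite exprS IH -cisD -natr1 mulrDl mul1r addrC.
Qed.

Lemma cis_nat n : cis n%:R = 1.
Proof. by rewrite -[n%:R]mulr1 -cisX cis1 expr1n. Qed.

Lemma cisN t : cis (- t) = (cis t)^-1.
Proof.
have EE : cis t * cis (- t) = 1 by rewrite -cisD subrr cis0.
have Et0 : cis t != 0 by apply: contra_eq_neq EE => ->; rewrite mul0r eq_sym oner_eq0.
by rewrite -[LHS]mul1r -(mulVf Et0) -mulrA EE mulr1.
Qed.

Lemma cis_int (m : int) : cis m%:~R = 1.
Proof.
case: m => n; first exact: cis_nat.
by rewrite NegzE mulrNz cisN cis_nat invr1.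
Qed.

Lemma cmod_cis t : cmod (cis t) = 1.
Proof. by rewrite cmodE re_cis im_cis cos2Dsin2 sqrtr1. Qed.

Lemma cis_continuous : continuous cis.
Proof.
move=> t; rewrite (_ : cis = fun t => Rc (cos (2 * pi * t)) + Rc (sin (2 * pi * t)) * 'i%C).
  apply: cvgD; last apply: cvgMr_tmp.
    apply: continuous_comp; last exact: Rc_continuous.
    apply: continuous_comp; last exact: continuous_cos.
    exact: mulrl_continuous.
  apply: continuous_comp; last exact: Rc_continuous.
  apply: continuous_comp; last exact: continuous_sin.
  exact: mulrl_continuous.
by apply/funext => s; apply: plane_eq; rewrite /re /im /=; ring.
Qed.

Lemma cis_eq1 t : cis t = 1 -> exists m : int, t = m%:~R.
Proof.
move=> Et; exists (Num.floor t).
have := floor_le t.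
have := lt_succ_floor t; rewrite intrD1.
set m := Num.floor t => tm mt.
pose u := t - m%:~R.
have Eu : cis u = 1 by rewrite /u cisD Et mul1r cisN cis_int invr1.
have pi0 := @pi_gt0 R.
have [u0|u0] := eqVneq u 0; first by apply/eqP; rewrite -subr_eq0 -/u u0.
have u01 : 0 < u < 1 by rewrite lt_neqAle eq_sym u0 /u /=; lra.
have /(congr1 im) := Eu; rewrite im_cis (_ : im 1 = 0)// => su.
have /(congr1 re) := Eu; rewrite re_cis (_ : re 1 = 1)// => cu.
exfalso.
(* Below half a turn the sine is positive, above it the same holds for the mirror angle 1 - u, and
   at half a turn the cosine is -1. *)
have [h|h|h] := ltgtP u 2^-1.
- have : 0 < sin (2 * pi * u) by apply: sin_gt0_pi; nra.
  by rewrite su ltxx.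
- have : 0 < sin (2 * pi * (1 - u)) by apply: sin_gt0_pi; nra.
  rewrite mulrBr mulr1 [2 * pi]mulrC mulr_natr addrC sinD2pi sinN.
  by rewrite -mulr_natr [pi * _]mulrC su oppr0 ltxx.
- by move: cu; rewrite h [2 * pi]mulrC -mulrA mulfV// mulr1 cospi; lra.
Qed.

Lemma cis_inj s t : cis s = cis t -> exists m : int, s = t + m%:~R.
Proof.
move=> Est; have [m Em] : exists m : int, s - t = m%:~R.
  apply: cis_eq1; rewrite cisD cisN Est mulfV//.
  by rewrite -cmod_eq0 cmod_cis oner_eq0.
by exists m; rewrite -Em addrC subrK.
Qed.

Lemma cis_surj z : cmod z = 1 -> exists t, z = cis t.
Proof.
move=> z1; have pi0 := @pi_gt0 R.
have zz : re z ^+ 2 + im z ^+ 2 = 1.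
  have : cmod z ^+ 2 = 1 by rewrite z1 expr1n.
  by rewrite cmodE sqr_sqrtr// addr_ge0 ?sqr_ge0.
have x1 : -1 <= re z <= 1 by rewrite -ler_norml -z1 re_le_cmod.
have cx : cos (acos (re z)) = re z by rewrite acosK// in_itv.
have sx : sin (acos (re z)) = `|im z|.
  by rewrite sin_acos// -zz addrC addKr sqrtr_sqr.
have pp a : 2 * pi * (a / (2 * pi)) = a :> R by field; lra.
have [y0|y0] := leP 0 (im z).
  exists (acos (re z) / (2 * pi)); apply: plane_eq; rewrite ?re_cis ?im_cis pp ?cx//.
  by rewrite sx ger0_norm.
exists (- acos (re z) / (2 * pi)); apply: plane_eq; rewrite ?re_cis ?im_cis pp ?cosN ?cx//.
by rewrite sinN sx ltr0_norm// opprK.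
Qed.

Lemma polar z : exists t, z = Rc (cmod z) * cis t.
Proof.
have [->|z0] := eqVneq z 0.
  by exists 0; rewrite (_ : cmod 0 = 0) ?mul0r//; apply/eqP; rewrite cmod_eq0.
have c0 : cmod z != 0 by rewrite cmod_eq0.
have [t Et] : exists t, z * Rc (cmod z)^-1 = cis t.
  by apply: cis_surj; rewrite cmodM cmodRc ger0_norm ?invr_ge0 ?cmod_ge0// mulfV.
by exists t; rewrite -Et mulrCA -RcM mulfV// mulr1.
Qed.

Lemma cmod_polar r t : 0 <= r -> cmod (Rc r * cis t) = r.
Proof. by move=> r0; rewrite cmodM cmod_cis mulr1 cmodRc ger0_norm. Qed.

(** The branch of the angle, in turns, with values between -1/4 and 1/4; it is the angle on the
    right half-plane. *)
Definition turn (z : C) : R := atan (im z / re z) / (2 * pi).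

Lemma turn_polar r t : 0 < r -> - 4^-1 < t < 4^-1 -> turn (Rc r * cis t) = t.
Proof.
move=> r0 t4; have pi0 := @pi_gt0 R.
rewrite /turn reM imM reRc imRc !(mul0r, addr0, subr0) re_cis im_cis.
have -> : r * sin (2 * pi * t) / (r * cos (2 * pi * t)) = tan (2 * pi * t).
  by rewrite -mulf_div mulfV ?gt_eqF// mul1r.
rewrite tanK; first by field; lra.
by rewrite in_itv /=; apply/andP; split; nra.
Qed.

Lemma turn_continuous z : 0 < re z -> {for z, continuous turn}.
Proof.
move=> z0; have Fz := nbhs_filter z; apply: cvgMr_tmp.
apply: continuous_cvg; first exact: continuous_atan.
apply: cvgM; first exact: im_continuous.
by apply: cvgV; [rewrite gt_eqF|exact: re_continuous].
Qed.

End Plane.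

(** * A cycle of arcs on the circle that does not bound *)

Section CircleCycle.
Variables (R : realType) (K : comNzRingType) (k : nat).
Hypothesis k2 : (2 <= k)%N.
Local Notation C := (plane R).

Lemma circle_cmod (x : (@circle R)) : cmod (set_val x) = 1.
Proof. by apply/cmod_norm1; exact: (set_valP x). Qed.

Lemma circle_cis_subproof t : circle (cis t : C).
Proof. by rewrite /circle /=; apply/cmod_norm1; exact: cmod_cis. Qed.

Definition circle_cis (t : R) : (@circle R) := SigSub (mem_set (circle_cis_subproof t)).

Lemma val_circle_cis t : set_val (circle_cis t) = cis t. Proof. by []. Qed.

Lemma circle_cis_continuous : continuous circle_cis.
Proof. by apply: sub_continuous; exact: cis_continuous. Qed.

Lemma circle_cis_int t (m : int) : circle_cis (t + m%:~R) = circle_cis t.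
Proof. by apply/val_inj; rewrite /= cisD cis_int mulr1. Qed.

Lemma cone0 m (b : 'rV[R]_m) (W : 'M[R]_(0, m)) : cone b W = b.
Proof.
apply/matrixP => i j; have [i' ->|[]//] := split_ordP (i : 'I_(1 + 0)).
by rewrite (@col_mxEu _ 1 0); congr (b _ _); apply/val_inj.
Qed.

Lemma ev_bd2 X (s : simp R 2 X) f :
  ev (bd K s) f = f (act s (row 1 1%:M)) - f (act s (row 0 1%:M)).
Proof.
rewrite ev_push; set V := 1%:M.
have VE : V = cone (row 0 V) (cone (row 1 V) 0).
  apply/matrixP => i j.
  have [i' ->|i' ->] := split_ordP (i : 'I_(1 + 1)).
    rewrite (@col_mxEu _ 1 1) ord1 [RHS]mxE.
    by congr (V _ _); apply/val_inj.
  rewrite (@col_mxEd _ 1 1) cone0 [RHS]mxE ord1.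
  by congr (V _ _); apply/val_inj.
by rewrite [in LHS]VE ev_bdry_mx_coneS ev_bdry_mx_cone0 /= !cone0.
Qed.

(** The power map of exponent [k] winds each of these arcs once around the circle, in the same way
    for every [j]. *)
Definition arc (j : nat) : simp R 2 (@circle R) :=
  fun x => circle_cis ((j%:R + x 0 1) / k%:R).

Definition arcs : chain K (simp R 2 (@circle R)) :=
  [seq (1, arc j) | j <- iota 0 k].

Definition cst1 X (x : X) : simp R 1 X := fun=> x.

Lemma simplex1 (y : 'rV[R]_1) : simplex y -> y 0 0 = 1.
Proof. by case=> _; rewrite big_ord1. Qed.

Lemma mulmx_rV1 m (y : 'rV[R]_1) (V : 'rV[R]_m) : y *m V = y 0 0 *: V.
Proof. by apply/rowP => j; rewrite mulmxEsum big_ord1 mxE. Qed.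

Lemma ev_bd_arc j f : admissible f ->
  ev (bd K (arc j)) f = f (cst1 (circle_cis (j.+1%:R / k%:R))) - f (cst1 (circle_cis (j%:R / k%:R))).
Proof.
move=> gf; rewrite ev_bd2; congr (_ - _); apply: gf => y /simplex1 y1;
  rewrite /act /arc mulmx_rV1 y1 scale1r !mxE /=.
- by rewrite natr1.
- by rewrite addr0.
Qed.

Let k0 : k%:R != 0 :> R. Proof. by rewrite pnatr_eq0; lia. Qed.

Lemma ev_arcs f : ev arcs f = \sum_(0 <= j < k) f (arc j).
Proof.
rewrite /ev /arcs big_map /index_iota subn0.
by apply: eq_bigr => j _; rewrite mul1r.
Qed.

Lemma cycle_arcs : is_cycle arcs.
Proof.
move=> f gf; rewrite ev_bdz ev_arcs.
under eq_bigr => j _ do rewrite ev_bd_arc//.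
rewrite telescope_sumr//.
rewrite mul0r mulfV// -[1]add0r -[1](mulr1z 1) circle_cis_int subrr//.
Qed.

Lemma arc_continuous j : continuous (arc j).
Proof.
move=> x; rewrite /arc; apply: continuous_comp; last exact: circle_cis_continuous.
have Fx := nbhs_filter x.
apply: cvgMr_tmp; apply: cvgD; first exact: cvg_cst.
exact: (@coord_continuous R 1 2 0 1 x).
Qed.

Lemma sing_arc (A : set (@circle R)) j :
  (forall t, j%:R <= t <= j.+1%:R -> A (circle_cis (t / k%:R))) -> sing A (arc j).
Proof.
move=> At; split; first exact/continuous_subspaceT/arc_continuous.
move=> x [x0 x1]; apply: At; rewrite lerDl x0 /= -natr1 lerD2l -x1.
by rewrite (bigD1 (1 : 'I_2))//= lerDl; apply: sumr_ge0.
Qed.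

End CircleCycle.

Section Segment.
Variables (R : realType) (X : topologicalType).

Definition segpt (u : R) : 'rV[R]_2 := \row_i (if i == 0 then 1 - u else u).

Lemma segpt_continuous : continuous segpt.
Proof.
apply: mx_continuous => i j.
rewrite (_ : (fun _ => _) = fun u : R => if j == 0 then 1 - u else u); last first.
  by apply/funext => u; rewrite mxE.
case: (j == 0) => u; last exact: cvg_id.
by apply: cvgB; [exact: cvg_cst|exact: cvg_id].
Qed.

Lemma simplex_segpt u : 0 <= u <= 1 -> simplex (segpt u).
Proof.
move=> /andP[u0 u1]; split=> [i|]; first by rewrite mxE; case: ifP; lra.
by rewrite !big_ord_recl big_ord0 !mxE /=; lra.
Qed.

(** By the intermediate value theorem a path avoiding the zeros of [g] keeps its sign. This detects
    components directly, without computing homology in degree 0. *)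
Lemma edge_sign (A : set X) (g : X -> R) (s : simp R 2 X) :
  {within A, continuous g} -> (forall x, A x -> g x != 0) -> sing A s ->
  (0 < g (s (row 1 1%:M))) = (0 < g (s (row 0 1%:M))).
Proof.
move=> cg g0 [cs sA].
have -> : row 1 1%:M = segpt 1.
  by apply/rowP => j; rewrite !mxE; case: j => [[|[|?]]//= ?]; rewrite ?subrr.
have -> : row 0 1%:M = segpt 0.
  by apply/rowP => j; rewrite !mxE; case: j => [[|[|?]]//= ?]; rewrite ?subr0.
pose h u := g (s (segpt u)).
have ch : {within `[0, 1], continuous h}.
  apply: (@within_comp _ _ _ _ A (s \o segpt) g) => //.
    apply: (@within_comp _ _ _ _ [set x | simplex x] segpt s) => //.
      exact/continuous_subspaceT/segpt_continuous.
    by move=> u /=; rewrite in_itv /= => /simplex_segpt.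
  by move=> u /=; rewrite in_itv /= => /simplex_segpt /sA.
have h0 u : 0 <= u <= 1 -> h u != 0 by move=> /simplex_segpt /sA /g0.
have := @IVT _ h 0 1 0 ler01 ch; rewrite ge_min le_max => HI.
have h00 : h 0 != 0 by apply: h0; rewrite lexx ler01.
have h01 : h 1 != 0 by apply: h0; rewrite lexx ler01.
have noroot : ~ ((h 0 <= 0 <= h 1) \/ (h 1 <= 0 <= h 0)).
  move=> hh; have [|c] := HI.
    by case: hh => /andP[-> ->]; rewrite ?orbT.
  by rewrite in_itv /= => /h0 + E; rewrite E eqxx.
rewrite -/(h 1) -/(h 0).
have [p0|p0|p0] := ltgtP (h 0) 0; last by rewrite p0 eqxx in h00.
  apply/negbTE; rewrite -leNgt leNgt; apply/negP => p1.
  by apply: noroot; left; rewrite !ltW.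
rewrite ltNge; apply/negP => p1.
by apply: noroot; right; rewrite p1 ltW.
Qed.

End Segment.


Section CircleNonacyclic.
Variables (R : realType) (K : comNzRingType) (k : nat).
Hypothesis k2 : (2 <= k)%N.

Lemma cos_lt1 (u : R) : 0 < u < 1 -> cos (2 * pi * u) < 1.
Proof.
move=> /andP[u0 u1]; rewrite lt_neqAle cos_le1 andbT; apply/eqP => cu.
have su : sin (2 * pi * u) = 0.
  by apply: cos1sin0; rewrite cu normr1.
have [m Em] : exists m : int, u = m%:~R.
  by apply: cis_eq1; apply: plane_eq; rewrite ?re_cis ?im_cis ?cu ?su.
move: u0 u1; rewrite Em -[0]/(0%:~R) -[1]/(1%:~R) !ltr_int; lia.
Qed.

(** Separate the arc number 0 from the others. If the whole cycle bounded, the two endpoints of that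
    arc would be homologous in the circle minus two points, where they lie on different sides. *)
Lemma arcs_not_bounds : ~ bounds [set: @circle R] (arcs R K k).
Proof.
move=> [w sw bw].
have pi0 := @pi_gt0 R.
have k0 : (0 : R) < k%:R by rewrite ltr0n; lia.
have k2' : (2 : R) <= k%:R by rewrite ler_nat.
(* Half the length of an arc, in turns; it is at most 1/4 because [k] is at least 2. *)
pose h : R := (2 * k%:R)^-1.
have hk : h * k%:R = 2^-1 by rewrite /h; field; rewrite gt_eqF.
have kV : k%:R^-1 = 2 * h :> R by rewrite /h; field; rewrite gt_eqF.
have h0 : 0 < h by nra.
have h4 : h <= 4^-1 by nra.
(* This rotation brings the midpoint of the arc number 0 to 1. *)
pose rot (x : @circle R) : plane R := set_val x * cis (- h).
have rotE t : rot (circle_cis t) = cis (t - h) by rewrite /rot val_circle_cis -cisD.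
have crot : continuous rot.
  move=> x; have Fx := nbhs_filter x.
  by apply: cvgMr_tmp; apply: val_continuous.
have cre : continuous (@re R \o rot).
  by move=> x; apply: continuous_comp; [exact: crot|exact: re_continuous].
have cim : continuous (@im R \o rot).
  by move=> x; apply: continuous_comp; [exact: crot|exact: im_continuous].
(* After the rotation, the circle minus -1 contains the arc number 0, and the circle minus 1
   contains all the others. *)
pose A := [set x | - 1 < re (rot x)]; pose B := [set x | re (rot x) < 1].
have oA : open A.
  by apply: (@open_comp _ _ (@re R \o rot) [set t | -1 < t]) => // *; exact: cre.
have oB : open B.
  by apply: (@open_comp _ _ (@re R \o rot) [set t | t < 1]) => // *; exact: cre.
have AE t : -h <= t - h <= h -> A (circle_cis t).
  move=> th; rewrite /A /mkset rotE re_cis.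
  have : 0 <= cos (2 * pi * (t - h)) by apply: cos_ge0_pihalf; nra.
  by lra.
have BE t : 0 < t - h < 1 -> B (circle_cis t).
  by move=> th; rewrite /B /mkset rotE re_cis cos_lt1.
pose a : chain K (simp R 2 _) := [:: (1, @arc R k 0)].
pose b : chain K (simp R 2 _) := [seq (1, @arc R k j) | j <- iota 1 k.-1].
have arcsE : arcs R K k = a ++ b.
  rewrite /arcs (_ : iota 0 k = 0%N :: iota 1 k.-1)//.
  by move: k2; case: (k) => [|[|?]].
pose c : chain K (simp R 1 (@circle R)) := [:: (1, cst1 (circle_cis k%:R^-1)); (-1, cst1 (circle_cis 0))].
have Ec f : admissible f -> ev c f = ev (bdz a) f.
  move=> gf; rewrite ev_bdz [RHS]ev_cons mul1r [snd _]/= ev_bd_arc//.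
  by rewrite !ev_cons !ev_nil mul1r mulN1r !addr0 mul0r div1r.
have [d sd bd] : bounds (A `&` B) c.
  apply: (@mayer_vietoris_boundary R K _ A B 0 a b w c) => //.
  - rewrite /= andbT; apply/asboolP/sing_arc => // t.
    rewrite -/(_ / _) kV => /andP[t0 t1]; apply: AE; nra.
  - rewrite /b; have : all (fun j => 1 <= j < k)%N (iota 1 k.-1).
      by apply/allP => j; rewrite mem_iota; lia.
    elim: (iota 1 k.-1) => //= j l IH /andP[jk /IH ->]; rewrite andbT.
    apply/asboolP/sing_arc => // t /andP[t0 t1].
    apply: BE; rewrite kV; have [j1 jk'] : (1 : R) <= j%:R /\ j.+1%:R <= (k%:R : R).
      by rewrite !ler_nat ler1n; lia.
    have -> : t * (2 * h) - h = h * (2 * t - 1) by ring.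
    nra.
  - rewrite (_ : A `|` B = setT)//; apply/seteqP; split=> // x _.
    by rewrite /A /B /=; have [?|?] := ltP (re (rot x)) 1; [right|left; lra].
  - by move=> f gf; rewrite bw// arcsE ev_cat.
  - rewrite /= andbT; apply/andP; split; apply/asboolP; apply: sing_cst.
      by rewrite kV; split; [apply: AE|apply: BE]; lra.
    split; first by apply: AE; lra.
    rewrite /B /mkset rotE re_cis sub0r mulrN cosN; apply: cos_lt1; lra.
(* The indicator of the upper half takes the value 1 on [c] but vanishes on boundaries in the
   intersection. *)
pose f (s : simp R 1 (@circle R)) : K := if 0 < im (rot (s (const_mx 1))) then 1 else 0.
have gf : admissible f.
  move=> s t st; rewrite /f st//; split=> [i|]; first by rewrite mxE.
  by rewrite big_ord1 mxE.
have := bd f gf; rewrite !ev_cons ev_nil addr0 /f /cst1 !rotE !im_cis sub0r kV.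
rewrite (_ : 2 * h - h = h); last by ring.
have sh : 0 < sin (2 * pi * h) by apply: sin_gt0_pi; nra.
rewrite mulrN sinN oppr_gt0 sh ltNge (ltW sh) /= mulr1 mulr0 addr0 => H1.
suff H0 : ev (bdz d) f = 0 by move: H1; rewrite H0 => /eqP; rewrite eq_sym oner_eq0.
rewrite ev_bdz (eq_ev_supp (g := fun=> 0) sd) ?ev0// => s sAB.
rewrite ev_bd2 /f /act.
have c1 i : (const_mx 1 : 'rV[R]_1) *m row i (1%:M : 'M[R]_2) = row i 1%:M.
  by rewrite mulmx_rV1 mxE scale1r.
rewrite !c1 (@edge_sign _ _ (A `&` B) (@im R \o rot) s) ?subrr//.
  exact: continuous_subspaceT.
move=> x [xA xB]; apply/eqP => /= im0.
have : cmod (rot x) ^+ 2 = 1 by rewrite /rot cmodM circle_cmod cmod_cis mulr1 expr1n.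
rewrite cmodE im0 expr0n addr0 sqr_sqrtr ?sqr_ge0//.
move: xA xB; rewrite /A /B /=; nra.
Qed.

End CircleNonacyclic.

(** * The Moore space of dimension two *)

Section SumFun.
Variables X Y : topologicalType.

Definition sumfun (Z : Type) (f : X -> Z) (g : Y -> Z) (p : sum_space X Y) : Z :=
  let: existT b x := p in
  (if b as b return ((if b then X else Y : topologicalType) -> Z) then f else g) x.

Lemma sumfun_continuous (Z : topologicalType) (f : X -> Z) (g : Y -> Z) :
  continuous f -> continuous g -> continuous (sumfun f g).
Proof.
by move=> cf cg [] [] x U nU; apply: existT_continuous; [exact: cf|exact: cg].
Qed.

Lemma sum_inl_continuous : continuous (@sum_inl X Y).
Proof. exact: (existT_continuous true). Qed.

Lemma sum_inr_continuous : continuous (@sum_inr X Y).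
Proof. exact: (existT_continuous false). Qed.

Lemma sum_open (U : set (sum_space X Y)) :
  open (@sum_inl X Y @^-1` U) -> open (@sum_inr X Y @^-1` U) -> open U.
Proof. by move=> ol or; apply/sigT_openP => -[]. Qed.

End SumFun.

Section Moore.
Variables (R : realType) (k : nat).
Local Notation C := (plane R).
Local Notation S1 := (@circle R).
Local Notation D2 := (@disk R).
Local Notation M := (moore_space1 R k).

Lemma cmod0 : cmod (0 : C) = 0.
Proof. by apply/eqP; rewrite cmod_eq0. Qed.

Lemma disk_cmod (z : D2) : cmod (set_val z) <= 1.
Proof. by rewrite -norm_le Rc1; exact: (set_valP z). Qed.

Lemma toD_subproof (z : C) : disk (z * Rc (Num.max 1 (cmod z))^-1).
Proof.
rewrite /disk /= -[X in _ <= X]Rc1 norm_le cmodM cmodRc.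
have m1 : 1 <= Num.max 1 (cmod z) by rewrite le_max lexx.
have m0 : 0 < Num.max 1 (cmod z) := lt_le_trans ltr01 m1.
rewrite ger0_norm ?invr_ge0 ?(ltW m0)// ler_pdivrMr// mul1r.
by rewrite le_max lexx orbT.
Qed.

(** A retraction of the plane onto the disk, so that points of the disk can be written as complex
    numbers without membership proofs. *)
Definition toD (z : C) : D2 := SigSub (mem_set (toD_subproof z)).

Lemma val_toD z : cmod z <= 1 -> set_val (toD z) = z.
Proof.
move=> z1; rewrite set_valE /=.
by rewrite (max_idPl _)// invr1 Rc1 mulr1.
Qed.

Lemma toDK (z : D2) : toD (set_val z) = z.
Proof. by apply/val_inj; apply: val_toD; exact: disk_cmod. Qed.

Lemma toD_continuous : continuous toD.
Proof.
apply: sub_continuous => z; have Fz := nbhs_filter z.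
rewrite (_ : (fun x : C => _) = fun z : C => z * Rc (Num.max 1 (cmod z))^-1)//.
apply: cvgM; first exact: cvg_id.
apply: continuous_cvg; first exact: Rc_continuous.
apply: cvgV; first by rewrite gt_eqF// lt_max ltr01.
apply: (@continuous_comp _ _ _ (fun z : C => (1 : R, cmod z))
  (fun p : R * R => Num.max p.1 p.2)); last exact: max_continuous.
by move: z {Fz}; apply: continuous_pair => z; [exact: cst_continuous|exact: cmod_continuous].
Qed.

Definition toC_val (z : C) : C := if z == 0 then 1 else z * Rc (cmod z)^-1.

Lemma toC_subproof (z : C) : circle (toC_val z).
Proof.
rewrite /circle /= /toC_val; case: eqVneq => [_|z0]; first by rewrite normr1.
have c0 : 0 < cmod z by rewrite lt_neqAle cmod_ge0 andbT eq_sym cmod_eq0.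
apply/cmod_norm1; rewrite cmodM cmodRc ger0_norm ?invr_ge0 ?ltW//.
by rewrite mulfV// gt_eqF.
Qed.

Definition toC (z : C) : S1 := SigSub (mem_set (toC_subproof z)).

Lemma val_toC z : set_val (toC z) = toC_val z. Proof. by []. Qed.

Lemma toC_polar r t : 0 < r -> toC (Rc r * cis t) = circle_cis t.
Proof.
move=> r0; apply/val_inj => /=; rewrite /toC_val cmod_polar ?ltW//.
rewrite -cmod_eq0 cmod_polar ?ltW// gt_eqF//.
by rewrite mulrAC -RcM mulfV ?gt_eqF// mul1r.
Qed.

Lemma toC_circle (s : S1) : toC (set_val s) = s.
Proof.
apply/val_inj => /=; rewrite /toC_val -cmod_eq0 circle_cmod oner_eq0.
by rewrite invr1 mulr1.
Qed.

Lemma within_sub (X Y : topologicalType) (D : set X) (A : set Y) (f : X -> A) :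
  {within D, continuous (fun x => set_val (f x))} -> {within D, continuous f}.
Proof. by move=> cf; apply: continuous_comp_initial. Qed.

Lemma toC_continuous : {within [set z | z != 0], continuous toC}.
Proof.
apply: within_sub; pose g (z : C) : C := z * Rc (cmod z)^-1.
apply: (@subspace_eq_continuous _ _ _ g).
  move=> z; rewrite inE => /negbTE z0.
  by rewrite /from_subspace val_toC /toC_val z0.
apply: (@continuous_in_subspaceT _ _ _ g) => z; rewrite inE /= => z0; have Fz := nbhs_filter z.
apply: cvgM; first exact: cvg_id.
apply: continuous_cvg; first exact: Rc_continuous.
by apply: cvgV; [rewrite cmod_eq0|exact: cmod_continuous].
Qed.

Definition mkD (z : C) : M := qpi _ (sum_inr S1 (toD z)).
Definition circ (w : S1) : M := qpi _ (sum_inl D2 w).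

Lemma mkD_continuous : continuous mkD.
Proof.
move=> z; apply: continuous_comp; last exact: qpi_continuous.
by apply: continuous_comp; [exact: toD_continuous|exact: sum_inr_continuous].
Qed.

Lemma circ_continuous : continuous circ.
Proof.
move=> z; apply: continuous_comp; last exact: qpi_continuous.
exact: sum_inl_continuous.
Qed.

Lemma circ_pow (s : S1) : circ (circle_pow k s) = mkD (set_val s).
Proof.
apply: qpi_eq; exists s; split=> //; congr (sum_inr _ _).
apply/val_inj; apply: (@val_toD (set_val s)).
by rewrite circle_cmod.
Qed.

Lemma circle_pow_cis (t : R) : circle_pow k (circle_cis t) = circle_cis (k%:R * t).
Proof. by apply/val_inj; rewrite /= cisX. Qed.

Lemma circle_cis_surj (w : S1) : exists t, w = circle_cis t.
Proof.
have [t Et] := cis_surj (circle_cmod w).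
by exists t; apply/val_inj; rewrite /= -Et.
Qed.

Lemma circle_cis_inj (s t : R) : circle_cis s = circle_cis t -> exists m : int, s = t + m%:~R.
Proof. by move=> /(congr1 val) /cis_inj. Qed.

Lemma mooreE (U : set M) : open (circ @^-1` U) ->
  open ((fun z : D2 => mkD (set_val z)) @^-1` U) -> open U.
Proof.
move=> oc od; apply: qopen; apply: sum_open; first exact: oc.
rewrite (_ : _ @^-1` _ = (fun z : D2 => mkD (set_val z)) @^-1` U)//.
by apply/seteqP; split=> z; rewrite /= /mkD toDK.
Qed.

Section Lift.
Variables (Z : Type) (f : S1 -> Z) (g : D2 -> Z).
Hypothesis fg : forall s : S1, f (circle_pow k s) = g (circle_incl s).

Lemma moore_compat p q :
  (exists s : S1, p = sum_inl D2 (circle_pow k s) /\ q = sum_inr S1 (circle_incl s)) ->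
  sumfun f g p = sumfun f g q.
Proof. move=> [s [-> ->]]; exact: fg. Qed.

Lemma lift_circ w : sumfun f g (qrepr (circ w)) = f w.
Proof. by rewrite (qlift moore_compat). Qed.

Lemma lift_mkD z : sumfun f g (qrepr (mkD z)) = g (toD z).
Proof. by rewrite (qlift moore_compat). Qed.

End Lift.

Definition rad (q : M) : R :=
  sumfun (fun=> 1) (fun z : D2 => cmod (set_val z)) (qrepr q).

Let rad_compat (s : S1) : 1 = cmod (set_val (circle_incl s)) :> R.
Proof. by rewrite [RHS]circle_cmod. Qed.

Lemma rad_circ w : rad (circ w) = 1.
Proof. exact: (lift_circ rad_compat). Qed.

Lemma rad_mkD z : cmod z <= 1 -> rad (mkD z) = cmod z.
Proof. by move=> z1; rewrite [LHS](lift_mkD rad_compat) val_toD. Qed.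

Lemma rad_continuous : continuous rad.
Proof.
apply: (qlift_continuous (moore_compat rad_compat)).
apply: sumfun_continuous; first by exact: cst_continuous.
by move=> z; apply: continuous_comp; [exact: val_continuous|exact: cmod_continuous].
Qed.

(* Only meaningful in the interior [rad q < 1]. *)
Definition pt (q : M) : C :=
  odflt 0 (sumfun (fun=> None) (fun z : D2 => if cmod (set_val z) < 1 then
    Some (set_val z) else None) (qrepr q)).

Let pt_compat (s : S1) : None = if cmod (set_val (circle_incl s)) < 1 then
  Some (set_val (circle_incl s)) else None.
Proof. by rewrite -rad_compat ltxx. Qed.

Lemma pt_mkD z : cmod z < 1 -> pt (mkD z) = z.
Proof.
by move=> z1; rewrite /pt (lift_mkD pt_compat) val_toD ?z1// ltW.
Qed.

(** The radial retraction onto the attached circle, meaningful away from the centre: z / |z| is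
    glued to its power of exponent [k]. *)
Definition wd (q : M) : S1 :=
  sumfun id (fun z : D2 => circle_pow k (toC (set_val z))) (qrepr q).

Let wd_compat (s : S1) : circle_pow k s = circle_pow k (toC (set_val (circle_incl s))).
Proof. by rewrite [toC _]toC_circle. Qed.

Lemma wd_circ w : wd (circ w) = w.
Proof. exact: (lift_circ wd_compat). Qed.

Lemma wd_mkD z : cmod z <= 1 -> wd (mkD z) = circle_pow k (toC z).
Proof. by move=> z1; rewrite [LHS](lift_mkD wd_compat) val_toD. Qed.

Lemma pt_open (N : set C) (a : R) : a <= 1 -> open N ->
  open [set q : M | rad q < a /\ N (pt q)].
Proof.
move=> a1 oN; apply: mooreE.
  rewrite (_ : _ @^-1` _ = set0); first exact: open0.
  apply/seteqP; split=> w //= []; rewrite rad_circ => a1'; lra.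
rewrite (_ : _ @^-1` _ = (fun z : D2 => set_val z) @^-1` (([set z | cmod z < a]) `&` N)).
  apply: open_comp; first by move=> z _; exact: val_continuous.
  apply: openI => //.
  apply: (@open_comp _ _ (@cmod R) [set t | t < a]); last exact: open_lt.
  by move=> z _; exact: cmod_continuous.
apply/seteqP; split=> z /=; rewrite rad_mkD ?disk_cmod// => -[za].
  by rewrite pt_mkD//; lra.
by rewrite pt_mkD//; lra.
Qed.

Lemma pt_continuous : {within [set q : M | rad q < 1], continuous pt}.
Proof.
apply/subspace_continuousP => q /= q1 N nN.
have := pt_open (lexx 1) (@open_interior C N).
rewrite openE => /(_ q (conj q1 nN)); rewrite /interior.
rewrite nbhs_simpl /= /within /=; apply: filterS => q' [_ Uq'] _.
exact: (@interior_subset C N).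
Qed.

Hypothesis k2 : (2 <= k)%N.
Let k0 : k%:R != 0 :> R. Proof. by rewrite pnatr_eq0; lia. Qed.

(** The power map is onto the circle, so the disk alone covers the Moore space. *)
Lemma moore_surj (q : M) : exists2 z, cmod z <= 1 & q = mkD z.
Proof.
rewrite -[q]qreprK; case: (qrepr q) => -[] x.
  have [t ->] := circle_cis_surj x; exists (cis (t / k%:R)); first by rewrite cmod_cis.
  rewrite -/(circ _) -val_circle_cis -circ_pow circle_pow_cis; congr (circ (circle_cis _)).
  by rewrite mulrCA mulfV ?mulr1.
exists (set_val x); first exact: disk_cmod.
by rewrite /mkD toDK.
Qed.

Lemma mkD_pt q : rad q < 1 -> mkD (pt q) = q.
Proof. by have [z z1 ->] := moore_surj q; rewrite rad_mkD// => z1'; rewrite pt_mkD. Qed.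

(** The circle of radius 1/2 bounds inside the open disk by contraction to the centre, and outside a
    small disk because, pushed to the boundary, it becomes [k] times a loop. If the resulting
    2-cycle bounded, this circle would bound in an annulus, and so would the arcs in the circle. *)
Lemma moore1_not_acyclic (K : comNzRingType) : k%:R = 0 :> K ->
  ~ acyclic R K [set: M] 2.
Proof.
move=> kK aM; apply: (@arcs_not_bounds R K k k2).
pose A := [set q : M | rad q < 1]; pose B := [set q : M | 4^-1 < rad q].
have oA : open A.
  by apply: (@open_comp _ _ rad [set t | t < 1]) => [q _|];
    [exact: rad_continuous|exact: open_lt].
have oB : open B.
  by apply: (@open_comp _ _ rad [set t | 4^-1 < t]) => [q _|];
    [exact: rad_continuous|exact: open_gt].
pose j (x : S1) : M := mkD (set_val x * Rc 2^-1).
pose c := push (fun s => j \o s) (arcs R K k).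
have sarcs : supp (sing [set: S1]) (arcs R K k).
  rewrite /arcs; elim: (iota 0 k) => //= i l ->; rewrite andbT.
  by apply/asboolP/sing_arc.
have contH (l : R -> R) : continuous l ->
    {within [set: S1] `*` unit_interval R,
       continuous (fun p => mkD (set_val p.1 * Rc (l p.2)))}.
  move=> cl; apply: continuous_subspaceT => p.
  apply: (@continuous_comp _ _ _ (fun p : S1 * R => set_val p.1 * Rc (l p.2)) mkD);
    last exact: mkD_continuous.
  have Fp := nbhs_filter p.
  apply: cvgM.
    by apply: continuous_comp; [exact: cvg_fst|exact: val_continuous].
  apply: continuous_cvg; first exact: Rc_continuous.
  by apply: continuous_comp; [exact: cvg_snd|exact: cl].
have cmodj (x : S1) (l : R) : 0 <= l -> cmod (set_val x * Rc l) = l.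
  by move=> l0; rewrite cmodM circle_cmod mul1r cmodRc ger0_norm.
have bA : bounds A c.
  pose H (x : S1) (t : R) := mkD (set_val x * Rc (2^-1 * (1 - t))).
  have -> : c = push (fun s => H^~ 0 \o s) (arcs R K k).
    by congr (push _ _); apply/funext => s; rewrite /H subr0 mulr1.
  apply: (@nullhomotopic_bounds R K _ M setT A H (mkD 0)) => //.
  - apply: (contH (fun t => 2^-1 * (1 - t))) => t.
    by apply: cvgMl_tmp; apply: cvgB; [exact: cvg_cst|exact: cvg_id].
  - move=> x t _ /andP[t0 t1]; rewrite /A /H /= rad_mkD cmodj; lra.
  - by move=> x _; rewrite /H subrr mulr0 Rc0 mulr0.
  - by rewrite /A /= rad_mkD cmod0 ?ler01// ltr01.
  - exact: cycle_arcs.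
have bB : bounds B c.
  (* This homotopy pushes the circle from radius 1/2 out to the boundary. *)
  pose H (x : S1) (t : R) := mkD (set_val x * Rc (2^-1 * (1 + t))).
  have cH : c = push (fun s => H^~ 0 \o s) (arcs R K k).
    by congr (push _ _); apply/funext => s; rewrite /H addr0 mulr1.
  have [||w sw bw] := @homotopy_bounds R K _ M setT B H _ _ _ _ sarcs (@cycle_arcs R K k k2).
  - apply: (contH (fun t => 2^-1 * (1 + t))) => t.
    by apply: cvgMl_tmp; apply: cvgD; [exact: cvg_cst|exact: cvg_id].
  - move=> x t _ /andP[t0 t1]; rewrite /B /H /= rad_mkD cmodj; lra.
  exists (opp w); first by rewrite supp_opp.
  move=> f gf; rewrite ev_bdz_opp bw// cH ev_push.
  rewrite (_ : ev _ (fun s => f (H^~ 1 \o s)) = 0) ?sub0r ?opprK//.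
  (* All [k] arcs arrive at this one simplex, so the sum has the coefficient k = 0. *)
  pose loop : simp R 2 M := fun x => circ (circle_cis (x 0 1)).
  rewrite ev_arcs (eq_bigr (fun=> f loop)).
    by rewrite sumr_const_nat subn0 -mulr_natl kK mul0r.
  move=> i _; congr f; apply/funext => x.
  rewrite /= /H /arc (_ : 2^-1 * (1 + 1) = 1); last by lra.
  rewrite Rc1 mulr1 -circ_pow circle_pow_cis /loop; congr circ.
  by rewrite mulrCA mulfV// mulr1 addrC -[i%:R]/(i%:Z%:~R) circle_cis_int.
have [a sa ba] := bA; have [b sb bb] := bB.
have [w sw bw] : bounds [set: M] (a ++ opp b).
  apply: aM.
    rewrite supp_cat supp_opp; apply/andP; split.
      by apply: sub_supp sa => s; apply: sub_sing.
    by apply: sub_supp sb => s; apply: sub_sing.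
  by move=> f gf; rewrite ev_bdz_cat ev_bdz_opp ba// bb// subrr.
have [d sd bd] : bounds (A `&` B) c.
  apply: (@mayer_vietoris_boundary R K M A B 1 a (opp b) w c) => //.
  - by rewrite supp_opp.
  - rewrite (_ : A `|` B = setT)//; apply/seteqP; split=> // q _; rewrite /A /B /=.
    by have [?|?] := ltP (rad q) 1; [left|right; lra].
  - by move=> f gf; rewrite bw// ev_cat.
  - rewrite supp_push; apply: sub_supp sarcs => s.
    apply: sing_comp; last first.
      by move=> x _; rewrite /A /B /j /= rad_mkD cmodj; lra.
    apply: continuous_subspaceT => x.
    apply: continuous_comp; last exact: mkD_continuous.
    by have Fx := nbhs_filter x; apply: cvgMr_tmp; exact: val_continuous.
  - by move=> f gf; rewrite ba.
(* Radial projection of the annulus back to the circle. *)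
exists (push (fun s => (toC \o pt) \o s) d).
  rewrite supp_push; apply: sub_supp sd => s.
  apply: sing_comp => //.
  apply: (@within_comp _ _ _ _ [set z | z != 0] pt toC).
  - by apply: continuous_subspaceW pt_continuous => q [].
  - exact: toC_continuous.
  - move=> q [qA qB] /=; apply/eqP => q0; move: qB.
    by rewrite -(mkD_pt qA) q0 /B /= rad_mkD cmod0//; lra.
move=> f gf; rewrite bdz_push bd; last exact: good_comp.
rewrite ev_push; apply: eq_ev => s; congr f; apply/funext => x /=.
rewrite pt_mkD; last by rewrite cmodj; lra.
have [t ->] := circle_cis_surj (s x).
by rewrite val_circle_cis mulrC toC_polar// invr_gt0.
Qed.

End Moore.

(** * The lower bound *)

Section LowerBound.
Variables (R : realType).

Lemma good_cover_acyclic (K : comNzRingType) (Y : topologicalType) (U : set (set Y)) n m :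
  good_cover R U -> (U #= `I_n)%card -> (n <= m.+1)%N -> acyclic R K [set: Y] m.
Proof.
move=> [[oU cU] _ gU] Un nm.
have fU : finite_set U by apply/finite_setP; exists n.
have [L UL] : exists2 L : seq (set Y), (forall A, U A <-> A \in L) & size L = n.
  exists (finmap.enum_fset (fset_set U)); last exact: card_fset_set.
  move=> A; split=> [UA|AL]; last first.
    by apply: set_mem; rewrite -(in_fset_set fU A); exact: AL.
  by have := in_fset_set fU A; rewrite (mem_set UA) => UA'; exact: UA'.
move=> sL.
have foldE (L' : seq (set Y)) :
    foldr setI setT L' = \bigcap_(A in [set A | A \in L']) A.
  elim: L' => [|A L' IH] /=.
    by apply/esym/seteqP; split=> // x _ B.
  rewrite IH; apply/seteqP; split=> x.
    by move=> [Ax xL] B /=; rewrite in_cons => /predU1P[->//|/xL].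
  move=> xL; split; first by apply: xL; exact: mem_head.
  by move=> B /= BL; apply: xL; rewrite /= in_cons BL orbT.
rewrite (_ : [set: Y] = foldr setU set0 L).
  apply: nerve_acyclic; last by rewrite sL.
    by move=> A /UL; exact: oU.
  move=> L' L'L L'0 p; rewrite foldE.
  (* A good cover says nothing about empty intersections, but these are acyclic as well. *)
  have [[x xI]|/nonemptyPn ->] := pselect (\bigcap_(A in [set A | A \in L']) A !=set0);
    last exact: acyclic0.
  apply: contractible_acyclic; apply: gU; last by exists x.
  - by move=> A /= /L'L /UL.
  - exact: finite_seq.
  - by case: L' L'0 {L'L xI} => // A L' _; exists A; exact: mem_head.
apply/seteqP; split=> // x _.
have : (\bigcup_(A in U) A) x by rewrite cU.
move=> [A /UL]; elim: L {UL sL} => //= B L IH; rewrite in_cons => /predU1P[->|AL] Ax.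
  by left.
by right; apply: IH.
Qed.

Lemma moore_not_acyclic k i : (1 <= i)%N -> (2 <= k)%N ->
  ~ acyclic R 'Z_k [set: moore_space R k i] i.+1.
Proof.
case: i => // i _ k2; rewrite /moore_space /=.
elim: i => [|i IH] /=; first exact: (@moore1_not_acyclic R k k2 _ (pchar_Zp k2)).
by move=> /suspension_acyclic.
Qed.

Lemma ct_moore_ge k i : (1 <= i)%N -> (2 <= k)%N ->
  ((i + 3)%N%:R%:E <= ct R (moore_space R k i))%E.
Proof.
move=> i1 k2; apply/ereal_infP => _ [Y [YM ->]].
apply/ereal_infP => _ [n [U [gU Un]] <-].
rewrite lee_fin ler_nat leqNgt; apply/negP => ni.
apply: (moore_not_acyclic i1 k2); apply: (homotopy_equivalent_acyclic YM).
(* Here [n < i + 3] amounts to [n <= (i + 1) + 1], the bound that gives acyclicity in degree i +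
   1. *)
by apply: (good_cover_acyclic gU Un); lia.
Qed.

End LowerBound.

(** * Good covers of suspensions *)

Section Contractible.
Variable R : realType.
Local Notation I01 := (unit_interval R).

Lemma contractible_raw (X : topologicalType) (S : set X) (H : X -> R -> X) (x0 : X) :
  S x0 -> {within S `*` I01, continuous (fun p => H p.1 p.2)} ->
  (forall x t, S x -> I01 t -> S (H x t)) ->
  (forall x, S x -> H x 0 = x) -> (forall x, S x -> H x 1 = x0) ->
  contractible R S.
Proof.
move=> Sx0 cH HS H0 H1; exists (SigSub (mem_set Sx0)).
have hS (p : S * I01) : H (set_val p.1) (set_val p.2) \in S.
  by apply/mem_set/HS; apply: set_valP.
exists (fun p => SigSub (hS p)); split=> [|x t t0|x t t1]; last 2 first.
- apply/val_inj; rewrite /= t0 H0//; exact: set_valP.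
- apply/val_inj; rewrite /= t1 H1//; exact: set_valP.
apply: sub_continuous => p.
have -> : (fun x => set_val (SigSub (hS x) : S)) =
    sigL (S `*` I01) (fun p => H p.1 p.2) \o @sigT_of_setX _ _ S I01.
  by apply/funext.
apply: continuous_comp; first exact: sigT_of_setX_continuous.
by move/subspace_sigL_continuousP : cH; apply.
Qed.

(* Continuity of a homotopy on a space coherently covered by two maps: this is
   the fact that taking the product with the interval preserves quotients. *)
Lemma coherent_homotopy (Q T1 T2 Z : topologicalType) (p1 : T1 -> Q) (p2 : T2 -> Q)
    (D : set Q) (G : Q -> R -> Z) :
  (forall U : set Q, open (p1 @^-1` U) -> open (p2 @^-1` U) -> open U) ->
  continuous p1 -> continuous p2 ->
  (forall q, (exists a, q = p1 a) \/ (exists a, q = p2 a)) ->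
  open D ->
  {within (p1 @^-1` D) `*` I01, continuous (fun p => G (p1 p.1) p.2)} ->
  {within (p2 @^-1` D) `*` I01, continuous (fun p => G (p2 p.1) p.2)} ->
  {within D `*` I01, continuous (fun p => G p.1 p.2)}.
Proof.
move=> coh c1 c2 surj oD g1 g2.
(* Tube lemma: over a compact set of times the condition on [q] is open after pulling back along
   [p]. Having it for both maps, coherence makes it open in [Q], which is impossible to arrange with
   a single time neighbourhood per preimage. *)
have tube (T : topologicalType) (p : T -> Q) (K : set R) (N : set Z) :
    continuous p ->
    {within (p @^-1` D) `*` I01, continuous (fun x => G (p x.1) x.2)} ->
    compact K -> open N ->
    open (p @^-1` [set q | D q /\ forall t, K t -> I01 t -> N (G q t)]).
  move=> cp /subspace_continuousP cg cK oN; rewrite openE => a /= [Da Na].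
  have nD : \forall a' \near a, D (p a').
    by apply: (cp a); apply: open_nbhs_nbhs.
  have /compact_near_coveringP/(_ T (nbhs a)
    (fun a' t => I01 t -> D (p a') -> N (G (p a') t))) := cK.
  move=> HK; rewrite /interior.
  have {}HK := HK (nbhs_filter a).
  suff : \forall a' \near a, forall t, K t -> I01 t -> D (p a') -> N (G (p a') t).
    move=> Ha; near=> a'; split; first by near: a'.
    move=> t Kt It; have : forall t, K t -> I01 t -> D (p a') -> N (G (p a') t).
      by near: a'.
    by apply=> //; near: a'.
  apply: HK => t Kt; case: (pselect (I01 t)) => It.
    have := cg (a, t) (conj Da It) _ (open_nbhs_nbhs (conj oN (Na t Kt It))).
    rewrite /= nbhs_simpl /= /within /= => -[[P1 P2] /= [nP1 nP2] HP].
    exists (P2, P1) => //= -[t' a'] /= [Pt' Pa'] It' Da'.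
    exact: (HP (a', t')).
  have cI : closed I01.
    rewrite (_ : I01 = `[0, 1]%classic); first exact: interval_closed.
    by apply/seteqP; split=> x /=; rewrite in_itv.
  have nI : nbhs t (~` I01) by apply: open_nbhs_nbhs; split=> //; exact: closed_openC.
  exists (~` I01, setT) => /=; first by split=> //; exact: filterT.
  by move=> [t' a'] /= [nIt' _] It'.
apply/subspace_continuousP => -[q0 t0] [/= Dq0 It0] N nN.
pose N' : set Z := N°.
have oN' : open N' := @open_interior Z N.
(* Continuity in time at the fixed point [q0] yields a compact segment of times to which the tube
   lemma applies. *)
have [e e0 He] : exists2 e : R, 0 < e &
    forall t, `[t0 - e, t0 + e]%classic t -> I01 t -> N' (G q0 t).
  have key (T : topologicalType) (p : T -> Q) a : q0 = p a ->
      {within (p @^-1` D) `*` I01, continuous (fun x => G (p x.1) x.2)} ->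
      exists2 e : R, 0 < e &
      forall t, `[t0 - e, t0 + e]%classic t -> I01 t -> N' (G q0 t).
    move=> qa /subspace_continuousP cg.
    have Da : D (p a) by rewrite -qa.
    have N'a : nbhs (G (p a) t0) N'.
      by rewrite -qa; apply: open_nbhs_nbhs; split.
    have := cg (a, t0) (conj Da It0) _ N'a.
    rewrite /= nbhs_simpl /= /within /= => -[[P1 P2] /= [nP1]].
    move=> /nbhs_ballP[e /= e0 eP2] HP.
    exists (e / 2); first by rewrite divr_gt0.
    move=> t; rewrite /= in_itv /= => /andP[t1 t2] It.
    rewrite qa; apply: (HP (a, t)) => //; split; first exact: nbhs_singleton.
    by apply: eP2; rewrite /ball /= ltr_norml; lra.
  by have [[a qa]|[a qa]] := surj q0; [apply: key qa g1|apply: key qa g2].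
have cK := @segment_compact R (t0 - e) (t0 + e).
have oV := coh _ (tube _ _ _ _ c1 g1 cK oN') (tube _ _ _ _ c2 g2 cK oN').
rewrite nbhs_simpl /= /within /=.
exists ([set q | D q /\ forall t, `[t0 - e, t0 + e]%classic t -> I01 t -> N' (G q t)],
        ball t0 e).
  split; last exact: nbhsx_ballx.
  by apply: open_nbhs_nbhs; split.
move=> [q t] /= [[Dq HG] te] [_ It]; apply: (@interior_subset Z N); apply: HG => //.
by rewrite /= in_itv /=; move: te; rewrite /ball /= ltr_norml; lra.
Unshelve. all: by end_near. Qed.

End Contractible.

Section Covered.
Variable R : realType.
Local Notation I01 := (unit_interval R).

(** [F] may repeat sets, so [n] only bounds the size of the cover from above. *)
Definition covered (X : topologicalType) (n : nat) :=
  exists F : nat -> set X, good_cover R (F @` `I_n).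

Lemma ct_le X n : covered X n -> (ct R X <= n%:R%:E)%E.
Proof.
move=> [F gF]; apply: ge_ereal_inf; exists (sct R X).
  exists X; split=> //; exists idfun, idfun.
  have hid : homotopic R (idfun \o idfun) (@idfun X).
    by exists fst; split=> // p; exact: cvg_fst.
  by split=> // x; exact: cvg_id.
have fF : finite_set (F @` `I_n) by exact: finite_image.
have [m Em] := (finite_setP _).1 fF.
apply: ge_ereal_inf; exists m%:R%:E; first by exists m => //; exists (F @` `I_n).
rewrite lee_fin ler_nat -card_le_II -(card_le_eql Em).
exact: card_image_le.
Qed.

(** One check on intersections is enough: singleton families give the members themselves. *)
Lemma good_coverI (X : topologicalType) (U : set (set X)) :
  (forall A, U A -> open A) -> (forall x, exists2 A, U A & A x) ->
  (forall A, U A -> A !=set0) ->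
  (forall V, V `<=` U -> V !=set0 -> \bigcap_(A in V) A !=set0 ->
     contractible R (\bigcap_(A in V) A)) ->
  good_cover R U.
Proof.
move=> oU cU nU gU; split=> //.
- split=> //; apply/seteqP; split=> // x _.
  by have [A UA Ax] := cU x; exists A.
- move=> A UA; have := gU [set A]; rewrite bigcap_set1; apply.
  + by move=> _ ->.
  + by exists A.
  + exact: nU.
- by move=> V VU _; exact: gU.
Qed.

Lemma within_openS (X Y : topologicalType) (A B : set X) (f : X -> Y) :
  A `<=` B -> {within B, continuous f} -> {within A, continuous f}.
Proof. by move=> AB; exact: continuous_subspaceW. Qed.

Section Susp.
Variable X : topologicalType.
Local Notation S := (suspension R X).

(** For homotopies that only move the height. Upstairs, on the product of [X] with the interval,
    they are given by a continuous formula, and [coherent_homotopy] brings this down to the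
    suspension. *)
Lemma sus_homotopy (D : set S) (G : S -> R -> S) (l : R -> R -> R) :
  open D -> continuous (fun p => l p.1 p.2) ->
  (forall x u t, D (sus x u) -> I01 u -> I01 t -> G (sus x u) t = sus x (l u t)) ->
  {within D `*` I01, continuous (fun p => G p.1 p.2)}.
Proof.
move=> oD cl HG.
have key : {within (qpi _ @^-1` D) `*` I01, continuous (fun p => G (qpi _ p.1) p.2)}.
  pose g (p : (X * I01) * R) := sus p.1.1 (l (set_val p.1.2) p.2).
  apply: (@subspace_eq_continuous _ _ _ g).
    move=> -[[x u] t]; rewrite inE /= => -[Dxu It].
    rewrite /from_subspace /g /= -[in RHS](toIK u) -HG//; last exact: (set_valP u).
    by rewrite /sus toIK.
  apply: continuous_subspaceT => p.
  apply: (@continuous_comp _ _ _ (fun p : (X * I01) * R => (p.1.1, l (set_val p.1.2) p.2))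
    (fun p : X * R => sus p.1 p.2)); last exact: sus_continuous.
  move: p; apply: continuous_pair => p.
    by apply: continuous_comp; exact: cvg_fst.
  apply: (@continuous_comp _ _ _ (fun p : (X * I01) * R => (set_val p.1.2 : R, p.2))
    (fun p : R * R => l p.1 p.2)); last exact: cl.
  move: p; apply: continuous_pair => p; last exact: cvg_snd.
  apply: (@continuous_comp _ _ _ (fun p : (X * I01) * R => p.1.2) set_val);
    last exact: val_continuous.
  by apply: continuous_comp; [exact: cvg_fst|exact: cvg_snd].
apply: (coherent_homotopy (p1 := qpi _) (p2 := qpi _)) => //.
- exact: qpi_continuous.
- exact: qpi_continuous.
- by move=> q; left; exists (qrepr q); rewrite qreprK.
Qed.

Lemma open_height_gt (a : R) : open [set q : S | a < height q].
Proof.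
by apply: (@open_comp _ _ (@height R X) [set t | a < t]) => [q _|];
  [exact: height_continuous|exact: open_gt].
Qed.

Lemma open_height_lt (a : R) : open [set q : S | height q < a].
Proof.
by apply: (@open_comp _ _ (@height R X) [set t | t < a]) => [q _|];
  [exact: height_continuous|exact: open_lt].
Qed.

Lemma interp_continuous (a : R) :
  continuous (fun p : R * R => (1 - p.2) * p.1 + p.2 * a).
Proof.
move=> p; apply: cvgD; last by apply: cvgMr_tmp; exact: cvg_snd.
apply: cvgM; last exact: cvg_fst.
by apply: cvgB; [exact: cvg_cst|exact: cvg_snd].
Qed.

Lemma suspension_covered n : (exists x : X, True) -> covered X n -> covered S n.+1.
Proof.
move=> [x0 _] [F [[oF cF] nF gF]].
pose bot : set S := [set q | height q < 2^-1].
pose V (A : set X) : set S :=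
  [set q | 2^-1 < height q \/ 4^-1 < height q /\ A (base q)].
pose G i := if (i < n)%N then V (F i) else bot.
have Gbot : G n = bot by rewrite /G ltnn.
have GV i : (i < n)%N -> G i = V (F i) by rewrite /G => ->.
have Gn A : (G @` `I_n.+1) A -> A = bot \/ exists2 i, (i < n)%N & A = V (F i).
  move=> [i /= _ <-]; rewrite /G; case: ifP => [ni|_]; last by left.
  by right; exists i.
have h1 x : height (sus x 1) = 1 :> R by rewrite height_sus// ler01 lexx.
have h0 x : height (sus x 0) = 0 :> R by rewrite height_sus// ler01 lexx.
exists G; apply: good_coverI.
- move=> A /Gn[->|[i ni ->]]; first exact: open_height_lt.
  (* Bounding the height by 1 in the second piece avoids the pole, where the base point is
     arbitrary, and loses nothing. *)
  rewrite (_ : V (F i) = [set q | 2^-1 < height q] `|`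
      [set q | 4^-1 < height q < 1 /\ F i (base q)]); last first.
    apply/seteqP; split=> q; rewrite /V /=.
      case=> [?|[q4 Fq]]; first by left.
      have [q2|q2] := ltP 2^-1 (height q); first by left.
      by right; split=> //; rewrite q4 /=; lra.
    by case=> [?|[/andP[? _] ?]]; [left|right].
  apply: openU; first exact: open_height_gt.
  by apply: open_height_base; [lra|lra|apply: oF; exists i].
- move=> q; have [q2|q2] := ltP (height q) 2^-1.
    by exists bot => //; exists n => //=.
  have : (\bigcup_(A in F @` `I_n) A) (base q) by rewrite cF.
  move=> [_ [i /= ni <-] Fq]; exists (V (F i)); last by right; split=> //; lra.
  by exists i; [rewrite /= ltnW|exact: GV].
- move=> A /Gn[->|[i ni ->]].
    by exists (sus x0 0); rewrite /bot /= h0; lra.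
  by exists (sus x0 1); left; rewrite h1; lra.
move=> W WG [A0 WA0] [q0 Wq0].
pose U := [set A | (F @` `I_n) A /\ W (V A)].
have WU B : W B -> B = bot \/ exists2 A, U A & B = V A.
  move=> WB; have [->|[i ni E]] := Gn _ (WG _ WB); first by left.
  by right; exists (F i) => //; split; [exists i|rewrite -E].
have finU : finite_set U.
  by apply: (@sub_finite_set _ _ (F @` `I_n)); [move=> A []|exact: finite_image].
(* Without the lower cone, everything can be pushed up into the upper pole: raising the height never
   leaves a set [V A]. *)
have [Wbot|nWbot] := pselect (W bot); last first.
  pose H (q : S) (t : R) := sus (base q) ((1 - t) * height q + t * 1).
  have hH q t : I01 t -> height (H q t) = (1 - t) * height q + t.
    move=> /andP[t0 t1]; rewrite /H mulr1 height_sus//.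
    by have /andP[q0' q1] := height01 q; nra.
  have bH q t : I01 t -> 0 < height q -> height (H q t) < 1 -> base (H q t) = base q.
    move=> It qp; rewrite hH// => q1; rewrite /H mulr1 base_sus// q1 andbT.
    by move: It => /andP[t0 t1]; nra.
  have sub q : (\bigcap_(A in W) A) q -> 4^-1 < height q.
    move=> Wq; have := Wq _ WA0; case: (WU _ WA0) => [E|[A UA ->]].
      by case: nWbot; rewrite -E.
    by case=> [|[]//]; lra.
  apply: (@contractible_raw _ _ _ H (sus x0 1)).
  - move=> B WB; case: (WU _ WB) => [E|[A UA ->]]; first by case: nWbot; rewrite -E.
    by left; rewrite h1; lra.
  - apply: (@within_openS _ _ _ ([set q | 4^-1 < height q] `*` I01)).
      by move=> [q t] [/sub ? ?].
    apply: (@sus_homotopy _ H (fun u t => (1 - t) * u + t * 1)).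
    + exact: open_height_gt.
    + exact: interp_continuous.
    move=> x u t; rewrite /= => + u01 t01; rewrite height_sus// => u4.
    rewrite /H height_sus//; have [u1|u1] := ltP u 1.
      by rewrite base_sus// u1 andbT; lra.
    have -> : u = 1 by move: u01 => /andP[]; lra.
    rewrite (_ : (1 - t) * 1 + t * 1 = 1); [exact: sus1|by ring].
  - move=> q t Wq It B WB; have := Wq _ WB; have q4 := sub _ Wq.
    case: (WU _ WB) => [E|[A UA ->]]; first by case: nWbot; rewrite -E.
    have hq : height q <= height (H q t).
      by rewrite hH//; move: It (height01 q) => /andP[? ?] /andP[? ?]; nra.
    case=> [q2|[_ Aq]]; first by left; lra.
    have [Hq1|Hq1] := ltP (height (H q t)) 1; last by left; lra.
    by right; rewrite bH//; [split=> //; lra|lra].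
  - by move=> q _; rewrite /H subr0 mul1r mul0r addr0 sus_base.
  - by move=> q _; rewrite /H subrr mul0r mul1r add0r; exact: sus1.
(* The lower cone alone contracts to the lower pole. *)
have [[A1 UA1]|nU] := pselect (exists A, U A); last first.
  rewrite (_ : \bigcap_(A in W) A = bot); last first.
    apply/seteqP; split=> q; first by apply.
    by move=> qb B /WU[->//|[A UA _]]; case: nU; exists A.
  pose H (q : S) (t : R) := sus (base q) ((1 - t) * height q + t * 0).
  apply: (@contractible_raw _ _ _ H (sus x0 0)).
  - by rewrite /bot /= h0; lra.
  - apply: (@sus_homotopy _ H (fun u t => (1 - t) * u + t * 0)).
    + exact: open_height_lt.
    + exact: interp_continuous.
    move=> x u t; rewrite /bot /= => + u01 t01; rewrite height_sus// => u2.
    rewrite /H height_sus//; have [u0|u0] := ltP 0 u.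
      by rewrite base_sus// u0 /=; lra.
    have -> : u = 0 by move: u01 => /andP[]; lra.
    rewrite (_ : (1 - t) * 0 + t * 0 = 0); [exact: sus0|by ring].
  - move=> q t; rewrite /bot /= => q2 /andP[t0 t1].
    by rewrite /H height_sus; have /andP[? ?] := height01 q; nra.
  - by move=> q _; rewrite /H subr0 mul1r mul0r addr0 sus_base.
  - by move=> q _; rewrite /H subrr mul0r add0r mulr0; exact: sus0.
(* In the mixed case the intersection avoids both poles: it is a cylinder over [N], and [N] is
   contractible by assumption. *)
pose N := \bigcap_(A in U) A.
have NE : \bigcap_(A in W) A = [set q | 4^-1 < height q < 2^-1 /\ N (base q)].
  apply/seteqP; split=> q /= Wq.
    have q2 : height q < 2^-1 by exact: (Wq bot).
    have VU A : U A -> 4^-1 < height q /\ A (base q).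
      by move=> [_ /Wq[|//]]; lra.
    split; first by rewrite q2 andbT; have [] := VU _ UA1.
    by move=> A /VU[].
  move: Wq => [/andP[q4 q2] Nq] B /WU[->//|[A UA ->]].
  by right; split=> //; exact: Nq.
have N0 : N !=set0 by exists (base q0); move: Wq0; rewrite NE => -[].
have [y [h [Ny ch hN hh0 hh1]]] : exists (x0 : X) (H : X -> R -> X),
    [/\ N x0, {within N `*` I01, continuous (fun p => H p.1 p.2)},
      (forall x t, N x -> I01 t -> N (H x t)),
      (forall x, H x 0 = x) & (forall x, H x 1 = x0)].
  apply: raw_contraction; apply: gF => //; first by move=> A [].
  by exists A1.
rewrite NE; set T := [set q | _].
(* The height 3/8 is the middle of the interval from 1/4 to 1/2. *)
pose H (q : S) (t : R) := sus (h (base q) t) ((1 - t) * height q + t * (3 / 8)).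
have hI q t : T q -> I01 t -> 4^-1 < (1 - t) * height q + t * (3 / 8) < 2^-1.
  by move=> [/andP[? ?] _] /andP[? ?]; apply/andP; split; nra.
apply: (@contractible_raw _ _ _ H (sus y (3 / 8))).
- rewrite /T /= height_sus; last by lra.
  by rewrite base_sus; [split=> //; lra|lra].
- apply: (@within_comp _ _ _ _ [set: (X * R)%type]
    (fun p : S * R => (h (base p.1) p.2, (1 - p.2) * height p.1 + p.2 * (3 / 8)))
    (fun p => sus p.1 p.2)) => //; last first.
    by apply: continuous_subspaceT; exact: sus_continuous.
  apply: within_pair.
    apply: (@within_comp _ _ _ _ (N `*` I01) (fun p : S * R => (base p.1, p.2))
      (fun p => h p.1 p.2)) => //; last by move=> [q t] [[_ Nq] It].
    apply: within_pair; last by apply: continuous_subspaceT => p; exact: cvg_snd.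
    apply: (@within_comp _ _ _ _ [set q : S | 4^-1 < height q < 2^-1] fst (@base R X)).
    + by apply: continuous_subspaceT => p; exact: cvg_fst.
    + by apply: base_continuous; lra.
    + by move=> [q t] [[? _] _].
  apply: continuous_subspaceT => p.
  apply: (@continuous_comp _ _ _ (fun p : S * R => (height p.1, p.2))
    (fun p : R * R => (1 - p.2) * p.1 + p.2 * (3 / 8))); last exact: interp_continuous.
  move: p; apply: continuous_pair => p; last exact: cvg_snd.
  by apply: continuous_comp; [exact: cvg_fst|exact: height_continuous].
- move=> q t Tq It; have /andP[hI1 hI2] := hI _ _ Tq It; case: (Tq) => _ Nq.
  rewrite /T /H /= height_sus; last by lra.
  by rewrite base_sus; [split; [lra|exact: hN]|lra].
- by move=> q _; rewrite /H hh0 subr0 mul1r mul0r addr0 sus_base.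
- by move=> q _; rewrite /H hh1 subrr mul0r mul1r add0r.
Qed.

End Susp.
End Covered.

(** * A good cover of the Moore space of dimension two *)

Section Sectors.
Variables (R : realType) (N : nat) (j : R).
Hypothesis N3 : (3 <= N)%N.
Local Notation C := (plane R).

(* In units of [1 / N] turn, the open sector of half-width [2 / 3] around [j]. *)
Definition sec : set C := [set z | 0 < re (z * cis (- (j / N%:R))) /\
  `|N%:R * turn (z * cis (- (j / N%:R)))| < 2 / 3].

(** On the sector this is the lift of the angle that lies near [j]. *)
Definition chart (z : C) : R := j + N%:R * turn (z * cis (- (j / N%:R))).

Let N0 : 0 < N%:R :> R. Proof. by rewrite ltr0n; lia. Qed.
Let N3' : 3 <= N%:R :> R. Proof. by rewrite ler_nat. Qed.

(** Since [N] is at least 3, the half-width is at most 2/9 < 1/4 of a turn: a sector fits in the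
    half-plane where [turn] is the angle. *)
Lemma turn_bound (a : R) : `|N%:R * a| < 2 / 3 -> - 4^-1 < a < 4^-1.
Proof. by rewrite ltr_norml => /andP[a1 a2]; have N3R := N3'; apply/andP; split; nra. Qed.

Lemma rot_continuous (a : R) : continuous (fun z : C => z * cis a).
Proof. by move=> z; have Fz := nbhs_filter z; apply: cvgMr_tmp; exact: cvg_id. Qed.

Lemma chart_cvg z : sec z -> {for z, continuous chart}.
Proof.
move=> [z0 _]; have Fz := nbhs_filter z.
apply: cvgD; first exact: cvg_cst.
apply: cvgMl_tmp.
apply: (@continuous_comp _ _ _ (fun z : C => z * cis (- (j / N%:R))) (@turn R)).
  exact: rot_continuous.
exact: turn_continuous.
Qed.

Lemma sec_open : open sec.
Proof.
rewrite openE => z sz; have Fz := nbhs_filter z; have [z0 zj] := sz.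
rewrite /interior; apply: filterI.
  have : {for z, continuous (@re R \o (fun z : C => z * cis (- (j / N%:R))))}.
    by apply: continuous_comp; [exact: rot_continuous|exact: re_continuous].
  by move=> cf; apply: (cf [set t | 0 < t]); exact: lt_nbhsr.
have := chart_cvg sz => /(_ [set t | `|t - j| < 2 / 3]) /=.
move=> H; have {}H : nbhs z (chart @^-1` [set t | `|t - j| < 2 / 3]).
  apply: H; apply: open_nbhs_nbhs; split; last first.
    by rewrite /= /chart addrAC subrr add0r.
  rewrite (_ : mkset _ = ball j (2 / 3)); first exact: ball_open.
  by apply/seteqP; split=> t; rewrite /ball /= distrC.
by apply: filterS H => w /=; rewrite /chart addrAC subrr add0r.
Qed.

Lemma chart_continuous : {within sec, continuous chart}.
Proof.
by apply: continuous_in_subspaceT => z /set_mem; exact: chart_cvg.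
Qed.

Lemma chart_bound z : sec z -> `|chart z - j| < 2 / 3.
Proof. by move=> [_]; rewrite /chart addrAC subrr add0r. Qed.

Lemma polar_re_gt0 (r a : R) : 0 < r -> - 4^-1 < a < 4^-1 -> 0 < re (Rc r * cis a).
Proof.
move=> r0 /andP[a1 a2]; rewrite reM reRc imRc mul0r subr0 re_cis.
apply: mulr_gt0 => //; apply: cos_gt0_pihalf.
by have pi0 := @pi_gt0 R; apply/andP; split; nra.
Qed.

Lemma turnE (z : C) : 0 < re z -> z = Rc (cmod z) * cis (turn z).
Proof.
move=> z0; have pi0 := @pi_gt0 R.
have c0 : 0 < cmod z.
  by apply: lt_le_trans z0 _; apply: le_trans (ler_norm _) (re_le_cmod _).
have ct := cos_atan (im z / re z).
have tt : 2 * pi * turn z = atan (im z / re z) by rewrite /turn; field; lra.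
have sq : Num.sqrt (1 + (im z / re z) ^+ 2) = cmod z / re z.
  have c2 : cmod z ^+ 2 = re z ^+ 2 + im z ^+ 2.
    by rewrite cmodE sqr_sqrtr// addr_ge0 ?sqr_ge0.
  rewrite -[RHS]ger0_norm ?divr_ge0 ?ltW// -sqrtr_sqr; congr Num.sqrt.
  by rewrite [in RHS]expr_div_n c2; field; rewrite gt_eqF.
have cosE : cos (2 * pi * turn z) = re z / cmod z by rewrite tt ct sq invf_div.
have sinE : sin (2 * pi * turn z) = im z / cmod z.
  have := atanK (im z / re z); rewrite -tt /tan cosE => /(congr1 (fun x => x * (re z / cmod z))).
  rewrite divfK; last by apply: mulf_neq0; rewrite ?invr_eq0 gt_eqF.
  by move=> ->; field; rewrite !gt_eqF.
by apply: plane_eq; rewrite ?reM ?imM reRc imRc re_cis im_cis cosE sinE; field; rewrite gt_eqF.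
Qed.

Lemma sec_polar z : sec z -> z = Rc (cmod z) * cis (chart z / N%:R).
Proof.
move=> [z0 zj]; rewrite /chart mulrDl mulrAC mulfV ?gt_eqF// mul1r.
have := turnE z0; rewrite cmodM cmod_cis mulr1 => E1.
by rewrite addrC cisD mulrA -E1 -mulrA -cisD addNr cis0 mulr1.
Qed.

Lemma polar_sec (r t : R) : 0 < r -> `|t - j| < 2 / 3 ->
  sec (Rc r * cis (t / N%:R)) /\ chart (Rc r * cis (t / N%:R)) = t.
Proof.
move=> r0 tj; have E1 : Rc r * cis (t / N%:R) * cis (- (j / N%:R)) = Rc r * cis ((t - j) / N%:R).
  by rewrite -mulrA -cisD -mulrBl.
have Nt : N%:R * ((t - j) / N%:R) = t - j by rewrite mulrCA mulfV ?mulr1// gt_eqF.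
have b : - 4^-1 < (t - j) / N%:R < 4^-1 by apply: turn_bound; rewrite Nt.
rewrite /chart /sec /mkset E1 turn_polar// Nt; split; last by rewrite addrC subrK.
by split=> //; apply: polar_re_gt0.
Qed.

Lemma sec_polarP (r t : R) : 0 < r ->
  sec (Rc r * cis (t / N%:R)) <-> exists m : int, `|t + N%:R * m%:~R - j| < 2 / 3.
Proof.
move=> r0; split=> [sz|[m tm]].
  have := sec_polar sz; rewrite cmod_polar ?ltW// => E1.
  have r0' : Rc r != 0 by rewrite -Rc0 (inj_eq (@Rc_inj R)) gt_eqF.
  have /cis_inj[m Em] := mulfI r0' E1.
  exists (- m); have -> : t + N%:R * (- m)%:~R = chart (Rc r * cis (t / N%:R)).
    have -> : chart (Rc r * cis (t / N%:R)) = (t / N%:R - m%:~R) * N%:R.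
      by rewrite [X in _ = (X - _) * _]Em addrK divfK// gt_eqF.
    by rewrite mulrNz mulrBl divfK ?gt_eqF// mulrN [m%:~R * _]mulrC.
  exact: chart_bound.
have [+ _] := polar_sec r0 tm.
by rewrite mulrDl mulrAC mulfV ?gt_eqF// mul1r cisD cis_int mulr1.
Qed.

End Sectors.

(** * Core, petals and bands *)

Section MooreCover.
Variables (R : realType) (k : nat).
Hypothesis k2 : (2 <= k)%N.
Local Notation C := (plane R).
Local Notation S1 := (@circle R).
Local Notation D2 := (@disk R).
Local Notation M := (moore_space1 R k).
Local Notation I01 := (unit_interval R).
Local Notation N := (3 * k)%N.

Let N3 : (3 <= N)%N. Proof. by lia. Qed.
Let N0 : 0 < N%:R :> R. Proof. by rewrite ltr0n; lia. Qed.
Let k0 : 0 < k%:R :> R. Proof. by rewrite ltr0n; lia. Qed.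

(* Polar coordinates on the Moore space, the angle being measured in units of
   [1 / (3 k)] turn of the disk, that is [1 / 3] turn of the circle. *)
Definition pol (r t : R) : M := mkD k (Rc r * cis (t / N%:R)).

Lemma pol_continuous : continuous (fun p => pol p.1 p.2).
Proof.
move=> p; apply: (@continuous_comp _ _ _
  (fun p : R * R => Rc p.1 * cis (p.2 / N%:R)) (mkD k)); last exact: mkD_continuous.
apply: cvgM.
  by apply: continuous_cvg; [exact: Rc_continuous|exact: cvg_fst].
apply: continuous_cvg; first exact: cis_continuous.
by apply: cvgMr_tmp; exact: cvg_snd.
Qed.

Lemma rad_pol r t : 0 <= r <= 1 -> rad (pol r t) = r.
Proof. by move=> /andP[r0 r1]; rewrite rad_mkD cmod_polar. Qed.

Lemma pt_pol r t : 0 <= r < 1 -> pt (pol r t) = Rc r * cis (t / N%:R).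
Proof. by move=> /andP[r0 r1]; rewrite pt_mkD// cmod_polar. Qed.

Lemma angle_circle t : k%:R * (t / N%:R) = t / 3 :> R.
Proof. by rewrite natrM; field; rewrite gt_eqF. Qed.

Lemma wd_pol r t : 0 < r <= 1 -> wd (pol r t) = circle_cis (t / 3).
Proof.
move=> /andP[r0 r1]; rewrite wd_mkD ?cmod_polar ?(ltW r0)//.
by rewrite toC_polar// circle_pow_cis angle_circle.
Qed.

Lemma pol_surj q : exists r t, 0 <= r <= 1 /\ q = pol r t.
Proof.
have [z z1 ->] := moore_surj k2 q; have [t Ez] := polar z.
exists (cmod z), (N%:R * t); split; first by rewrite cmod_ge0.
by rewrite /pol mulrAC mulfV ?mul1r -?Ez// gt_eqF.
Qed.

(** At radius 1 the gluing leaves only the angle on the attached circle, that is the angle modulo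
    3. *)
Lemma pol1_eq s t : circle_cis (s / 3) = circle_cis (t / 3) -> pol 1 s = pol 1 t.
Proof.
move=> st; have key x : pol 1 x = circ k (circle_cis (x / 3)).
  by rewrite /pol Rc1 mul1r -[cis _]val_circle_cis -circ_pow circle_pow_cis angle_circle.
by rewrite !key st.
Qed.

Lemma pol_period r t (m : int) : pol r (t + N%:R * m%:~R) = pol r t.
Proof. by rewrite /pol mulrDl mulrAC mulfV ?gt_eqF// mul1r cisD cis_int mulr1. Qed.

Definition petal (j : nat) : set M :=
  [set q | 4^-1 < rad q < 1 /\ sec N j%:R (pt q)].

(* The [c]-th petal merged with a neighbourhood of the [c]-th arc of the
   boundary circle: the merging leaves [3 k + 1] sets instead of [3 k + 4]. *)
Definition band (c : nat) : set M :=
  [set q | 4^-1 < rad q /\ (3 / 4 < rad q /\ sec 3 c%:R (set_val (wd q)) \/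
    rad q < 1 /\ sec N c%:R (pt q))].

Definition core : set M := [set q | rad q < 2^-1].

Lemma petalP j r t : 0 <= r <= 1 -> petal j (pol r t) <->
  4^-1 < r < 1 /\ exists m : int, `|t + N%:R * m%:~R - j%:R| < 2 / 3.
Proof.
move=> r01; rewrite /petal /= rad_pol//; split=> -[/andP[r4 r1]]; rewrite pt_pol.
- by move=> /sec_polarP sz; rewrite r4 r1; split=> //; apply: sz => //; lra.
- by case/andP: r01 => ->.
- by move=> tm; rewrite r4 r1; split=> //; apply/sec_polarP => //; lra.
- by case/andP: r01 => ->.
Qed.

Lemma bandP c r t : 0 <= r <= 1 -> band c (pol r t) <->
  4^-1 < r /\ ((3 / 4 < r /\ exists m : int, `|t + 3 * m%:~R - c%:R| < 2 / 3) \/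
    (r < 1 /\ exists m : int, `|t + N%:R * m%:~R - c%:R| < 2 / 3)).
Proof.
move=> r01; have /andP[r0 r1] := r01.
have up : 4^-1 < r -> sec 3 c%:R (set_val (wd (pol r t))) <->
    exists m : int, `|t + 3 * m%:~R - c%:R| < 2 / 3.
  move=> r4; rewrite wd_pol; last by rewrite r1 andbT; lra.
  by rewrite val_circle_cis -[cis _]mul1r -Rc1; exact: (@sec_polarP _ 3 c%:R isT _ _ ltr01).
have lo : 4^-1 < r -> r < 1 -> sec N c%:R (pt (pol r t)) <->
    exists m : int, `|t + N%:R * m%:~R - c%:R| < 2 / 3.
  by move=> r4 r1'; rewrite pt_pol ?r0//; apply: sec_polarP => //; lra.
rewrite /band /= rad_pol//; split=> -[r4 H]; split=> //.
  by case: H => -[h1 h2]; [left|right]; split=> //; [apply/up|apply/lo].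
by case: H => -[h1 h2]; [left|right]; split=> //; [apply/up|apply/lo].
Qed.

Lemma rad_open (a b : R) : open [set q : M | a < rad q < b].
Proof.
rewrite (_ : mkset _ = rad (k := k) @^-1` ([set t | a < t] `&` [set t | t < b])).
  apply: open_comp; first by move=> q _; exact: rad_continuous.
  by apply: openI; [exact: open_gt|exact: open_lt].
by apply/seteqP; split=> q /=; [move/andP|move=> [-> ->]].
Qed.

Lemma petal_open j : open (petal j).
Proof.
rewrite (_ : petal j = [set q | 4^-1 < rad q < 2] `&` [set q | rad q < 1 /\ sec N j%:R (pt q)]).
  by apply: openI; [exact: rad_open|apply: pt_open => //; exact: sec_open].
apply/seteqP; split=> q; rewrite /petal /=.
  by move=> [/andP[-> r1] s]; rewrite r1 /=; split=> //; lra.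
by move=> [/andP[-> _] [-> s]].
Qed.

Lemma sec_scale (n c : nat) (z : C) (r : R) : 0 < r ->
  sec n c%:R (z * Rc r) <-> sec n c%:R z.
Proof.
move=> r0; rewrite /sec /mkset; set e := cis _.
have -> : z * Rc r * e = z * e * Rc r by rewrite mulrAC.
have reS w : re (w * Rc r) = re w * r by rewrite reM reRc imRc mulr0 subr0.
have imS w : im (w * Rc r) = im w * r by rewrite imM reRc imRc mulr0 add0r.
have -> : turn (z * e * Rc r) = turn (z * e).
  by rewrite /turn reS imS -mulf_div mulfV ?mulr1// gt_eqF.
by rewrite reS pmulr_lgt0.
Qed.

Lemma expc_continuous n : continuous (fun z : C => z ^+ n).
Proof.
elim: n => [|n IH] z; have Fz := nbhs_filter z.
  by rewrite (_ : (fun _ => _) = cst 1); [exact: cvg_cst|apply/funext].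
rewrite (_ : (fun _ => _) = fun z => z * z ^+ n).
  by apply: cvgM; [exact: cvg_id|exact: IH].
by apply/funext => w; rewrite exprS.
Qed.

(** On the disk [wd] is the power of exponent [k] up to a positive factor, which sectors ignore; so
    the condition pulls back along a continuous map. *)
Lemma up_open (a : R) c : 0 < a -> open [set q : M | a < rad q /\ sec 3 c%:R (set_val (wd q))].
Proof.
move=> a0; apply: mooreE.
  have [a1|a1] := ltP a 1; last first.
    rewrite (_ : _ @^-1` _ = set0); first exact: open0.
    by apply/seteqP; split=> w //= []; rewrite rad_circ; lra.
  rewrite (_ : _ @^-1` _ = set_val @^-1` (sec 3 c%:R : set C)).
    apply: open_comp; last exact: sec_open.
    by move=> w _; exact: val_continuous.
  by apply/seteqP; split=> w /=; rewrite rad_circ wd_circ; [move=> []|].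
rewrite (_ : _ @^-1` _ = (fun z : D2 => set_val z) @^-1` (([set z | a < cmod z]) `&`
    (fun z : C => z ^+ k) @^-1` (sec 3 c%:R : set C))).
  apply: open_comp; first by move=> z _; exact: val_continuous.
  apply: openI.
    apply: (@open_comp _ _ (@cmod R) [set t | a < t]); last exact: open_gt.
    by move=> z _; exact: cmod_continuous.
  apply: open_comp; last exact: sec_open.
  by move=> z _; exact: expc_continuous.
have key (z : D2) : a < cmod (set_val z) ->
    sec 3 c%:R (set_val (wd (mkD k (set_val z)))) <-> sec 3 c%:R (set_val z ^+ k).
  move=> az; have z1 := disk_cmod z; have z0 : 0 < cmod (set_val z) by lra.
  rewrite wd_mkD//.
  rewrite (_ : set_val (circle_pow k (toC _)) =
      set_val z ^+ k * Rc ((cmod (set_val z))^-1 ^+ k)).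
    by apply: sec_scale; rewrite exprn_gt0// invr_gt0.
  rewrite /circle_pow /= set_valE /= /toC_val -cmod_eq0 gt_eqF// exprMn.
  by congr (_ * _); elim: (k) => [//|i IH]; rewrite !exprS RcM IH.
by apply/seteqP; split=> z /=; rewrite rad_mkD ?disk_cmod// => -[az] /(key _ az).
Qed.

Lemma band_open c : open (band c).
Proof.
rewrite (_ : band c = [set q | 3 / 4 < rad q /\ sec 3 c%:R (set_val (wd q))] `|`
  ([set q | 4^-1 < rad q < 2] `&` [set q | rad q < 1 /\ sec N c%:R (pt q)])).
  apply: openU; first by apply: up_open; lra.
  by apply: openI; [exact: rad_open|apply: pt_open => //; exact: sec_open].
apply/seteqP; split=> q; rewrite /band /=.
  by move=> [r4 [[r3 s]|[r1 s]]]; [left|right; split; [apply/andP; split; lra|]].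
by move=> [[r3 s]|[/andP[r4 _] [r1 s]]]; split; [lra|left|lra|right].
Qed.

Lemma core_open : open core.
Proof.
apply: (@open_comp _ _ (rad (k := k)) [set t | t < 2^-1]); last exact: open_lt.
by move=> q _; exact: rad_continuous.
Qed.


Lemma int_uniq (n : nat) (m m' : int) : (3 <= n)%N ->
  `|n%:R * m%:~R - n%:R * m'%:~R : R| < 3 -> m = m'.
Proof.
move=> n3; have n3' : (3 : R) <= n%:R by rewrite ler_nat.
rewrite -mulrBr -intrB ltr_norml => /andP[h1 h2].
have [] : (-1 < (m - m')%:~R :> R) /\ ((m - m')%:~R < 1 :> R) by split; nra.
rewrite -[1]/(1%:~R) -mulrNz !ltr_int; lia.
Qed.

Lemma conv_lt (a b c s : R) : 0 <= s <= 1 -> a < c -> b < c ->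
  (1 - s) * a + s * b < c.
Proof.
move=> /andP[s0 s1] ac bc; have [->|sn0] := eqVneq s 0; first by lra.
have sp : 0 < s by rewrite lt_neqAle eq_sym sn0.
have h1 : 0 < s * (c - b) by apply: mulr_gt0 => //; lra.
have h2 : 0 <= (1 - s) * (c - a) by apply: mulr_ge0; lra.
lra.
Qed.

Lemma conv_dist (a b c e s : R) : 0 <= s <= 1 ->
  `|a - c| < e -> `|b - c| < e -> `|(1 - s) * a + s * b - c| < e.
Proof.
move=> s01; rewrite !ltr_norml => /andP[a1 a2] /andP[b1 b2].
have -> : (1 - s) * a + s * b - c = (1 - s) * (a - c) + s * (b - c) by ring.
rewrite conv_lt// andbT -ltrN2 opprK.
have -> : - ((1 - s) * (a - c) + s * (b - c)) = (1 - s) * (c - a) + s * (c - b) by ring.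
by apply: conv_lt => //; lra.
Qed.

(** Convexity in the polar coordinates of the petal [j], angles being lifted near [j]. It passes to
    intersections, so all intersections contained in a petal are treated at once. *)
Definition tconv (j : nat) (D : set M) := forall r r' t t' s,
  4^-1 < r < 1 -> 4^-1 < r' < 1 -> `|t - j%:R| < 2 / 3 -> `|t' - j%:R| < 2 / 3 ->
  0 <= s <= 1 -> D (pol r t) -> D (pol r' t') ->
  D (pol ((1 - s) * r + s * r') ((1 - s) * t + s * t')).

(** The two translates differ by less than 4 times 2/3, hence by less than 3, so they are equal; a
    segment of lifted angles then stays near [c]. *)
Lemma conv_near (n : nat) (j c t t' s : R) (m m' : int) : (3 <= n)%N ->
  `|t - j| < 2 / 3 -> `|t' - j| < 2 / 3 -> 0 <= s <= 1 ->
  `|t + n%:R * m%:~R - c| < 2 / 3 -> `|t' + n%:R * m'%:~R - c| < 2 / 3 ->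
  m = m' /\ `|(1 - s) * t + s * t' + n%:R * m%:~R - c| < 2 / 3.
Proof.
move=> n3 tj tj' s01 tm tm'.
have mm' : m = m'.
  by apply: (int_uniq n3); move: tj tj' tm tm'; rewrite !ltr_norml; lra.
split=> //; rewrite -mm' in tm'.
have -> : (1 - s) * t + s * t' + n%:R * m%:~R - c =
    (1 - s) * (t + n%:R * m%:~R) + s * (t' + n%:R * m%:~R) - c by ring.
exact: conv_dist.
Qed.

Lemma conv_rad (a b r r' s : R) : 0 <= s <= 1 -> a < r < b -> a < r' < b ->
  a < (1 - s) * r + s * r' < b.
Proof.
move=> s01 /andP[r1 r2] /andP[r1' r2']; rewrite [X in _ && X]conv_lt// andbT -ltrN2.
have -> : - ((1 - s) * r + s * r') = (1 - s) * - r + s * - r' by ring.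
by apply: conv_lt => //; rewrite ltrN2.
Qed.

Lemma tconv_petal j j' : tconv j (petal j').
Proof.
move=> r r' t t' s r1 r1' tj tj' s01.
move=> /petalP[|_ [m tm]]; first by lra.
move=> /petalP[|_ [m' tm']]; first by lra.
have r2 := conv_rad s01 r1 r1'.
apply/petalP; first by lra.
split=> //; exists m.
by have [] := conv_near N3 tj tj' s01 tm tm'.
Qed.

Lemma tconv_core j : tconv j core.
Proof.
move=> r r' t t' s r1 r1' _ _ s01; have r2 := conv_rad s01 r1 r1'.
rewrite /core /= !rad_pol; [|lra|lra|lra] => h h'.
exact: conv_lt.
Qed.

Lemma tconv_band j c : tconv j (band c).
Proof.
move=> r r' t t' s r1 r1' tj tj' s01.
have r2 := conv_rad s01 r1 r1'.
have N3E (m : int) : N%:R * m%:~R = 3 * (k%:Z * m)%:~R :> R.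
  by rewrite natrM intrM -mulrA.
move=> /bandP[|r4 H]; first by lra.
move=> /bandP[|r4' H']; first by lra.
apply/bandP; first by lra.
split; first by lra.
case: H H' => [[r3 [m tm]]|[_ [m tm]]] [[r3' [m' tm']]|[_ [m' tm']]].
- left; split.
    have r3r : 3 / 4 < r < 1 by rewrite r3; lra.
    have r3r' : 3 / 4 < r' < 1 by rewrite r3'; lra.
    by have /andP[] := conv_rad s01 r3r r3r'.
  by exists m; have [] := @conv_near 3 _ _ _ _ _ _ _ isT tj tj' s01 tm tm'.
(* One point satisfies the condition modulo 3 and the other modulo 3k. As the translates must agree,
   the first point also satisfies it modulo 3k, and the segment stays in the inner sector. *)
- right; split; first by lra.
  exists m'; rewrite N3E in tm' *.
  by have [<-] := @conv_near 3 _ _ _ _ _ _ _ isT tj tj' s01 tm tm'.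
- right; split; first by lra.
  exists m; rewrite N3E in tm *.
  by have [_] := @conv_near 3 _ _ _ _ _ _ _ isT tj tj' s01 tm tm'.
- right; split; first by lra.
  by exists m; have [] := conv_near N3 tj tj' s01 tm tm'.
Qed.

Lemma cmod_pt (q : M) : rad q < 1 -> cmod (pt q) = rad q.
Proof.
by have [z z1 ->] := moore_surj k2 q; rewrite rad_mkD// => z1'; rewrite pt_mkD.
Qed.

Lemma petal_polar j q : petal j q ->
  let t := chart N j%:R (pt q) in q = pol (rad q) t /\ `|t - j%:R| < 2 / 3.
Proof.
move=> [/andP[r4 r1] sq] t; split; last exact: chart_bound.
rewrite -[LHS](mkD_pt k2)// /pol; congr mkD.
rewrite [LHS](sec_polar N3 sq); congr (Rc _ * _).
by rewrite cmod_pt.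
Qed.

(** A straight-line contraction to [q0] in polar coordinates. *)
Lemma contractible_petal j (S : set M) (q0 : M) : S q0 -> S `<=` petal j -> tconv j S ->
  contractible R S.
Proof.
move=> Sq0 ST cS.
pose th (q : M) := chart N j%:R (pt q).
pose H (q : M) (s : R) := pol ((1 - s) * rad q + s * rad q0) ((1 - s) * th q + s * th q0).
have [E0 b0] := petal_polar (ST _ Sq0); have [r0 _] := ST _ Sq0.
apply: (@contractible_raw _ _ _ H q0) => //.
- apply: (@within_comp _ _ _ _ [set: (R * R)%type]
    (fun p : M * R => ((1 - p.2) * rad p.1 + p.2 * rad q0,
       (1 - p.2) * th p.1 + p.2 * th q0)) (fun p => pol p.1 p.2)) => //; last first.
    by apply: continuous_subspaceT; exact: pol_continuous.
  apply: within_pair.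
    apply: (@within_comp _ _ _ _ [set: (R * R)%type]
      (fun p : M * R => (rad p.1, p.2)) (fun p => (1 - p.2) * p.1 + p.2 * rad q0)) => //.
      apply: within_pair; apply: continuous_subspaceT => p; last exact: cvg_snd.
      by apply: continuous_comp; [exact: cvg_fst|exact: rad_continuous].
    by apply: continuous_subspaceT; exact: interp_continuous.
  apply: (@within_comp _ _ _ _ [set: (R * R)%type]
    (fun p : M * R => (th p.1, p.2)) (fun p => (1 - p.2) * p.1 + p.2 * th q0)) => //.
    apply: within_pair; last by apply: continuous_subspaceT => p; exact: cvg_snd.
    apply: (@within_comp _ _ _ _ (petal j) fst th); last by move=> [q t] [/ST].
      by apply: continuous_subspaceT => p; exact: cvg_fst.
    apply: (@within_comp _ _ _ _ (sec N j%:R : set C) (@pt R k) (chart N j%:R)).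
    + by apply: continuous_subspaceW (pt_continuous (k := k)) => q [/andP[]].
    + exact: chart_continuous.
    + by move=> q [].
  by apply: continuous_subspaceT; exact: interp_continuous.
- move=> q s Sq s01; have [Eq bq] := petal_polar (ST _ Sq); have [rq _] := ST _ Sq.
  by apply: cS => //; rewrite -?Eq -?E0.
- move=> q Sq; have [Eq bq] := petal_polar (ST _ Sq).
  by rewrite /H subr0 !mul1r !mul0r !addr0 -Eq.
- by move=> q Sq; rewrite /H subrr !mul0r !mul1r !add0r -E0.
Qed.

Lemma contractible_core : contractible R core.
Proof.
have c0 := @cmod0 R.
pose H (q : M) (s : R) := mkD k (pt q * Rc (1 - s)).
apply: (@contractible_raw _ _ _ H (mkD k 0)).
- by rewrite /core /= rad_mkD c0 ?ler01//; lra.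
- apply: (@within_comp _ _ _ _ [set: C] (fun p : M * R => pt p.1 * Rc (1 - p.2)) (mkD k)) => //.
    apply: (@within_comp _ _ _ _ [set: (C * R)%type] (fun p : M * R => (pt p.1, p.2))
      (fun p : C * R => p.1 * Rc (1 - p.2))) => //.
      apply: within_pair; last by apply: continuous_subspaceT => p; exact: cvg_snd.
      apply: (@within_comp _ _ _ _ [set q : M | rad q < 1] fst (@pt R k)).
      + by apply: continuous_subspaceT => p; exact: cvg_fst.
      + exact: pt_continuous.
      + by move=> [q t] [/= Oq _]; move: Oq; rewrite /core /=; lra.
    apply: continuous_subspaceT => p; have Fp := nbhs_filter p.
    apply: cvgM; first exact: cvg_fst.
    apply: continuous_cvg; first exact: Rc_continuous.
    by apply: cvgB; [exact: cvg_cst|exact: cvg_snd].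
  by apply: continuous_subspaceT; exact: mkD_continuous.
- move=> q s; rewrite /core /= => Oq /andP[s0 s1].
  have q1 : rad q < 1 by lra.
  have [z z1 E1] := moore_surj k2 q.
  have rz : rad q = cmod z by rewrite E1 rad_mkD.
  have zc : cmod (z * Rc (1 - s)) <= cmod z.
    rewrite cmodM cmodRc ger0_norm ?subr_ge0//.
    by have := cmod_ge0 z; nra.
  rewrite /H E1 pt_mkD -?rz// rad_mkD; last by lra.
  by apply: le_lt_trans zc _; rewrite -rz.
- move=> q; rewrite /core /= => Oq.
  by rewrite /H subr0 Rc1 mulr1 mkD_pt//; lra.
- by move=> q _; rewrite /H subrr Rc0 mulr0.
Qed.

Lemma band_near c r t : 0 <= r <= 1 -> band c (pol r t) ->
  4^-1 < r /\ exists m : int, `|t + 3 * m%:~R - c%:R| < 2 / 3.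
Proof.
move=> r01 /bandP[//|r4 [[_ H]|[_ [m tm]]]]; split=> //.
by exists (k%:Z * m); rewrite intrM mulrA -natrM.
Qed.

Lemma chart_scale (n : nat) (j : R) (z : C) (r : R) : 0 < r ->
  chart n j (Rc r * z) = chart n j z.
Proof.
move=> r0; rewrite /chart -mulrA; set w := z * _.
rewrite /turn reM imM reRc imRc !(mul0r, subr0, addr0).
by rewrite -mulf_div mulfV ?mul1r// gt_eqF.
Qed.

Lemma within_mul (X : topologicalType) (D : set X) (f g : X -> C) :
  {within D, continuous f} -> {within D, continuous g} ->
  {within D, continuous (fun x => f x * g x)}.
Proof. by move=> cf cg x; apply: cvgM; [exact: cf|exact: cg]. Qed.

Section Arc.
Variables (c0 : nat) (phi0 : R).

(** The angle on the attached circle, lifted near [c0]. Unlike the angle in the disk it makes sense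
    up to the boundary. *)
Definition arg (q : M) : R := chart 3 c0%:R (set_val (wd q)).

Lemma band_arg r t : 0 <= r <= 1 -> band c0 (pol r t) ->
  [/\ sec 3 c0%:R (set_val (wd (pol r t))), `|arg (pol r t) - c0%:R| < 2 / 3 &
    exists m : int, arg (pol r t) = t + 3 * m%:~R].
Proof.
move=> r01 /(band_near r01)[r4 [m tm]].
have r1 : 0 < r <= 1 by case/andP: r01 => _ ->; rewrite andbT; lra.
have E1 : set_val (wd (pol r t)) = Rc 1 * cis ((t + 3 * m%:~R) / 3).
  by rewrite wd_pol// val_circle_cis Rc1 mul1r mulrDl mulrAC mulfV// mul1r cisD cis_int mulr1.
rewrite /arg E1; have [s0 ->] := @polar_sec _ 3 _ isT _ _ (@ltr01 R) tm.
by split=> //; exists m.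
Qed.

Definition rt (q : M) : R * R :=
  sval (cid (P := fun x : R * R => 0 <= x.1 <= 1 /\ q = pol x.1 x.2)
    (let: ex_intro r (ex_intro t H) := pol_surj q in ex_intro _ (r, t) H)).

(* On the boundary circle the second component of [rt q] is only determined up
   to a multiple of [3]; the value of [slide] does not depend on it. *)
Definition slide (q : M) (s : R) : M :=
  pol ((1 - s) * (rt q).1 + s * 1) ((rt q).2 + s * (phi0 - arg q)).

(** Two polar descriptions of a point differ by a multiple of 3k in the angle inside the disk, and
    of 3 on the boundary; the slide is insensitive to both. *)
Lemma slideE r t s : 0 < r <= 1 ->
  slide (pol r t) s = pol ((1 - s) * r + s * 1) (t + s * (phi0 - arg (pol r t))).
Proof.
move=> r01; have [r0 r1] := andP r01.
rewrite /slide /rt; case: cid => -[r' t'] /= [r01' E1].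
have rr : r' = r by rewrite -(rad_pol t' r01') -E1 rad_pol// r1 ltW.
rewrite rr in E1 *; set x := s * (phi0 - _).
have [r1'|r1'] := ltP r 1.
  have [m Em] : exists m : int, t = t' + N%:R * m%:~R.
    have rn0 : Rc r != 0 by rewrite -Rc0 (inj_eq (@Rc_inj R)) gt_eqF.
    have := congr1 (@pt R k) E1; rewrite !pt_pol ?(ltW r0)// => /(mulfI rn0)/cis_inj[m Em].
    have Nn0 : N%:R != 0 :> R by rewrite gt_eqF.
    by exists m; rewrite -[LHS](divfK Nn0) Em mulrDl divfK// [m%:~R * _]mulrC.
  by rewrite Em addrAC pol_period.
(* A point of the boundary keeps radius 1 during the slide, so its angle matters only modulo 3. *)
have -> : r = 1 by lra.
rewrite (_ : (1 - s) * 1 + s * 1 = 1); last by ring.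
apply: pol1_eq; have := congr1 (@wd R k) E1; rewrite !wd_pol// => /circle_cis_inj[m Em].
rewrite -(circle_cis_int ((t' + x) / 3) m); congr circle_cis.
by rewrite !mulrDl Em; ring.
Qed.

(** An open set, as [coherent_homotopy] requires, containing the band [c0]. *)
Definition slide_dom : set M :=
  [set q | 4^-1 < rad q /\ sec 3 c0%:R (set_val (wd q))].

Lemma slide_continuous_disk :
  {within ((fun z : D2 => mkD k (set_val z)) @^-1` slide_dom) `*` I01,
     continuous (fun p => slide (mkD k (set_val p.1)) p.2)}.
Proof.
(* Rotating z / |z| by an increment avoids lifting the angle of the disk, which has no continuous
   choice over the [k] sheets; the increment only involves the power of z. *)
pose g (p : D2 * R) := mkD k (set_val (toC (set_val p.1)) *
  Rc ((1 - p.2) * cmod (set_val p.1) + p.2 * 1) *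
  cis (p.2 * (phi0 - chart 3 c0%:R (set_val p.1 ^+ k)) / N%:R)).
have polar_dom (z : D2) : slide_dom (mkD k (set_val z)) -> exists r t,
    [/\ 4^-1 < r <= 1, set_val z = Rc r * cis (t / N%:R) &
        sec 3 c0%:R (set_val z ^+ k) /\
        chart 3 c0%:R (set_val z ^+ k) = arg (pol r t)].
  move=> [rz sz]; have z1 := disk_cmod z; rewrite rad_mkD// in rz.
  have [t Et] := polar (set_val z).
  have EN : set_val z = Rc (cmod (set_val z)) * cis ((N%:R * t) / N%:R).
    by rewrite mulrAC mulfV ?mul1r// gt_eqF.
  exists (cmod (set_val z)), (N%:R * t); split=> //; first by rewrite rz.
  set r := cmod _ in EN rz z1 *.
  have r0 : 0 < r by lra.
  have zk : set_val z ^+ k = Rc (r ^+ k) * cis (N%:R * t / 3).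
    rewrite EN exprMn cisX angle_circle; congr (_ * _).
    by elim: (k) => [//|i IH]; rewrite !exprS RcM IH.
  have wz : set_val (wd (pol r (N%:R * t))) = cis (N%:R * t / 3).
    by rewrite wd_pol// r0.
  have rk0 : 0 < r ^+ k by rewrite exprn_gt0.
  rewrite zk chart_scale// /arg wz; split=> //.
  rewrite mulrC; apply/sec_scale => //; rewrite -wz.
  by move: sz; rewrite /pol -EN.
apply: (@subspace_eq_continuous _ _ _ g).
  move=> -[z s]; rewrite inE => -[/= Dz Is]; rewrite /from_subspace /g /=.
  have [r [t [/andP[r4 r1] zE [_ ->]]]] := polar_dom z Dz.
  have r0 : 0 < r by lra.
  rewrite zE -/(pol r t) slideE ?r0// toC_polar// cmod_polar ?ltW// val_circle_cis.
  rewrite /pol; congr (mkD _ _); rewrite [(t + _) / _]mulrDl cisD mulrA; congr (_ * _).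
  by rewrite mulrC.
apply: (@within_comp _ _ _ _ [set: C] _ (mkD k)) => //; last first.
  by apply: continuous_subspaceT; exact: mkD_continuous.
apply: within_mul; first apply: within_mul.
- apply: (@within_comp _ _ _ _ [set: S1] (fun p : D2 * R => toC (set_val p.1)) set_val) => //.
    apply: (@within_comp _ _ _ _ [set z | z != 0] (fun p : D2 * R => set_val p.1) (@toC R)).
    + apply: continuous_subspaceT => p.
      by apply: continuous_comp; [exact: cvg_fst|exact: val_continuous].
    + exact: toC_continuous.
    + move=> [z s] [/= Dz _]; have [r [t [/andP[r4 r1] -> _]]] := polar_dom z Dz.
      by rewrite -cmod_eq0 cmod_polar; lra.
  by apply: continuous_subspaceT; exact: val_continuous.
- apply: continuous_subspaceT => p.
  apply: continuous_cvg; first exact: Rc_continuous.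
  apply: (@continuous_comp _ _ _ (fun p : D2 * R => (cmod (set_val p.1), p.2))
    (fun p : R * R => (1 - p.2) * p.1 + p.2 * 1)); last exact: interp_continuous.
  move: p; apply: continuous_pair => p; last exact: cvg_snd.
  apply: (@continuous_comp _ _ _ (fun p : D2 * R => set_val p.1) (@cmod R)).
    by apply: continuous_comp; [exact: cvg_fst|exact: val_continuous].
  exact: cmod_continuous.
apply: (@within_comp _ _ _ _ [set: (R * R)%type]
  (fun p : D2 * R => (chart 3 c0%:R (set_val p.1 ^+ k), p.2))
  (fun p : R * R => cis (p.2 * (phi0 - p.1) / N%:R))) => //.
  apply: within_pair; last by apply: continuous_subspaceT => p; exact: cvg_snd.
  apply: (@within_comp _ _ _ _ (sec 3 c0%:R : set C)
    (fun p : D2 * R => set_val p.1 ^+ k) (chart 3 c0%:R)).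
  - apply: continuous_subspaceT => p.
    apply: (@continuous_comp _ _ _ (fun p : D2 * R => set_val p.1) (fun z : C => z ^+ k)).
      by apply: continuous_comp; [exact: cvg_fst|exact: val_continuous].
    exact: expc_continuous.
  - exact: chart_continuous.
  - by move=> [z s] [/= Dz _]; have [r [t [_ _ []]]] := polar_dom z Dz.
apply: continuous_subspaceT => p.
apply: continuous_cvg; first exact: cis_continuous.
apply: cvgMr_tmp; apply: cvgM; first exact: cvg_snd.
by apply: cvgB; [exact: cvg_cst|exact: cvg_fst].
Qed.

Lemma slide_continuous_circ :
  {within (circ k @^-1` slide_dom) `*` I01, continuous (fun p => slide (circ k p.1) p.2)}.
Proof.
pose g (p : S1 * R) :=
  pol 1 ((1 - p.2) * chart 3 c0%:R (set_val p.1) + p.2 * phi0).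
apply: (@subspace_eq_continuous _ _ _ g).
  move=> -[w s]; rewrite inE => -[/= [_ sw] Is]; rewrite /from_subspace /g /=.
  rewrite wd_circ in sw; have [t wt] := circle_cis_surj w.
  have cw : circ k w = pol 1 (3 * t).
    rewrite /pol Rc1 mul1r -[cis _]val_circle_cis -circ_pow circle_pow_cis angle_circle wt.
    by congr (circ k (circle_cis _)); field.
  have argw : arg (pol 1 (3 * t)) = chart 3 c0%:R (set_val w) by rewrite /arg -cw wd_circ.
  rewrite cw slideE ?ltr01 ?lexx// argw (_ : (1 - s) * 1 + s * 1 = 1); last by ring.
  have := @sec_polar _ 3 _ isT _ sw; rewrite circle_cmod Rc1 mul1r wt val_circle_cis => /cis_inj[m Em].
  set phi := chart _ _ _ in Em *; apply: pol1_eq.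
  rewrite -[LHS](circle_cis_int _ m); congr circle_cis.
  by rewrite Em; field.
apply: (@within_comp _ _ _ _ [set: R] (fun p : S1 * R =>
  (1 - p.2) * chart 3 c0%:R (set_val p.1) + p.2 * phi0) (pol 1)) => //; last first.
  apply: continuous_subspaceT => t.
  apply: (@continuous_comp _ _ _ (fun t : R => (1 : R, t)) (fun p : R * R => pol p.1 p.2)).
    by move: t; apply: continuous_pair => t; [exact: cvg_cst|exact: cvg_id].
  exact: pol_continuous.
apply: (@within_comp _ _ _ _ [set: (R * R)%type]
  (fun p : S1 * R => (chart 3 c0%:R (set_val p.1), p.2))
  (fun p : R * R => (1 - p.2) * p.1 + p.2 * phi0)) => //.
  apply: within_pair; last by apply: continuous_subspaceT => p; exact: cvg_snd.
  apply: (@within_comp _ _ _ _ (sec 3 c0%:R : set C)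
    (fun p : S1 * R => set_val p.1) (chart 3 c0%:R)).
  - apply: continuous_subspaceT => p.
    by apply: continuous_comp; [exact: cvg_fst|exact: val_continuous].
  - exact: chart_continuous.
  - by move=> [w s] [/= [_ sw] _]; rewrite wd_circ in sw.
by apply: continuous_subspaceT; exact: interp_continuous.
Qed.

Lemma slide_continuous : {within slide_dom `*` I01, continuous (fun p => slide p.1 p.2)}.
Proof.
apply: (coherent_homotopy (p1 := fun z : D2 => mkD k (set_val z)) (p2 := circ k)).
- by move=> U oD oC; apply: mooreE.
- by move=> z; apply: continuous_comp; [exact: val_continuous|exact: mkD_continuous].
- exact: circ_continuous.
- move=> q; left; have [z z1 ->] := moore_surj k2 q.
  by exists (toD z); rewrite val_toD.
- by apply: up_open; lra.
- exact: slide_continuous_disk.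
- exact: slide_continuous_circ.
Qed.

End Arc.

(** Fix one band [c0] to lift all angles. Every point slides outwards to the boundary while its
    lifted angle moves linearly to that of [q0]; since both ends lie near every [c] in [J], so do
    the angles in between. *)
Lemma contractible_bands (J : set nat) (q0 : M) : J !=set0 ->
  (forall c, J c -> band c q0) ->
  contractible R [set q | forall c, J c -> band c q].
Proof.
move=> [c0 Jc0] Bq0.
have [r0 [t0 [r01 E0]]] := pol_surj q0; rewrite E0 in Bq0.
have [_ phi0c [m0 Em0]] := band_arg r01 (Bq0 _ Jc0).
set phi0 := arg c0 _ in phi0c Em0.
have key r t c s : 0 <= r <= 1 -> band c0 (pol r t) -> J c -> 0 <= s <= 1 ->
    forall m : int, `|t + 3 * m%:~R - c%:R| < 2 / 3 ->
    `|t + s * (phi0 - arg c0 (pol r t)) + 3 * m%:~R - c%:R| < 2 / 3.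
  move=> r01' Br Jc s01 m tm.
  have [_ ac [m1 Em1]] := band_arg r01' Br.
  have [_ [m' tm']] := band_near r01 (Bq0 _ Jc).
  set a := arg _ _ in ac Em1 *.
  (* The conditions at the moving point and at [q0], restated for their angles lifted near [c0], as
     [conv_near] needs. *)
  have h1 : `|a + 3%:R * (m - m1)%:~R - c%:R| < 2 / 3.
    rewrite (_ : _ - c%:R = t + 3 * m%:~R - c%:R)//.
    by rewrite Em1 intrB; ring.
  have h2 : `|phi0 + 3%:R * (m' - m0)%:~R - c%:R| < 2 / 3.
    rewrite (_ : _ - c%:R = t0 + 3 * m'%:~R - c%:R)//.
    by rewrite Em0 intrB; ring.
  have [_] := @conv_near 3 _ _ _ _ _ _ _ isT ac phi0c s01 h1 h2.
  rewrite intrB (_ : _ - c%:R = t + s * (phi0 - a) + 3 * m%:~R - c%:R)//.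
  by rewrite Em1; ring.
have r4 r t : 0 <= r <= 1 -> band c0 (pol r t) -> 4^-1 < r.
  by move=> r01' /(band_near r01')[].
apply: (@contractible_raw _ _ _ (slide c0 phi0) (pol 1 phi0)).
- move=> c Jc; apply/bandP; first by rewrite ler01 lexx.
  split; first by lra.
  left; split; first by lra.
  have [_ [m tm]] := band_near r01 (Bq0 _ Jc).
  exists (m - m0); rewrite (_ : _ - c%:R = t0 + 3 * m%:~R - c%:R)//.
  by rewrite Em0 intrB; ring.
- apply: (@within_openS _ _ _ (slide_dom c0 `*` I01)); last exact: slide_continuous.
  move=> [q s] [/= Sq Is]; split=> //.
  have [r [t [r01' E1]]] := pol_surj q; have := Sq _ Jc0; rewrite E1 => Br.
  split; first by rewrite rad_pol//; exact: r4 Br.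
  by have [] := band_arg r01' Br.
- move=> q s Sq s01 c Jc; have [r [t [r01' E1]]] := pol_surj q; rewrite E1 in Sq *.
  have Br0 := Sq _ Jc0; have rr := r4 _ _ r01' Br0; have [r0' r1'] := andP r01'.
  have [s0 s1] := andP s01.
  rewrite slideE; last by rewrite r1' andbT; lra.
  have b2 : 4^-1 < (1 - s) * r + s * 1 by nra.
  have b1 : (1 - s) * r + s * 1 <= 1 by nra.
  apply/bandP; first by lra.
  split=> //; have /bandP[//|_ [[r3 [m tm]]|[_ [m tm]]]] := Sq _ Jc.
    left; split; first by nra.
    by exists m; apply: key.
  have NE : N%:R * m%:~R = 3 * (k%:Z * m)%:~R :> R by rewrite natrM intrM -mulrA.
  rewrite NE in tm; have := key _ _ _ _ r01' Br0 Jc s01 _ tm => tm'.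
  (* Below radius 1 the condition modulo 3k persists; on the boundary only its reduction modulo 3 is
     required. *)
  have [h|h] := ltP ((1 - s) * r + s * 1) 1; [right|left]; split=> //.
  + by exists m; rewrite NE.
  + by lra.
  + by exists (k%:Z * m).
- move=> q Sq; have [r [t [r01' E1]]] := pol_surj q; rewrite E1 in Sq *.
  have rr := r4 _ _ r01' (Sq _ Jc0); have [r0' r1'] := andP r01'.
  rewrite slideE; last by rewrite r1' andbT; lra.
  by rewrite subr0 mul1r !mul0r !addr0.
- move=> q Sq; have [r [t [r01' E1]]] := pol_surj q; rewrite E1 in Sq *.
  have Br0 := Sq _ Jc0; have rr := r4 _ _ r01' Br0; have [r0' r1'] := andP r01'.
  rewrite slideE; last by rewrite r1' andbT; lra.
  rewrite subrr !mul0r !mul1r !add0r; apply: pol1_eq.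
  have [_ _ [m1 ->]] := band_arg r01' Br0.
  by rewrite -[LHS](circle_cis_int _ m1); congr circle_cis; field.
Qed.

Definition member (i : nat) : set M :=
  if (i < 3)%N then band i else if (i < N)%N then petal i else core.

(** Rounding [t] to an integer costs at most 1/2, which is less than 2/3; the integer is then
    reduced modulo 3k. *)
Lemma nearest (t : R) : exists2 i : nat, (i < N)%N &
  exists m : int, `|t + N%:R * m%:~R - i%:R| < 2 / 3.
Proof.
pose f := Num.floor (t + 2^-1).
have f1 : f%:~R <= t + 2^-1 by exact: floor_le.
have f2 : t + 2^-1 < f%:~R + 1 by have := lt_succ_floor (t + 2^-1); rewrite intrD1.
have N0' : (N%:Z != 0) by lia.
have fE := divz_eq f N%:Z.
have fm0 := modz_ge0 f N0'; have fm1 := ltz_mod f N0'.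
exists `|(f %% N%:Z)%Z|%N; first by lia.
exists (- (f %/ N%:Z)%Z).
have -> : (`|(f %% N%:Z)%Z|%N%:R : R) = ((f %% N%:Z)%Z)%:~R.
  by rewrite -[in RHS](gez0_abs fm0).
have fE' : f%:~R = (f %/ N%:Z)%Z%:~R * N%:R + (f %% N%:Z)%Z%:~R :> R.
  by rewrite {1}fE intrD intrM.
rewrite mulrNz ltr_norml; apply/andP; split; nra.
Qed.

Lemma moore1_covered : covered R M (3 * k).+1.
Proof.
have mB i : (i < 3)%N -> member i = band i by rewrite /member => ->.
have mT i : (3 <= i < N)%N -> member i = petal i.
  by rewrite /member leqNgt => /andP[/negbTE -> ->].
have mO : member N = core.
  by rewrite /member ltnn ifF//; apply/negbTE; rewrite -leqNgt; lia.
have mm A : (member @` `I_N.+1) A -> [\/ A = core,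
    exists2 c, (c < 3)%N & A = band c | exists2 j, (3 <= j < N)%N & A = petal j].
  move=> [i /= iN <-]; case: (ltnP i 3) => i3.
    by apply: Or32; exists i => //; exact: mB.
  case: (ltnP i N) => iN'; last by apply: Or31; rewrite -mO; congr member; lia.
  by apply: Or33; exists i; [rewrite i3|apply: mT; rewrite i3].
have half01 : 0 <= (2^-1 : R) <= 1 by lra.
have near0 (i n : nat) : `|i%:R + n%:R * (0 : int)%:~R - i%:R : R| < 2 / 3.
  by rewrite mulr0 addr0 subrr normr0; lra.
exists member; apply: good_coverI.
- move=> A /mm[->|[c _ ->]|[j _ ->]]; [exact: core_open|exact: band_open|exact: petal_open].
- move=> q; have [r [t [r01 ->]]] := pol_surj q; have [r0 r1] := andP r01.
  have [r2|r2] := ltP r 2^-1.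
    exists core; last by rewrite /core /= rad_pol.
    by exists N => //=; rewrite ltnSn.
  have [i iN [m tm]] := nearest t.
  have [i3|i3] := ltnP i 3.
    exists (band i); first by exists i; [rewrite /= ltnW|exact: mB].
    apply/bandP => //; split; first by lra.
    have [r1'|r1'] := ltP r 1; first by right; split=> //; exists m.
    left; split; first by lra.
    exists (k%:Z * m); have -> : 3 * (k%:Z * m)%:~R = N%:R * m%:~R :> R.
      by rewrite natrM intrM mulrA.
    exact: tm.
  have [r1'|r1'] := ltP r 1.
    exists (petal i); first by exists i; [rewrite /= ltnW|rewrite mT// i3].
    by apply/petalP => //; split; [lra|exists m].
  (* On the boundary, which petals do not reach, the angle matters only modulo 3, so a band takes
     over. *)
  pose c := (i %% 3)%N; have c3 : (c < 3)%N by rewrite ltn_mod.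
  exists (band c); first by exists c; [rewrite /=; lia|exact: mB].
  apply/bandP => //; split; first by lra.
  left; split; first by lra.
  exists (k%:Z * m - Posz (i %/ 3)).
  have iE : (i%:R : R) = 3 * (i %/ 3)%N%:R + c%:R.
    by rewrite {1}(divn_eq i 3) natrD natrM mulrC.
  rewrite (_ : _ - c%:R = t + N%:R * m%:~R - i%:R)//.
  by rewrite iE intrB intrM natrM; ring.
- move=> A /mm[->|[c _ ->]|[j _ ->]].
  + by exists (pol 0 0); rewrite /core /= rad_pol; lra.
  + exists (pol 2^-1 c%:R); apply/bandP => //; split; first by lra.
    by right; split; [lra|exists 0].
  + exists (pol 2^-1 j%:R); apply/petalP => //; split; first by lra.
    by exists 0.
move=> W WG [A0 WA0] [q0 Wq0].
have tW j : (\bigcap_(A in W) A) `<=` petal j -> contractible R (\bigcap_(A in W) A).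
  move=> WT; apply: (contractible_petal Wq0 WT) => r r' t t' s h1 h2 h3 h4 h5 H H' A WA.
  have /mm[E|[c _ E]|[i _ E]] := WG _ WA; rewrite E in WA *.
  - by apply: (@tconv_core j) => //; [exact: H|exact: H'].
  - by apply: (@tconv_band j) => //; [exact: H|exact: H'].
  - by apply: (@tconv_petal j) => //; [exact: H|exact: H'].
(* Once a petal takes part, convexity in its polar coordinates settles the intersection. *)
have [[j [j3 WT]]|noT] := pselect (exists j, (3 <= j < N)%N /\ W (petal j)).
  by apply: (tW j) => q; apply.
have [WO|noO] := pselect (W core).
  (* The core stops at radius 1/2 and the outer part of a band starts at 3/4, so core and band meet
     inside [petal c]. *)
  have [[c WB]|noB] := pselect (exists c, W (band c)).
    apply: (tW c) => q Wq; have := Wq _ WO; have := Wq _ WB.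
    rewrite /core /band /petal /= => -[h1 [[h2 _]|[h2 h3]]] h4; first by lra.
    by rewrite h1 h2.
  rewrite (_ : \bigcap_(A in W) A = core); first exact: contractible_core.
  apply/seteqP; split=> q; first by apply.
  move=> Oq A WA; have /mm[->//|[c _ E]|[j j3 E]] := WG _ WA; rewrite E in WA.
  - by case: noB; exists c.
  - by case: noT; exists j.
(* Only bands are left, and these may reach the boundary circle. *)
pose J := [set c | W (band c)].
have WE : \bigcap_(A in W) A = [set q | forall c, J c -> band c q].
  apply/seteqP; split=> q Wq; first by move=> c; exact: Wq.
  move=> A WA; have /mm[E|[c _ E]|[j j3 E]] := WG _ WA; rewrite E in WA *.
  - by [].
  - exact: Wq.
  - by case: noT; exists j.
rewrite WE in Wq0 *; apply: (contractible_bands _ Wq0).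
have /mm[E|[c _ E]|[j j3 E]] := WG _ WA0; rewrite E in WA0.
- by [].
- by exists c.
- by case: noT; exists j.
Qed.

End MooreCover.

Lemma moore_inhabited (R : realType) (k i : nat) :
  exists x : iter i (suspension R) (moore_space1 R k), True.
Proof.
elim: i => [|i [x _]]; first by exists (mkD k 0).
by exists (sus x 0).
Qed.

Lemma moore_covered (R : realType) (k i : nat) : (1 <= i)%N -> (2 <= k)%N ->
  covered R (moore_space R k i) (i + 3 * k).
Proof.
case: i => // i _ k2; rewrite addSn /moore_space /=.
elim: i => [|i IH] /=; first by rewrite add0n; exact: moore1_covered.
by rewrite addSn; apply: suspension_covered => //; exact: moore_inhabited.
Qed.

Theorem proposition4p6 (R : realType) (i k : nat) :
  (1 <= i)%N -> (2 <= k)%N ->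
  ((i + 3)%N%:R%:E <= ct R (moore_space R k i) <= (i + 3 * k)%N%:R%:E)%E.
Proof.
move=> i1 k2; apply/andP; split; first exact: ct_moore_ge.
exact/ct_le/moore_covered.
Qed.
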